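(* Let $d\ge3$. There exists $\eta>0$ such that for every $\xi$ with $|\xi-\xi_o|<\eta$ the following holds, where $\theta$ is the unique solution of $\xi=\nabla\Lambda_c(\theta)$. There exists a $\mathcal{B}_0^+$-measurable function $u^\theta>0$ with $\int u^\theta\,\mathrm{d}\mathbb{P}=1$ and, $\mathbb{P}$-a.s., $$u^\theta(\omega)=\sum_{z\in U}\overline{\pi}(\omega,T_{1,z}\omega)\mathrm{e}^{\langle\theta,z\rangle-\Lambda_c(\theta)}u^\theta(T_{1,z}\omega).$$ Define the kernel $\overline{\pi}^\theta(\omega,T_{1,z}\omega):=\overline{\pi}(\omega,T_{1,z}\omega)\frac{u^\theta(T_{1,z}\omega)}{u^\theta(\omega)}\mathrm{e}^{\langle\theta,z\rangle-\Lambda_c(\theta)}$ on $\Omega$. Then $\mu_\xi^\infty$ is the unique stationary Markov process with transition kernel $\overline{\pi}^\theta$ whose marginal is absolutely continuous relative to $\mathbb{P}$ on every $\mathcal{B}_n^+$.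
   Context: Space-time RWRE on $\mathbb{Z}^d$: environment $\omega=(\omega_{n,x})_{n\in\mathbb{Z},x\in\mathbb{Z}^d}$, $\omega_{n,x}=(\pi_{n,n+1}(x,x+z))_{z\in U}$ probability vectors, $U:=\{z:|z_1|+\cdots+|z_d|=1\}$; the $\omega_{n,x}$ are i.i.d. under $\mathbb{P}$ and $\mathbb{P}(\pi_{0,1}(0,z)\ge c_1)=1$ for all $z\in U$, some $c_1>0$. Quenched law $P_{k,x}^\omega$ of the walk with $X_k=x$ and $P(X_{n+1}=y+z\mid X_n=y)=\pi_{n,n+1}(y,y+z)$; averaged $P_{k,x}=\int P^\omega_{k,x}\,\mathrm{d}\mathbb{P}$, expectation $E_{k,x}$. $Z_i:=X_i-X_{i-1}$; shifts $(T_{m,y}\omega)_{n,x}=\omega_{n+m,x+y}$; $\overline\pi(\omega,T_{1,z}\omega):=\pi_{0,1}(0,z)$ is the kernel of the environment chain $(T_{n,X_n}\omega)_n$. $\mathcal{B}_n^-$ (resp. $\mathcal{B}_n^+$) is generated by $\omega_{m,x}$ with $m\le n$ (resp. $m\ge n$). $q(z):=\mathbb{E}[\pi_{0,1}(0,z)]$, $\xi_o:=\sum_zq(z)z$, $\Lambda_c(\theta):=\log\sum_zq(z)\mathrm{e}^{\langle\theta,z\rangle}$. $\bar\mu_\xi^\infty$ is the measure on $\Omega\times U^{\mathbb{N}}$ defined, for all $N,M,K\in\mathbb{N}$ and bounded $f$ with $f(\cdot,(z_i))$ independent of $(z_i)_{i>K}$ and $\mathcal{B}_{-N}^+\cap\mathcal{B}_M^-$-measurable,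 by $\int f\,\mathrm{d}\bar\mu_\xi^\infty:=E_{0,0}[\mathrm{e}^{\langle\theta,X_{N+M+K+1}\rangle-(N+M+K+1)\Lambda_c(\theta)}f(T_{N,X_N}\omega,(Z_{N+i})_{i\ge1})]$. $\mu_\xi^\infty$ is the law on $\Omega^{\mathbb{N}}$ of $(\omega,T_{1,z_1}\omega,T_{2,z_1+z_2}\omega,\ldots)$ when $(\omega,(z_i)_{i\ge1})\sim\bar\mu_\xi^\infty$ (a stationary process). *)

(* Defs.v *)
From HB Require Import structures.
From mathcomp Require Import all_boot all_order all_algebra.
From mathcomp Require Import all_classical all_reals all_analysis.

Set Implicit Arguments.
Unset Strict Implicit.
Unset Printing Implicit Defensive.

Import Order.TTheory GRing.Theory Num.Theory.
Local Open Scope classical_set_scope.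
Local Open Scope ring_scope.


Notation Zd d := ('rV[int]_d).

(** The set U = {z : |z_1|+...+|z_d| = 1} of unit steps, encoded as the finite
    type 'I_d * bool: (i, true) is e_i and (i, false) is -e_i. *)
Notation U d := ('I_d * bool)%type.

Definition uvec (d : nat) (z : U d) : Zd d :=
  \row_(j < d) (if j == z.1 then (if z.2 then 1 else -1) else 0).

(** Environments  omega = (omega_{n,x})_{n in Z, x in Z^d},
    omega n x z = pi_{n,n+1}(x, x + z). *)
Definition Env (R : realType) (d : nat) := int -> Zd d -> U d -> R.
HB.instance Definition _ (R : realType) (d : nat) := Choice.on (Env R d).
HB.instance Definition _ (R : realType) (d : nat) :=
  isPointed.Build (Env R d) (fun _ _ _ => 0).

Definition env_gen (R : realType) (d : nat) (I : set int) : set (set (Env R d)) :=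
  [set A | exists n x z (B : set R), [/\ I n, measurable B &
           A = [set om : Env R d | B (om n x z)]]].

Notation Omega R d := (g_sigma_algebraType (@env_gen R d setT)).

Definition Bplus (R : realType) (d : nat) (n : int) : set (set (Omega R d)) :=
  <<s @env_gen R d [set m | (n <= m)%R] >>.
Definition Bminus (R : realType) (d : nat) (n : int) : set (set (Omega R d)) :=
  <<s @env_gen R d [set m | (m <= n)%R] >>.

Definition site_sigma (R : realType) (d : nat) (n : int) (x : Zd d)
  : set (set (Omega R d)) :=
  <<s [set A | exists z (B : set R), measurable B /\
               A = [set om : Env R d | B (om n x z)]] >>.

Definition measurable_wrt (R : realType) (d : nat) (G : set (set (Omega R d)))
  (f : Omega R d -> R) : Prop :=
  forall B : set R, measurable B -> G (f @^-1` B).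

Definition shift (R : realType) (d : nat) (m : int) (y : Zd d) (om : Omega R d)
  : Omega R d := fun n x => om (n + m) (x + y).

Definition env_assumptions (R : realType) (d : nat) (P : probability (Omega R d) R)
  (c1 : R) : Prop :=
  [/\ (forall n x, P [set om : Omega R d | (forall z, 0 <= om n x z) /\
                                        \sum_(z : U d) om n x z = 1] = 1%E),
      (forall n x A, site_sigma 0 0 A -> P (shift n x @^-1` A) = P A),
      (forall (k : nat) (s : 'I_k -> int * Zd d) (A : 'I_k -> set (Omega R d)),
          injective s -> (forall i, site_sigma (s i).1 (s i).2 (A i)) ->
          fine (P (\bigcap_i A i)) = \prod_(i < k) fine (P (A i))),
      0 < c1 &
      (forall z : U d, P [set om : Omega R d | c1 <= om 0 0 z] = 1%E)].

Definition zR (R : realType) (d : nat) (x : Zd d) : 'rV[R]_d :=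
  \row_(j < d) (x 0 j)%:~R.
Arguments zR {R d} x.
Definition ip (R : realType) (d : nat) (u v : 'rV[R]_d) : R :=
  \sum_(j < d) u 0 j * v 0 j.
Definition enorm (R : realType) (d : nat) (v : 'rV[R]_d) : R :=
  Num.sqrt (\sum_(j < d) v 0 j ^+ 2).

Definition qz (R : realType) (d : nat) (P : probability (Omega R d) R) (z : U d) : R :=
  fine (\int[P]_om (om 0 0 z)%:E)%E.
Definition xi_o (R : realType) (d : nat) (P : probability (Omega R d) R) : 'rV[R]_d :=
  \sum_(z : U d) qz P z *: zR (uvec z).
Definition Lambda_c (R : realType) (d : nat) (P : probability (Omega R d) R)
  (th : 'rV[R]_d) : R :=
  ln (\sum_(z : U d) qz P z * expR (ip th (zR (uvec z)))).
Definition grad (R : realType) (d : nat) (f : 'rV[R]_d -> R) (th : 'rV[R]_d)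
  : 'rV[R]_d := \row_(i < d) derive f th (delta_mx 0 i).

(** Nearest-neighbour paths of length L from (0,0): zs i = Z_{i+1}.
    pos zs k = X_k ; weight om zs = prod_{i<L} pi_{i,i+1}(X_i, X_{i+1}). *)
Definition pos (d L : nat) (zs : {ffun 'I_L -> U d}) (k : nat) : Zd d :=
  \sum_(i < L | (i < k)%N) uvec (zs i).
Definition weight (R : realType) (d L : nat) (om : Omega R d)
  (zs : {ffun 'I_L -> U d}) : R :=
  \prod_(i < L) om (i%:Z) (pos zs i) (zs i).

(** Sequences of steps (z_i)_{i >= 1}, stored as zseq i = z_{i+1}, with the
    product sigma-algebra (generated by the coordinates). *)
Definition ZdSeq (d : nat) := nat -> Zd d.
HB.instance Definition _ (d : nat) := Choice.on (ZdSeq d).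
HB.instance Definition _ (d : nat) := isPointed.Build (ZdSeq d) (fun _ => 0).
Definition zgen (d : nat) : set (set (ZdSeq d)) :=
  [set A | exists (i : nat) (y : Zd d), A = [set s | s i = y]].
Notation Zseq d := (g_sigma_algebraType (@zgen d)).

(** The right-hand side of the definition of bar mu_xi^infty:
    E_{0,0}[ e^{<theta, X_L> - L Lambda_c(theta)} f(T_{N,X_N} omega, (Z_{N+i})_{i>=1}) ]
    with L = N+M+K+1 (f only depends on the first K steps). *)
Definition mubar_rhs (R : realType) (d : nat) (P : probability (Omega R d) R)
  (th : 'rV[R]_d) (N M K : nat) (f : Omega R d * Zseq d -> R) : \bar R :=
  let L := (N + M + K).+1 in
  (\int[P]_om
     (\sum_(zs : {ffun 'I_L -> U d})
        weight om zs
        * expR (ip th (zR (pos zs L)) - L%:R * Lambda_c P th)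
        * f (shift (N%:Z) (pos zs N) om,
             fun i : nat => if (N + i < L)%N then uvec (zs (inord (N + i))) else 0))%:E)%E.

Definition is_mubar (R : realType) (d : nat) (P : probability (Omega R d) R)
  (th : 'rV[R]_d) (mb : probability (Omega R d * Zseq d)%type R) : Prop :=
  forall (N M K : nat) (f : Omega R d * Zseq d -> R),
    (exists C : R, forall p, `|f p| <= C) ->
    (forall om (s s' : Zseq d), (forall i, (i < K)%N -> s i = s' i) ->
        f (om, s) = f (om, s')) ->
    (forall s : Zseq d, measurable_wrt (Bplus (- (N%:Z))) (fun om => f (om, s)) /\
                        measurable_wrt (Bminus (M%:Z)) (fun om => f (om, s))) ->
    (\int[mb]_p (f p)%:E)%E = mubar_rhs P th N M K f.

Definition env_path (R : realType) (d : nat) (p : Omega R d * Zseq d)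
  : nat -> Omega R d :=
  fun k => shift (k%:Z) (\sum_(i < k) p.2 i) p.1.

Definition EnvSeq (R : realType) (d : nat) := nat -> Omega R d.
HB.instance Definition _ (R : realType) (d : nat) := Choice.on (EnvSeq R d).
HB.instance Definition _ (R : realType) (d : nat) :=
  isPointed.Build (EnvSeq R d) (fun _ => point).
Definition seqgen (R : realType) (d : nat) : set (set (EnvSeq R d)) :=
  [set S | exists (i : nat) (A : set (Omega R d)), measurable A /\
           S = [set w | A (w i)]].
Notation OmegaN R d := (g_sigma_algebraType (@seqgen R d)).

(** Finite-dimensional Markov integrand for a kernel on Omega of the form
    K(omega, .) = sum_z k(omega,z) delta_{T_{1,z} omega}:
    chain k A j m omega = 1_{A_j}(omega) sum_z k(omega,z) chain k A (j+1) (m-1) (T_{1,z}omega). *)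
Fixpoint chain (R : realType) (d : nat) (k : Omega R d -> U d -> R)
  (A : nat -> set (Omega R d)) (j m : nat) (om : Omega R d) : R :=
  match m with
  | 0 => \1_(A j) om
  | m'.+1 => \1_(A j) om *
             \sum_(z : U d) k om z * chain k A j.+1 m' (shift 1 (uvec z) om)
  end.

Definition stat_markov_ac (R : realType) (d : nat) (P : probability (Omega R d) R)
  (k : Omega R d -> U d -> R) (dX : measure_display) (X : measurableType dX)
  (Q : probability X R) (W : X -> nat -> Omega R d) : Prop :=
  [/\
      (forall (n : nat) (A : nat -> set (Omega R d)), (forall i, measurable (A i)) ->
         Q (W @^-1` [set w | forall i, (i <= n)%N -> A i (w i)])
         = (\int[Q]_x (chain k A 0 n (W x 0))%:E)%E),
      (forall S : set (OmegaN R d), measurable S ->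
         Q (W @^-1` ((fun w : nat -> Omega R d => fun i => w i.+1) @^-1` S))
         = Q (W @^-1` S)) &
      (forall (n : int) (A : set (Omega R d)), Bplus n A -> P A = 0%E ->
         Q (W @^-1` [set w | A (w 0%N)]) = 0%E)].

Definition tilt (R : realType) (d : nat) (P : probability (Omega R d) R)
  (th : 'rV[R]_d) (om : Omega R d) (z : U d) : R :=
  om 0 0 z * expR (ip th (zR (uvec z)) - Lambda_c P th).

Definition harmonic_at (R : realType) (d : nat) (P : probability (Omega R d) R)
  (th : 'rV[R]_d) (u : Omega R d -> R) (om : Omega R d) : Prop :=
  u om = \sum_(z : U d) tilt P th om z * u (shift 1 (uvec z) om).

Definition pibar_theta (R : realType) (d : nat) (P : probability (Omega R d) R)
  (th : 'rV[R]_d) (u : Omega R d -> R) (om : Omega R d) (z : U d) : R :=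
  om 0 0 z * (u (shift 1 (uvec z) om) / u om)
    * expR (ip th (zR (uvec z)) - Lambda_c P th).

(* Main.v *)
(** The partition functions F_n, sums over paths of length n of the weights
    tilted by theta, have mean one. In the second moment two replicas interact
    only where they meet, and for theta close to 0 a meeting costs a factor
    close to 1; the difference walk being transient for d >= 3, the Lyapunov
    function 1 + G built from its Green function G bounds F_n, and its time
    reversal, in L2. Their subsequential
    limits u (reading the layers n >= 0) and D (reading the layers n < 0) are
    forward and backward harmonic, and u > 0 by a zero-one law.

    As u and D are independent, D u P is a probability; backward harmonicity of
    D makes it invariant under the kernel transformed by u, and the Markov chain
    started from it satisfies the defining identity of mu-bar because
    E[Y F_n] = E[Y u] whenever Y only reads layers below n.

    Conversely, let phi be the density on the future of the marginal of a
    stationary chain. Comparing the one-step invariance of phi and of u shows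
    that {u < phi} is preserved by every step, so by independence its
    probability is 0 or 1 and phi = u. Running the chain N steps determines the
    marginal on the layers n >= -N as well. *)
From HB Require Import structures.
From mathcomp Require Import all_boot all_order all_algebra.
From mathcomp Require Import all_classical all_reals all_analysis.
From mathcomp Require Import measurable_realfun charge ring lra zify.
Require Import Defs.
Import Order.TTheory GRing.Theory Num.Theory.
Import numFieldNormedType.Exports.
Local Open Scope classical_set_scope.
Local Open Scope ring_scope.

Set Implicit Arguments.
Unset Strict Implicit.
Unset Printing Implicit Defensive.

(** * Transience of the difference walk *)

(** The limits need moments only. For [a <= b] the product of [F_a] and [F_b] has the mean of the
    square of [F_a], so increments are orthogonal and bounded second moments yield an almost surely
    convergent subsequence. Harmonicity relates [F_n] to its successor, so the subsequence must
    converge together with its shift by one.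

    The admissible size of theta depends on a bound for the Green function, which must therefore
    hold uniformly in theta. Hence a quantitative form of transience: every step has probability at
    least [kappa], so three steps of the difference walk dominate a multiple of a product of lazy
    walks on three axes. Its return probability is the cube of a central binomial probability, and
    such a cube is at most twice the decrement of these probabilities, so the series telescopes.

    The time-reversed pair is controlled differently: its total mass is bounded by counting the
    visits of the forward pair to the origin, through transposition.

    For uniqueness, absolute continuity is granted only on each [Bplus n]. Exceptional sets have to
    be placed, site by site, in one of these sigma-algebras before they can be discarded. *)

Section OneDim.
Variable R : realFieldType.
Implicit Types (f g : int -> R) (n : int).

Definition dirac1 n : R := (n == 0)%:R.
(** A step of 0 or 2 with equal probability: two of them, recentred, form [lazy_step], and their
    iterates are binomial. Steps have size 2 because two replicas moving oppositely on an axis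
    change their difference by 2. *)
Definition half_step f n : R := (f n + f (n + 2)) / 2.
Definition lazy_step f n : R := (f (n - 2) + 2 * f n + f (n + 2)) / 4.

Lemma iter_half_step_out (m : nat) n :
  (forall j : nat, n != - (2 * j)%:Z) -> iter m half_step dirac1 n = 0.
Proof.
elim: m n => [|m IHm] n hn /=.
  rewrite /dirac1; case: eqP => // n0; have := hn 0%N.
  by rewrite n0 muln0 oppr0 eqxx.
rewrite /half_step !IHm ?addr0 ?mul0r// => j.
by apply: contraNneq (hn j.+1) => h; apply/eqP; lia.
Qed.

Lemma iter_half_step_bin (m i : nat) :
  iter m half_step dirac1 (- (2 * i)%:Z) = ('C(m, i))%:R / 2 ^+ m.
Proof.
elim: m i => [|m IHm] i /=.
  rewrite /dirac1 expr0 divr1 bin0n.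
  by congr (_ %:R); case: i.
rewrite /half_step IHm; case: i => [|i].
  rewrite muln0 oppr0 add0r iter_half_step_out ?addr0 ?bin0 ?exprS ?invfM; last first.
    by move=> j; apply/eqP; lia.
  by rewrite !mul1r mulrC.
have -> : - (2 * i.+1)%:Z + 2 = - (2 * i)%:Z :> int by lia.
by rewrite IHm binS natrD -mulrDl exprS invfM mulrAC !mulrA.
Qed.

Lemma leq_bin_central (k i : nat) : ('C(2 * k, i) <= 'C(2 * k, k))%N.
Proof.
have mono j : (j < k)%N -> ('C(2 * k, j) <= 'C(2 * k, j.+1))%N.
  move=> jk; rewrite -(leq_pmul2l (ltn0Sn j)) mul_bin_left leq_mul2r.
  by apply/orP; right; lia.
have below j : (j <= k)%N -> ('C(2 * k, j) <= 'C(2 * k, k))%N.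
  move=> jk; rewrite -(subKn jk).
  elim: (k - j)%N (leq_subr j k) => [|l IHl] lk; first by rewrite subn0.
  apply: (leq_trans (mono _ _)); first by lia.
  by rewrite -subSn ?subSS ?IHl//; lia.
have [ik|ki] := leqP i k; first exact: below.
have [i2k|] := leqP i (2 * k); last by move=> /bin_small->.
by rewrite -bin_sub// below//; lia.
Qed.

(** Return probability of the lazy walk after [k] steps, of order [k ^ (-1/2)]. *)
Definition central (k : nat) : R := ('C(2 * k, k))%:R / 4 ^+ k.

Lemma central0 : central 0 = 1.
Proof. by rewrite /central muln0 bin0 expr0 divr1. Qed.

Lemma central_ge0 k : 0 <= central k.
Proof. by rewrite /central divr_ge0 ?exprn_ge0. Qed.

Lemma centralS k : central k.+1 = central k * (2 * k + 1)%:R / (2 * k + 2)%:R.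
Proof.
have nat_eq : (k.+1 * k.+1 * 'C(2 * k.+1, k.+1) =
    (2 * k + 2) * (2 * k + 1) * 'C(2 * k, k))%N.
  have := mul_bin_diag (2 * k.+1) k; have := mul_bin_down (2 * k).+1 k.
  have -> : (2 * k.+1).-1 = (2 * k).+1 by lia.
  have -> : ((2 * k).+1 - k = k.+1)%N by lia.
  rewrite /=; nia.
have h : k.+1%:R * k.+1%:R * ('C(2 * k.+1, k.+1))%:R =
    (2 * k + 2)%:R * (2 * k + 1)%:R * ('C(2 * k, k))%:R :> R.
  by rewrite -!natrM nat_eq.
have k1 : k.+1%:R != 0 :> R by rewrite pnatr_eq0.
rewrite /central.
have -> : ('C(2 * k.+1, k.+1))%:R =
    (2 * k + 2)%:R * (2 * k + 1)%:R * ('C(2 * k, k))%:R / (k.+1%:R * k.+1%:R) :> R.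
  by rewrite -h mulrAC divff ?mul1r// mulf_neq0.
rewrite exprS.
have -> : (2 * k + 2)%:R = 2 * k.+1%:R :> R by rewrite -natrM; congr (_%:R); lia.
by field; rewrite expf_neq0 ?andbT ?nat1r ?k1 ?pnatr_eq0.
Qed.

(** Induction works because [(2k+1)(2k+3) <= (2k+2)^2]. *)
Lemma central_sqr k : (2 * k + 1)%:R * central k ^+ 2 <= 1.
Proof.
elim: k => [|k IHk]; first by rewrite central0 mul1r expr1n.
rewrite centralS; set x := central k in IHk *.
have k0 : (0 <= k%:R :> R) by [].
have -> : (2 * k.+1 + 1)%:R = 2 * k%:R + 3 :> R.
  by rewrite natrD natrM -natr1; ring.
have e j : (2 * k + j)%:R = 2 * k%:R + j%:R :> R by rewrite natrD natrM.
move: IHk; rewrite !e => IHk.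
set y := k%:R in k0 IHk *.
rewrite expr_div_n mulrA ler_pdivrMr ?exprn_gt0//; last by lra.
have : 0 <= (2 * y + 3) * (2 * y + 1) by apply: mulr_ge0; lra.
move/ler_wpM2l => /(_ _ _ IHk); rewrite exprMn mulr1 mul1r; nra.
Qed.

(** The decrement of [central] at [k] is [central k / (2k+2)], and [central_sqr] bounds
    [central k ^ 2] by [1/(k+1)]. Twice the decrement thus dominates the cube, the return
    probability in three dimensions. *)
Lemma central_tail k : central k ^+ 3 + 2 * central k.+1 <= 2 * central k.
Proof.
have := central_sqr k; rewrite centralS; set x := central k => h.
have x0 : 0 <= x by exact: central_ge0.
have k0 : (0 <= k%:R :> R) by [].
have e j : (2 * k + j)%:R = 2 * k%:R + j%:R :> R by rewrite natrD natrM.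
move: h; rewrite !e => h.
set y := k%:R in h k0 *.
have -> : x * (2 * y + 1) / (2 * y + 2) = x - x / (2 * y + 2).
  by field; apply: lt0r_neq0; lra.
have x3 : x ^+ 3 <= x / (y + 1).
  rewrite ler_pdivlMr; last by lra.
  have : x * ((2 * y + 1) * x ^+ 2) <= x * 1 by rewrite ler_wpM2l.
  have : 0 <= x ^+ 3 * y by rewrite mulr_ge0 ?exprn_ge0.
  by rewrite mulr1 !exprS expr0; nra.
have -> : x / (2 * y + 2) = x / (y + 1) / 2.
  by field; apply/andP; split; apply: lt0r_neq0; lra.
lra.
Qed.

Lemma iter_lazy_half f k n :
  iter k lazy_step f n = iter (2 * k) half_step f (n - (2 * k)%:Z).
Proof.
elim: k n => [|k IHk] n; first by rewrite muln0 subr0.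
have -> : (2 * k.+1 = (2 * k).+2)%N by lia.
rewrite /= /lazy_step !IHk /half_step.
set g := iter (2 * k) _ f.
have -> : n - (2 * k).+2%:Z + 2 + 2 = n + 2 - (2 * k)%:Z by lia.
have -> : n - (2 * k).+2%:Z + 2 = n - (2 * k)%:Z by lia.
have -> : n - (2 * k).+2%:Z = n - 2 - (2 * k)%:Z by lia.
by field.
Qed.

Lemma iter_lazy_dirac_le k n : iter k lazy_step dirac1 n <= central k.
Proof.
rewrite iter_lazy_half.
have [[j ->]|hn] := pselect (exists j : nat, n - (2 * k)%:Z = - (2 * j)%:Z).
  rewrite iter_half_step_bin /central.
  have -> : 4 ^+ k = 2 ^+ (2 * k) :> R by rewrite exprM; congr (_ ^+ k); rewrite expr2; ring.
  by rewrite ler_pM2r ?invr_gt0 ?exprn_gt0// ler_nat leq_bin_central.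
rewrite iter_half_step_out ?central_ge0// => j.
by apply/eqP => h; apply: hn; exists j.
Qed.

Lemma iter_lazy_dirac_ge0 k n : 0 <= iter k lazy_step dirac1 n.
Proof.
elim: k n => [|k IHk] n /=; first by rewrite /dirac1.
by rewrite /lazy_step divr_ge0 ?addr_ge0 ?mulr_ge0.
Qed.

End OneDim.

Lemma ler_sum2 (R : numDomainType) (I : finType) (F : I -> R) (a b : I) :
  a != b -> (forall i, 0 <= F i) -> F a + F b <= \sum_i F i.
Proof.
move=> ab F0; rewrite (bigD1 a)//= (bigD1 b)/=; last by rewrite eq_sym.
by rewrite addrA lerDl sumr_ge0.
Qed.

Lemma uvec_opp d (i : 'I_d) : uvec (i, false) = - uvec (i, true).
Proof.
by apply/rowP => j; rewrite !mxE/=; case: ifP => // _; rewrite oppr0.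
Qed.

Section Lattice.
Variables (R : realType) (d : nat).
Implicit Types (f g : Zd d -> R) (y : Zd d) (i : 'I_d).

Definition dirac0 y : R := (y == 0)%:R.

Definition diff_step (p : U d -> R) f y : R :=
  \sum_(z : U d) \sum_(z' : U d) p z * p z' * f (y + uvec z' - uvec z).

Definition dstep i : Zd d := uvec (i, true) *+ 2.

Definition axis_step i f y : R :=
  (f (y - dstep i) + 2 * f y + f (y + dstep i)) / 4.

Lemma axis_step_mono i f g y :
  (forall y, f y <= g y) -> axis_step i f y <= axis_step i g y.
Proof.
move=> fg; rewrite /axis_step ler_pM2r ?invr_gt0//.
by rewrite !lerD ?ler_wpM2l.
Qed.

Lemma axis_step_scale i (c : R) f y :
  axis_step i (fun y => c * f y) y = c * axis_step i f y.
Proof. by rewrite /axis_step; ring. Qed.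

Lemma axis_step_cst i (c : R) y : axis_step i (fun=> c) y = c.
Proof. by rewrite /axis_step; field. Qed.

Lemma axis_stepD i f g y :
  axis_step i (fun y => f y + g y) y = axis_step i f y + axis_step i g y.
Proof. by rewrite /axis_step; ring. Qed.

Section Step.
Variable p : U d -> R.
Hypothesis p_ge0 : forall z, 0 <= p z.
Hypothesis p_sum1 : \sum_z p z = 1.
Local Notation T := (diff_step p).

Lemma diff_step_mono f g y : (forall y, f y <= g y) -> T f y <= T g y.
Proof.
by move=> fg; do 2 apply: ler_sum => ? _; rewrite ler_wpM2l ?mulr_ge0.
Qed.

Lemma diff_step_ge0 f y : (forall y, 0 <= f y) -> 0 <= T f y.
Proof.
by move=> f0; do 2 apply: sumr_ge0 => ? _; rewrite !mulr_ge0.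
Qed.

Lemma diff_stepD f g y : T (fun y => f y + g y) y = T f y + T g y.
Proof.
rewrite -big_split; apply: eq_bigr => z _; rewrite -big_split.
by apply: eq_bigr => z' _; rewrite mulrDr.
Qed.

Lemma diff_step_scale (c : R) f y : T (fun y => c * f y) y = c * T f y.
Proof.
rewrite mulr_sumr; apply: eq_bigr => z _; rewrite mulr_sumr.
by apply: eq_bigr => z' _; rewrite mulrCA.
Qed.

Lemma diff_step_cst (c : R) y : T (fun=> c) y = c.
Proof.
rewrite /diff_step -[RHS]mul1r -p_sum1 mulr_suml; apply: eq_bigr => z _.
by rewrite -mulr_suml -mulr_sumr p_sum1 mulr1.
Qed.

Lemma diff_step_le f (c : R) y : (forall y, f y <= c) -> T f y <= c.
Proof. by move=> fc; rewrite -[leRHS](diff_step_cst c y) diff_step_mono. Qed.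

Lemma diff_step_transl f w y : T (fun y => f (y + w)) y = T f (y + w).
Proof.
do 2 apply: eq_bigr => ? _; congr (_ * f _).
by rewrite -!addrA; congr (_ + _); rewrite addrA addrC.
Qed.

(** Both operators are averages over translations. *)
Lemma axis_diff_comm i f : axis_step i (T f) = T (axis_step i f).
Proof.
apply/funext => y; rewrite /axis_step.
rewrite -!(diff_step_transl f) -diff_step_scale -!diff_stepD mulrC.
rewrite -diff_step_scale; congr (diff_step p _ y).
by apply/funext => x; rewrite mulrC.
Qed.

(** The two opposite pairs of steps along axis [i] shift the difference by [dstep i] or its
    negative, the two equal pairs leave it fixed, and each of the four has probability at least
    [kappa ^ 2]. *)
Lemma diff_step_ge_axis (kappa : R) i f y :
  0 <= kappa -> (forall z, kappa <= p z) -> (forall y, 0 <= f y) ->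
  4 * kappa ^+ 2 * axis_step i f y <= T f y.
Proof.
move=> k0 kp f0.
have pp z z' : kappa ^+ 2 <= p z * p z' by rewrite expr2 ler_pM.
have ab : (i, true) != (i, false) :> U d by rewrite xpair_eqE andbF.
apply: (le_trans _ (ler_sum2 ab _)); last first.
  by move=> z; apply: sumr_ge0 => z' _; rewrite !mulr_ge0.
have h z : kappa ^+ 2 * (f (y + uvec (i, true) - uvec z) +
    f (y + uvec (i, false) - uvec z)) <=
    \sum_z' p z * p z' * f (y + uvec z' - uvec z).
  apply: (le_trans _ (ler_sum2 ab _)); last by move=> z'; rewrite !mulr_ge0.
  by rewrite mulrDr lerD// ler_wpM2r.
apply: (le_trans _ (lerD (h _) (h _))).
rewrite !uvec_opp !opprK !addrK subrK le_eqVlt; apply/orP; left; apply/eqP.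
by rewrite /axis_step /dstep mulr2n opprD !addrA; field.
Qed.

End Step.
End Lattice.

Section Transience.
Variables (R : realType) (d : nat).
Hypothesis d3 : (3 <= d)%N.
Implicit Types (f g : Zd d -> R) (y : Zd d).

Let i0 : 'I_d := Ordinal (leq_trans (isT : 1 <= 3)%N d3).
Let i1 : 'I_d := Ordinal (leq_trans (isT : 2 <= 3)%N d3).
Let i2 : 'I_d := Ordinal d3.

Definition cube_step f : Zd d -> R :=
  axis_step i0 (axis_step i1 (axis_step i2 f)).

Lemma cube_step_mono f g y :
  (forall y, f y <= g y) -> cube_step f y <= cube_step g y.
Proof. by move=> fg; do 3 (apply: axis_step_mono => ?). Qed.

Lemma cube_stepD f g :
  cube_step (fun y => f y + g y) = fun y => cube_step f y + cube_step g y.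
Proof.
rewrite /cube_step.
have e i (a b : Zd d -> R) : axis_step i (fun y => a y + b y) =
  (fun y => axis_step i a y + axis_step i b y).
  by apply/funext => y; exact: axis_stepD.
by rewrite !e.
Qed.

Lemma cube_step_cst (c : R) : cube_step (fun=> c) = fun=> c.
Proof.
rewrite /cube_step.
have e i : axis_step i (fun=> c : R) = (fun=> c).
  by apply/funext => y; exact: axis_step_cst.
by rewrite !e.
Qed.

Lemma cube_diff_comm (p : U d -> R) f :
  cube_step (diff_step p f) = diff_step p (cube_step f).
Proof. by rewrite /cube_step !axis_diff_comm. Qed.

Lemma dstepE (i j : 'I_d) : dstep i 0 j = if j == i then 2 else 0.
Proof. by rewrite /dstep mulr2n !mxE /=; case: ifP. Qed.

Lemma add_dstepE y (i j : 'I_d) :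
  (y + dstep i) 0 j = if j == i then y 0 j + 2 else y 0 j.
Proof. by rewrite mxE dstepE; case: ifP => // _; rewrite addr0. Qed.

Lemma sub_dstepE y (i j : 'I_d) :
  (y - dstep i) 0 j = if j == i then y 0 j - 2 else y 0 j.
Proof.
have -> : (y - dstep i) 0 j = y 0 j - dstep i 0 j by rewrite !mxE.
by rewrite dstepE; case: ifP => // _; rewrite subr0.
Qed.

Lemma iter_cube_prod k y :
  iter k cube_step (fun y => dirac1 R (y 0 i0) * dirac1 R (y 0 i1) * dirac1 R (y 0 i2)) y =
  iter k (@lazy_step R) (@dirac1 R) (y 0 i0) *
  iter k (@lazy_step R) (@dirac1 R) (y 0 i1) *
  iter k (@lazy_step R) (@dirac1 R) (y 0 i2).
Proof.
elim: k y => [//|k IHk] y; rewrite !iterS.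
have -> : iter k cube_step (fun y => dirac1 R (y 0 i0) * dirac1 R (y 0 i1) * dirac1 R (y 0 i2)) =
  fun y => iter k (@lazy_step R) (@dirac1 R) (y 0 i0) *
  iter k (@lazy_step R) (@dirac1 R) (y 0 i1) *
  iter k (@lazy_step R) (@dirac1 R) (y 0 i2) by apply/funext.
rewrite /cube_step; move: (iter _ _ _) => f.
have e2 : axis_step i2 (fun y => f (y 0 i0) * f (y 0 i1) * f (y 0 i2)) =
    fun y => f (y 0 i0) * f (y 0 i1) * lazy_step f (y 0 i2).
  apply/funext => x; rewrite /axis_step /lazy_step !(add_dstepE, sub_dstepE) /=.
  by field.
have e1 : axis_step i1 (fun y => f (y 0 i0) * f (y 0 i1) * lazy_step f (y 0 i2)) =
    fun y => f (y 0 i0) * lazy_step f (y 0 i1) * lazy_step f (y 0 i2).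
  apply/funext => x; rewrite /axis_step /lazy_step !(add_dstepE, sub_dstepE) /=.
  by field.
rewrite e2 e1 /axis_step /lazy_step !(add_dstepE, sub_dstepE) /=.
by field.
Qed.

Lemma iter_cube_mono k f g y :
  (forall y, f y <= g y) -> iter k cube_step f y <= iter k cube_step g y.
Proof.
by move=> fg; elim: k y => [|k IHk] y /=; [exact: fg|exact: cube_step_mono].
Qed.

(** The mass at the origin is bounded by the mass on the set where three coordinates vanish, which
    ignores the other axes and factorises. *)
Lemma iter_cube_dirac_le k y :
  iter k cube_step (@dirac0 R d) y <= central R k ^+ 3.
Proof.
pose phi y : R := dirac1 R (y 0 i0) * dirac1 R (y 0 i1) * dirac1 R (y 0 i2).
apply: (@le_trans _ _ (iter k cube_step phi y)).
  apply: iter_cube_mono => x; rewrite /dirac0 /phi /dirac1.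
  case: eqP => [->|_]; first by rewrite !mxE eqxx !mulr1.
  by rewrite !mulr_ge0.
have c0 := central_ge0 R k.
rewrite iter_cube_prod !exprS expr0 mulr1 mulrA.
by rewrite !ler_pM ?mulr_ge0 ?iter_lazy_dirac_ge0 ?iter_lazy_dirac_le.
Qed.

Section Green.
Variables (p : U d -> R) (kappa : R).
Hypothesis kappa_gt0 : 0 < kappa.
Hypothesis p_ge : forall z, kappa <= p z.
Hypothesis p_sum1 : \sum_z p z = 1.
Local Notation T := (diff_step p).
Let p_ge0 z : 0 <= p z. Proof. exact: le_trans (ltW kappa_gt0) (p_ge z). Qed.
Let lam : R := (4 * kappa ^+ 2) ^+ 3.

Let lam_gt0 : 0 < lam. Proof. by rewrite exprn_gt0// mulr_gt0// exprn_gt0. Qed.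

(** One factor [T] is spent on each of the three axes. *)
Lemma diff_step3_ge f y : (forall y, 0 <= f y) ->
  lam * cube_step f y <= T (T (T f)) y.
Proof.
move=> f0; have k0 := ltW kappa_gt0.
have c0 : 0 <= 4 * kappa ^+ 2 by rewrite mulr_ge0// exprn_ge0.
apply: (le_trans _ (diff_step_ge_axis p_ge0 i0 y k0 p_ge _)); last first.
  by move=> x; do 2 apply: (diff_step_ge0 p_ge0) => ?.
rewrite /lam exprS -mulrA ler_wpM2l// -axis_step_scale.
apply: axis_step_mono => x.
apply: (le_trans _ (diff_step_ge_axis p_ge0 i1 x k0 p_ge _)); last first.
  by move=> ?; apply: (diff_step_ge0 p_ge0) => ?.
rewrite exprS expr1 -mulrA ler_wpM2l// -axis_step_scale.
apply: axis_step_mono => {}x.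
exact: (diff_step_ge_axis p_ge0).
Qed.

(* Splits T^3 as lam * cube_step plus a positive operator of mass 1 - lam. *)
Lemma diff_step3_le f (b : R) y : (forall y, f y <= b) ->
  T (T (T f)) y <= lam * cube_step f y + (1 - lam) * b.
Proof.
move=> fb.
have h0 x : 0 <= b + (-1) * f x by rewrite mulN1r subr_ge0.
have := diff_step3_ge y h0.
have TE g : T (fun x => b + -1 * g x) = fun x => b + -1 * T g x.
  apply/funext => x.
  by rewrite (diff_stepD p (fun=> b)) diff_step_cst// diff_step_scale.
rewrite !TE cube_stepD cube_step_cst.
have -> : cube_step (fun x => -1 * f x) y = -1 * cube_step f y.
  rewrite /cube_step.
  have e i (a : Zd d -> R) : axis_step i (fun y => -1 * a y) =
    (fun y => -1 * axis_step i a y).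
    by apply/funext => x; exact: axis_step_scale.
  by rewrite !e.
by move=> h; lra.
Qed.

(** Truncated Green function of [T^3] whose source is the unit mass after [k] cube steps. The index
    [k] closes the induction on [N]: a [cube_step] extracted from [T^3] is absorbed by raising
    [k]. *)
Fixpoint green3 (k N : nat) y : R :=
  if N is N'.+1 then iter k cube_step (@dirac0 R d) y + T (T (T (green3 k N'))) y
  else 0.

Lemma cube_green3 k N : cube_step (green3 k N) = green3 k.+1 N.
Proof.
elim: N => [|N IHN] /=; first by rewrite (cube_step_cst 0).
by rewrite cube_stepD !cube_diff_comm IHN.
Qed.

(* central k ^ 3 bounds the return probability after k steps of cube_step, and
   by central_tail the tails of these sums are at most 2 * central k. *)
Lemma green3_le k N y : green3 k N y <= 2 * central R k / lam.
Proof.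
elim: N k y => [|N IHN] k y /=.
  by rewrite divr_ge0 ?(ltW lam_gt0)// mulr_ge0 ?central_ge0.
have := diff_step3_le y (IHN k); rewrite cube_green3 => h.
have h1 : lam * green3 k.+1 N y <= 2 * central R k.+1.
  by rewrite -ler_pdivlMl// mulrC.
have h2 := iter_cube_dirac_le k y; have h3 := central_tail R k.
apply: (le_trans (lerD h2 h)).
rewrite mulrBl mul1r [lam * (_ / _)]mulrC divfK ?gt_eqF//; lra.
Qed.

Fixpoint green (N : nat) y : R :=
  if N is N'.+1 then dirac0 R y + T (green N') y else 0.

Lemma green_ge0 N y : 0 <= green N y.
Proof.
elim: N y => [//|N IHN] y /=.
by rewrite addr_ge0 ?(diff_step_ge0 p_ge0)//.
Qed.

Lemma green_leS N y : green N y <= green N.+1 y.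
Proof.
elim: N y => [|N IHN] y; first exact: green_ge0.
by rewrite [leRHS]/= [leLHS]/= lerD2l (diff_step_mono p_ge0).
Qed.

Lemma green_le_mono M N y : (M <= N)%N -> green M y <= green N y.
Proof.
elim: N => [|N IHN]; first by rewrite leqn0 => /eqP->.
rewrite leq_eqVlt => /predU1P[->//|/IHN h].
exact: le_trans h (green_leS N y).
Qed.

(** Times are sorted by their residue modulo 3. *)
Lemma green3E N y :
  green (3 * N) y = green3 0 N y + T (green3 0 N) y + T (T (green3 0 N)) y.
Proof.
have TD f g : T (fun x => f x + g x) = fun x => T f x + T g x.
  by apply/funext => x; exact: diff_stepD.
elim: N y => [|N IHN] y.
  have Te0 : T (green3 0 0) = fun=> 0 by apply/funext => x; rewrite diff_step_cst.
  by rewrite muln0 !(Te0, addr0).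
have -> : (3 * N.+1 = (3 * N).+3)%N by lia.
have gE n : green n.+1 = fun x => dirac0 R x + T (green n) x by [].
have g3E : green3 0 N.+1 =
  fun x => dirac0 R x + T (T (T (green3 0 N))) x by [].
rewrite gE gE gE g3E (funext IHN) !TD; ring.
Qed.

Lemma green_bound N y : green N y <= 6 / lam.
Proof.
apply: (@le_trans _ _ (green (3 * N) y)).
  by apply: green_le_mono; rewrite leq_pmull.
have h x : green3 0 N x <= 2 / lam.
  by have := green3_le 0 N x; rewrite central0 mulr1.
have h1 x : T (green3 0 N) x <= 2 / lam by exact: (diff_step_le p_ge0).
have h2 : T (T (green3 0 N)) y <= 2 / lam by exact: (diff_step_le p_ge0).
rewrite green3E; apply: (le_trans (lerD (lerD (h y) (h1 y)) h2)).
by rewrite -!mulrDl ler_pM2r ?invr_gt0//; lra.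
Qed.

(** Maximum principle: away from the origin there is no source, so the next value is an average of
    values already bounded by the one at the origin. *)
Lemma green_max N y : green N y <= green N 0.
Proof.
elim: N y => [//|N IHN] y.
have [->//|y0] := eqVneq y 0.
rewrite [leLHS]/= /dirac0 (negPf y0) add0r.
by apply: (le_trans _ (green_leS N 0)); exact: (diff_step_le p_ge0).
Qed.

End Green.
End Transience.

(** * Two interacting replicas and their total mass *)

Section PairKernel.
Variables (R : realType) (d : nat) (p : U d -> R) (V : U d -> U d -> R).
Implicit Types (f g : Zd d -> R) (y x : Zd d).

(* Two replicas of the walk see each other only when they read the same site:
   y is the displacement between the replicas, and in the time-reversed kernel
   pair_back the common site is the one reached by the step. *)
Definition pair_wt y (z z' : U d) : R := if y == 0 then V z z' else p z * p z'.

Definition pair_fwd f y : R :=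
  \sum_(z : U d) \sum_(z' : U d) pair_wt y z z' * f (y + uvec z' - uvec z).

Definition pair_back f y : R :=
  \sum_(z : U d) \sum_(z' : U d)
    pair_wt (y - uvec z' + uvec z) z z' * f (y - uvec z' + uvec z).

Hypothesis p_ge0 : forall z, 0 <= p z.
Hypothesis p_sum1 : \sum_z p z = 1.
Hypothesis V_ge0 : forall z z', 0 <= V z z'.

Lemma pair_wt_ge0 y z z' : 0 <= pair_wt y z z'.
Proof. by rewrite /pair_wt; case: ifP; rewrite ?mulr_ge0. Qed.

Lemma pair_fwd_mono f g y : (forall y, f y <= g y) -> pair_fwd f y <= pair_fwd g y.
Proof.
by move=> fg; do 2 apply: ler_sum => ? _; rewrite ler_wpM2l ?pair_wt_ge0.
Qed.

Lemma pair_back_mono f g y : (forall y, f y <= g y) -> pair_back f y <= pair_back g y.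
Proof.
by move=> fg; do 2 apply: ler_sum => ? _; rewrite ler_wpM2l ?pair_wt_ge0.
Qed.

Lemma pair_backD f g y :
  pair_back (fun y => f y + g y) y = pair_back f y + pair_back g y.
Proof.
rewrite -big_split; apply: eq_bigr => z _; rewrite -big_split.
by apply: eq_bigr => z' _; rewrite mulrDr.
Qed.

Lemma pair_fwd_scale (c : R) f y : pair_fwd (fun y => c * f y) y = c * pair_fwd f y.
Proof.
rewrite mulr_sumr; apply: eq_bigr => z _; rewrite mulr_sumr.
by apply: eq_bigr => z' _; rewrite mulrCA.
Qed.

Lemma pair_back_scale (c : R) f y :
  pair_back (fun y => c * f y) y = c * pair_back f y.
Proof.
rewrite mulr_sumr; apply: eq_bigr => z _; rewrite mulr_sumr.
by apply: eq_bigr => z' _; rewrite mulrCA.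
Qed.

Lemma pair_fwd_sum (I : Type) (r : seq I) (F : I -> Zd d -> R) y :
  pair_fwd (fun y => \sum_(i <- r) F i y) y = \sum_(i <- r) pair_fwd (F i) y.
Proof.
rewrite exchange_big; apply: eq_bigr => z _; rewrite exchange_big.
by apply: eq_bigr => z' _; rewrite mulr_sumr.
Qed.

Lemma pair_back_sum (I : Type) (r : seq I) (F : I -> Zd d -> R) y :
  pair_back (fun y => \sum_(i <- r) F i y) y = \sum_(i <- r) pair_back (F i) y.
Proof.
rewrite exchange_big; apply: eq_bigr => z _; rewrite exchange_big.
by apply: eq_bigr => z' _; rewrite mulr_sumr.
Qed.

Lemma iter_pair_back_mono n f g y :
  (forall y, f y <= g y) -> iter n pair_back f y <= iter n pair_back g y.
Proof.
by move=> fg; elim: n y => [|n IHn] y //=; exact: pair_back_mono.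
Qed.

Lemma iter_pair_backD n f g y :
  iter n pair_back (fun y => f y + g y) y =
  iter n pair_back f y + iter n pair_back g y.
Proof.
elim: n y => [//|n IHn] y; rewrite !iterS.
by rewrite (funext IHn) pair_backD.
Qed.

Lemma iter_pair_back_lin n (I : Type) (r : seq I) (c : I -> R)
    (F : I -> Zd d -> R) y :
  iter n pair_back (fun y => \sum_(i <- r) c i * F i y) y =
  \sum_(i <- r) c i * iter n pair_back (F i) y.
Proof.
elim: n y => [//|n IHn] y; rewrite iterS (funext IHn) pair_back_sum.
by apply: eq_bigr => i _; rewrite pair_back_scale.
Qed.

(** The two kernels are transposes of each other: a column of one [n]-step matrix is a row of the
    other. *)
Lemma iter_pair_transpose n y x :
  iter n pair_back (fun w => (w == y)%:R) x =
  iter n pair_fwd (fun w => (w == x)%:R) y.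
Proof.
elim: n y x => [|n IHn] y x; first by rewrite /= eq_sym.
rewrite iterSr iterS /pair_fwd.
have -> : pair_back (fun w => (w == y)%:R) =
    fun w => \sum_(u : U d * U d) pair_wt y u.1 u.2 *
      (w == y + uvec u.2 - uvec u.1)%:R.
  apply/funext => w; rewrite /pair_back pair_bigA/=.
  apply: eq_bigr => -[z z'] _ /=.
  have -> : (w == y + uvec z' - uvec z) = (w - uvec z' + uvec z == y).
    by rewrite eq_sym subr_eq eq_sym -subr_eq addrAC.
  by case: eqP => [->|_]; rewrite ?mulr0.
rewrite iter_pair_back_lin pair_bigA /=; apply: eq_bigr => -[z z'] _ /=.
by congr (_ * _); exact: IHn.
Qed.

(** Truncated Green function of the interacting pair at the origin: the mean weight of meetings at
    times below [M]. *)
Definition visits (M : nat) y : R := \sum_(m < M) iter m pair_fwd (@dirac0 R d) y.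

Lemma visitsS M y : visits M.+1 y = dirac0 R y + pair_fwd (visits M) y.
Proof.
by rewrite /visits big_ord_recl/= pair_fwd_sum; congr (_ + _); apply: eq_bigr.
Qed.

(** Reversed in time, the excess mass sits on transitions out of the origin, so one step sends the
    constant 1 to at most [1 + pair_back dirac0]. Iterating collects the iterates of [dirac0] at
    [0], which transposition turns into [visits]. *)
Lemma iter_pair_back1 N : iter N pair_back (fun=> 1) 0 <= 1 + visits N.+1 0.
Proof.
have tr m : iter m pair_back (@dirac0 R d) 0 = iter m pair_fwd (@dirac0 R d) 0.
  exact: iter_pair_transpose.
rewrite /visits big_ord_recl/= addrA.
apply: (@le_trans _ _ (1 + \sum_(i < N) iter (bump 0 i) pair_fwd (@dirac0 R d) 0));
  last by rewrite lerD2r lerDl.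
elim: N => [|N IHN]; first by rewrite /= big_ord0 addr0.
rewrite iterSr big_ord_recr addrA.
apply: (le_trans _ (lerD IHN (lexx _))).
rewrite -[bump 0 _]/(N.+1) -tr iterSr -iter_pair_backD.
apply: iter_pair_back_mono => y.
rewrite -[leLHS]/(pair_back _ y) -[1 in leRHS](diff_step_cst p_sum1 1 (- y)).
rewrite -big_split; apply: ler_sum => z _; rewrite -big_split.
apply: ler_sum => z' _; rewrite /pair_wt /dirac0 !mulr1.
by case: ifP => _ /=; rewrite ?mulr0 ?mulr1 ?addr0 ?lerDr ?mulr_ge0.
Qed.

Section Bound.
Hypothesis d3 : (3 <= d)%N.
Variables (kappa a eps c : R).
Hypothesis kappa_gt0 : 0 < kappa.
Hypothesis p_ge : forall z, kappa <= p z.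
Hypothesis V_ge : forall z z', a * (p z * p z') <= V z z'.
Hypothesis a_le1 : a <= 1.
Hypothesis V_sum : \sum_z \sum_z' V z z' <= 1 + eps.
Hypothesis c_gt0 : 0 < c.
Hypothesis eps_ge0 : 0 <= eps.
Let B : R := 6 / (4 * kappa ^+ 2) ^+ 3.
Hypothesis small : eps * (1 + B) + c <= a.

Local Notation G := (green p).

(* 1 + G is a Lyapunov function: the drift of G at the origin pays for the
   excess mass eps of the interaction. *)
Lemma pair_fwd_green m y :
  pair_fwd (fun x => 1 + G m x) y + c * dirac0 R y <= 1 + G m.+1 y.
Proof.
have [->|y0] := eqVneq y 0; last first.
  rewrite /dirac0 (negPf y0) mulr0 addr0 /= /dirac0 (negPf y0) add0r.
  rewrite -[1 in leRHS](diff_step_cst p_sum1 1 y) -diff_stepD.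
  by do 2 apply: ler_sum => ? _; rewrite /pair_wt (negPf y0).
rewrite /dirac0 eqxx mulr1.
set g := G m 0.
have g0 : 0 <= g by exact: (green_ge0 kappa_gt0 p_ge).
have gB : g <= B by exact: (green_bound d3 kappa_gt0 p_ge p_sum1).
(* Each term is nonnegative by [green_max], so [V_ge] preserves at least the fraction [a] of the
   drop that free steps produce. *)
have drop : \sum_z \sum_z' V z z' * (g - G m (uvec z' - uvec z)) >=
    a * (g - diff_step p (G m) 0).
  have -> : g - diff_step p (G m) 0 =
      \sum_z \sum_z' p z * p z' * (g - G m (uvec z' - uvec z)).
    rewrite -[X in X - _](diff_step_cst p_sum1 g 0) -sumrB.
    apply: eq_bigr => z _; rewrite -sumrB; apply: eq_bigr => z' _.
    by rewrite mulrBr add0r.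
  rewrite mulr_sumr; apply: ler_sum => z _; rewrite mulr_sumr.
  apply: ler_sum => z' _; rewrite mulrA ler_wpM2r//.
  by rewrite subr_ge0 (green_max kappa_gt0 p_ge p_sum1).
have -> : pair_fwd (fun x => 1 + G m x) 0 = (\sum_z \sum_z' V z z') * (1 + g) -
    \sum_z \sum_z' V z z' * (g - G m (uvec z' - uvec z)).
  rewrite mulr_suml -sumrB; apply: eq_bigr => z _.
  rewrite mulr_suml -sumrB; apply: eq_bigr => z' _.
  by rewrite /pair_wt eqxx add0r; ring.
have vs : (\sum_z \sum_z' V z z') * (1 + g) <= (1 + eps) * (1 + g).
  by rewrite ler_wpM2r// addr_ge0.
have gS : G m.+1 0 = 1 + diff_step p (G m) 0 by rewrite /= /dirac0 eqxx.
have gm : g <= G m.+1 0 by exact: (green_leS kappa_gt0 p_ge).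
have eg : eps * (1 + g) <= eps * (1 + B) by rewrite ler_wpM2l// lerD2l.
have ga : (1 - a) * (G m.+1 0 - g) >= 0 by rewrite mulr_ge0 ?subr_ge0.
rewrite gS in ga gm *.
move: drop vs eg ga small.
set W := \sum_z _; set SV := (\sum_z _) * _; set t := diff_step p _ 0.
move: W SV t => W SV t.
have -> : (1 - a) * (1 + t - g) = 1 + t - g - a * (1 + (t - g)) by ring.
have -> : (1 + eps) * (1 + g) = 1 + g + eps * (1 + g) by ring.
have -> : a * (1 + (t - g)) = a - a * (g - t) by ring.
move: (eps * (1 + g)) (a * (g - t)) (eps * (1 + B)) => x1 x2 x3; lra.
Qed.

(** [1 + G] lies between [1] and [1 + B], and by [pair_fwd_green] each step of the kernel is
    compensated by one more term of [G]. *)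
Lemma iter_pair_fwd1 m y : iter m pair_fwd (fun=> 1) y <= 1 + B.
Proof.
apply: (@le_trans _ _ (1 + G m y)); last first.
  by rewrite lerD2l (green_bound d3 kappa_gt0 p_ge p_sum1).
elim: m y => [|m IHm] y; first by rewrite /= addr0.
rewrite iterS; apply: le_trans (pair_fwd_green m y).
apply: le_trans (pair_fwd_mono _ IHm) _.
by rewrite lerDl mulr_ge0 ?(ltW c_gt0) /dirac0.
Qed.

(** The gain [c] at the origin in [pair_fwd_green] is collected at every visit, out of a total of at
    most [1 + B]. *)
Lemma visits_bound M y : visits M y <= (1 + B) / c.
Proof.
rewrite ler_pdivlMr// mulrC.
apply: (@le_trans _ _ (1 + G M y)); last first.
  by rewrite lerD2l (green_bound d3 kappa_gt0 p_ge p_sum1).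
elim: M y => [|M IHM] y; first by rewrite /visits big_ord0 mulr0 addr0.
apply: le_trans (pair_fwd_green M y).
rewrite visitsS mulrDr addrC lerD2r -pair_fwd_scale.
exact: pair_fwd_mono.
Qed.

Lemma iter_pair_back1_bound N : iter N pair_back (fun=> 1) 0 <= 1 + (1 + B) / c.
Proof.
by apply: le_trans (iter_pair_back1 N) _; rewrite lerD2l visits_bound.
Qed.

End Bound.
End PairKernel.

(** * Independence of site sigma-algebras *)

Lemma pi_system_unique d (R : realType) (T : measurableType d)
    (G : set (set T)) (m1 m2 : {measure set T -> \bar R}) :
  G `<=` measurable -> setI_closed G -> G setT -> (m1 setT < +oo)%E ->
  (forall A, G A -> m1 A = m2 A) -> forall A, <<s G >> A -> m1 A = m2 A.
Proof.
move=> Gm GI GT m1T m12.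
apply: (@g_sigma_algebra_measure_unique _ _ _ G Gm (fun=> setT)) => //.
by rewrite bigcup_const//; exists 0%N.
Qed.

Section Sites.
Variables (R : realType) (d : nat).
Local Notation site := (int * Zd d)%type.
Implicit Types (I J : set site).

(** Indexing by sets of space-time sites treats [site_sigma], [Bplus] and [Bminus] alike and reduces
    independence to disjointness. *)
Definition sgen I : set (set (Env R d)) :=
  [set A | exists s z (B : set R), [/\ I s, measurable B &
           A = [set om : Env R d | B (om s.1 s.2 z)]]].

Lemma sgen_sub I J : I `<=` J -> <<s sgen I >> `<=` <<s sgen J >>.
Proof.
move=> IJ; apply: smallest_sub; first exact: smallest_sigma_algebra.
move=> A [s [z [B [Is mB ->]]]]; apply: sub_sigma_algebra.
by exists s, z, B; split => //; exact: IJ.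
Qed.

Lemma env_genE (N : set int) : @env_gen R d N = sgen [set s | N s.1].
Proof.
apply/seteqP; split=> [A [n [x [z [B [Nn mB ->]]]]]|A [[n x] [z [B [/= Nn mB ->]]]]].
  by exists (n, x), z, B.
by exists n, x, z, B.
Qed.

Lemma site_sigmaE n x : @site_sigma R d n x = <<s sgen [set (n, x)] >>.
Proof.
congr <<s _ >>; apply/seteqP; split=> [A [z [B [mB ->]]]|A [_ [z [B [-> mB ->]]]]].
  by exists (n, x), z, B.
by exists z, B.
Qed.

Lemma sgen_measurable I (A : set (Omega R d)) : <<s sgen I >> A -> measurable A.
Proof.
rewrite /measurable/= env_genE.
by apply: sgen_sub => s _.
Qed.

Lemma measurable_sgenT (A : set (Omega R d)) : measurable A = <<s sgen setT >> A.
Proof.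
by rewrite /measurable/= env_genE; congr (<<s sgen _ >> A); apply/seteqP; split.
Qed.

Lemma preimage_shift_sgen I J n x :
  (forall s, I s -> J (s.1 + n, s.2 + x)) ->
  forall A, <<s sgen I >> A -> <<s sgen J >> (shift n x @^-1` A).
Proof.
move=> IJ; apply: smallest_sub => [|A [s [z [B [Is mB ->]]]]].
  have sJ := smallest_sigma_algebra setT (sgen J).
  split => [|A|F hF].
  - by rewrite /= preimage_set0; exact: sigma_algebra0.
  - by move=> hA; rewrite /= setTD preimage_setC -setTD; exact: sigma_algebraCD.
  - by rewrite /= preimage_bigcup; exact: sigma_algebra_bigcup.
apply: sub_sigma_algebra; exists (s.1 + n, s.2 + x), z, B; split => //.
exact: IJ.
Qed.

Lemma shift_shift (m n : int) (x y : Zd d) (om : Omega R d) :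
  shift m x (shift n y om) = shift (m + n) (x + y) om.
Proof. by apply/funext => k; apply/funext => w; rewrite /shift !addrA. Qed.

Lemma shift0 (om : Omega R d) : shift 0 0 om = om.
Proof. by apply/funext => k; apply/funext => w; rewrite /shift !addr0. Qed.

(** The intersection-stable class on which the independence hypothesis speaks directly. *)
Definition cyl I : set (set (Env R d)) :=
  [set A | exists (l : seq site) (C : site -> set (Env R d)),
    [/\ uniq l, (forall s, s \in l -> I s),
        (forall s, site_sigma s.1 s.2 (C s)) &
        A = \bigcap_(s in [set` l]) C s]].

Lemma site_sigmaT n x : @site_sigma R d n x setT.
Proof.
rewrite -(setD0 setT); apply: sigma_algebraCD; exact: sigma_algebra0.
Qed.

Lemma cylT I : cyl I setT.
Proof.
exists [::], (fun=> setT); split => //; first by move=> s; exact: site_sigmaT.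
by apply/seteqP; split.
Qed.

Lemma cyl_setI I : setI_closed (cyl I).
Proof.
move=> A B [l [C [ul lI hC ->]]] [l' [C' [ul' lI' hC' ->]]].
exists (undup (l ++ l')), (fun s =>
  (if s \in l then C s else setT) `&` (if s \in l' then C' s else setT)).
split => //.
- exact: undup_uniq.
- by move=> s; rewrite mem_undup mem_cat => /orP[/lI|/lI'].
- move=> s; have hT := @site_sigmaT s.1 s.2; move: hT (hC s) (hC' s).
  rewrite !site_sigmaE => hT h1 h2.
  apply: (@measurableI _ (g_sigma_algebraType (sgen [set (s.1, s.2)])));
    by case: ifP.
apply/seteqP; split => [om [h h'] s /=|om h].
  rewrite mem_undup => _.
  by split; case: ifP => // sl; [exact: h|exact: h'].
split=> s /= sl; have /= := h s; rewrite mem_undup mem_cat sl ?orbT.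
  by case/(_ isT).
by case/(_ isT).
Qed.

Lemma cyl_sub I : cyl I `<=` <<s sgen I >>.
Proof.
move=> A [l [C [_ lI hC ->]]].
apply: (@fin_bigcap_measurable _ (g_sigma_algebraType (sgen I)) site) => //= s sl.
have := hC s; rewrite site_sigmaE; apply: sgen_sub => _ ->.
by rewrite -surjective_pairing; exact: lI.
Qed.

Lemma cyl_sgen I : <<s cyl I >> = <<s sgen I >>.
Proof.
apply/seteqP; split.
  by apply: smallest_sub; [exact: smallest_sigma_algebra|exact: cyl_sub].
apply: smallest_sub; first exact: smallest_sigma_algebra.
move=> A [s [z [B [Is mB ->]]]]; apply: sub_sigma_algebra.
exists [:: s], (fun s' => if s' == s then [set om | B (om s.1 s.2 z)] else setT).
split => //.
- by move=> s'; rewrite inE => /eqP->.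
- move=> s'; case: eqP => [->|_]; last exact: site_sigmaT.
  by apply: sub_sigma_algebra; exists z, B.
apply/seteqP; split=> [om h s' /=|om /(_ s)]; rewrite /= ?inE ?eqxx; last exact.
by move=> /eqP ->; rewrite eqxx.
Qed.

Section Law.
Variables (P : probability (Omega R d) R) (c1 : R).
Hypothesis hP : env_assumptions P c1.

Lemma P_cyl (l : seq site) (C : site -> set (Env R d)) :
  uniq l -> (forall s, site_sigma s.1 s.2 (C s)) ->
  fine (P (\bigcap_(s in [set` l]) C s)) = \prod_(s <- l) fine (P (C s)).
Proof.
move=> ul hC; have [_ _ ind _ _] := hP.
case: l ul => [_|s0 l ul].
  rewrite big_nil (_ : \bigcap_(_ in _) _ = setT) ?probability_setT//.
  by apply/seteqP; split.
have := ind (size (s0 :: l)) (fun i => nth s0 (s0 :: l) i)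
  (fun i => C (nth s0 (s0 :: l) i)).
rewrite (_ : \bigcap_i _ = \bigcap_(s in [set` s0 :: l]) C s); last first.
  apply/seteqP; split=> [om h s /= sl|om h i _]; last by apply: h; exact/mem_nth.
  have hs : (index s (s0 :: l) < size (s0 :: l))%N by rewrite index_mem.
  by have := h (Ordinal hs) I; rewrite /= nth_index.
move=> ->; first by rewrite (big_nth s0) big_mkord.
  by move=> i j /eqP; rewrite nth_uniq// => /eqP/val_inj.
by move=> i; exact: hC.
Qed.

(** The product formula for cylinders is extended to one sigma-algebra at a time, by uniqueness of
    finite measures on an intersection-stable class. *)
Lemma sgen_indep I J (A B : set (Omega R d)) : I `&` J = set0 ->
  <<s sgen I >> A -> <<s sgen J >> B -> (P (A `&` B) = P A * P B)%E.
Proof.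
move=> IJ0 hA hB.
have cylm K : cyl K `<=` (measurable : set (set (Omega R d))).
  by move=> X /cyl_sub; exact: sgen_measurable.
have mA := sgen_measurable hA; have mB := sgen_measurable hB.
have fP X : measurable X -> ((fine (P X))%:E = P X)%E.
  by move=> mX; rewrite fineK// fin_num_measure.
have step1 X Y : cyl I X -> cyl J Y -> (P (X `&` Y) = P X * P Y)%E.
  move=> hX hY.
  have := cylm _ _ hX; have := cylm _ _ hY.
  move: hX hY => [l [C [ul lI hC ->]]] [l' [C' [ul' lJ hC' ->]]] mY mX.
  pose C2 s := if s \in l then C s else C' s.
  have dis s : s \in l -> s \in l' -> False.
    by move=> /lI Is /lJ Js; have : (I `&` J) s by []; rewrite IJ0.
  have lC : \prod_(s <- l) fine (P (C s)) = \prod_(s <- l) fine (P (C2 s)).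
    by apply: eq_big_seq => s sl; rewrite /C2 sl.
  have lC' : \prod_(s <- l') fine (P (C' s)) = \prod_(s <- l') fine (P (C2 s)).
    apply: eq_big_seq => s sl'; rewrite /C2; case: ifPn => // sl.
    by case: (dis s).
  rewrite -[LHS]fP; last exact: measurableI.
  rewrite -[X in (X * _)%E]fP// -[X in (_ * X)%E]fP// -EFinM.
  congr EFin; rewrite !P_cyl// lC lC' -big_cat -P_cyl//.
  - congr (fine (P _)); apply/seteqP; split=> [om [h h'] s /=|om h].
      rewrite mem_cat /C2 => /orP[sl|sl']; first by rewrite sl; exact: h.
      by case: ifPn => sl; [exact: h|exact: h'].
    split=> s /= sl; have := h s; rewrite /= mem_cat sl ?orbT /C2.
      by rewrite sl => /(_ isT).
    by case: ifPn => [sl'|_ /(_ isT)//]; case: (dis s).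
  - rewrite cat_uniq ul ul' andbT/=; apply/hasPn => s sl'.
    by apply/negP => /= sl; exact: (dis s).
  - by move=> s; rewrite /C2; case: ifP.
have nn X : 0 <= fine (P X) by exact: fine_ge0.
have sc X Y : measurable Y ->
    (mscale (NngNum (nn Y)) P X = P X * P Y)%E.
  by move=> mY; rewrite /mscale/= fP// muleC.
have lt1 X : measurable X -> (P (setT `&` X) < +oo)%E.
  by move=> mX; rewrite setTI; apply: (le_lt_trans (probability_le1 _ mX)); rewrite ltry.
have step2 X Y : <<s sgen I >> X -> cyl J Y -> (P (X `&` Y) = P X * P Y)%E.
  move=> hX hY; have mY := cylm _ _ hY; have mX := sgen_measurable hX.
  rewrite -cyl_sgen in hX.
  rewrite -sc//.
  apply: (@pi_system_unique _ R (Omega R d) (cyl I) (mrestr P mY)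
    (mscale (NngNum (nn Y)) P) (cylm I) (@cyl_setI I) (@cylT I) (lt1 _ mY) _ X hX).
  by move=> Z hZ; rewrite -[RHS]/(mscale (NngNum (nn Y)) P Z) sc//; exact: step1.
rewrite -cyl_sgen in hB.
rewrite setIC muleC -sc//.
apply: (@pi_system_unique _ R (Omega R d) (cyl J) (mrestr P mA)
  (mscale (NngNum (nn A)) P) (cylm J) (@cyl_setI J) (@cylT J) (lt1 _ mA) _ B hB).
move=> Z hZ; rewrite -[RHS]/(mscale (NngNum (nn A)) P Z) sc// muleC -[LHS]/(P (Z `&` A)) setIC; exact: step2.
Qed.

Lemma site_sigma_shift n x (A : set (Omega R d)) : site_sigma n x A ->
  site_sigma 0 0 (shift (- n) (- x) @^-1` A).
Proof.
rewrite !site_sigmaE; apply: preimage_shift_sgen => s -> /=.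
by rewrite !subrr.
Qed.

(** The hypothesis compares single sites only. On cylinders both probabilities factor over sites, so
    this suffices there, and cylinders determine the measure. *)
Lemma P_shift n x (A : set (Omega R d)) :
  measurable A -> P (shift n x @^-1` A) = P A.
Proof.
have [_ hs _ _ _] := hP.
have mshift : measurable_fun setT (shift n x : Omega R d -> Omega R d).
  move=> _ B mB; rewrite setTI measurable_sgenT.
  rewrite measurable_sgenT in mB.
  exact: preimage_shift_sgen mB.
rewrite [measurable A]measurable_sgenT -cyl_sgen => hA.
have cylm : cyl setT `<=` (measurable : set (set (Omega R d))).
  by move=> X /cyl_sub; exact: sgen_measurable.
have := @pi_system_unique _ R (Omega R d) (cyl setT) (pushforward P (shift n x)) P
  cylm (@cyl_setI setT) (@cylT setT) _ _ A hA.
apply => //=.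
  by rewrite /pushforward preimage_setT probability_setT ltry.
move=> X hX; have mX := cylm _ hX; rewrite /pushforward.
have mX' : measurable (shift n x @^-1` X).
  by rewrite -[X in measurable X]setTI; exact: mshift.
rewrite -[LHS]fineK ?fin_num_measure// -[RHS]fineK ?fin_num_measure//.
congr EFin; move: hX => [l [C [ul lI hC ->]]].
rewrite preimage_bigcap [RHS]P_cyl//.
pose C' (s : site) := shift n x @^-1` C (s.1 - n, s.2 - x).
pose f (s : site) := (s.1 + n, s.2 + x).
have fK : cancel f (fun s : site => (s.1 - n, s.2 - x)).
  by move=> [a b]; rewrite /f/= !addrK.
have := @P_cyl (map f l) C'.
have -> : \bigcap_(s in [set` map f l]) C' s =
    \bigcap_(s in [set` l]) (shift n x @^-1` C s).
  apply/seteqP; split=> [om h s /= sl|om h _ /mapP[s sl ->]].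
    by have := h (f s) (map_f f sl); rewrite /C' fK.
  by rewrite /C' fK; exact: h.
move=> ->.
- rewrite big_map; apply: eq_bigr => s _; rewrite /C' fK.
  (* Shift invariance is assumed for events at the origin, so [C s] and its translate are both
     compared with the same event there. *)
  have e1 := hs s.1 s.2 _ (site_sigma_shift (hC s)).
  have hC' : site_sigma (s.1 + n) (s.2 + x) (shift n x @^-1` C s).
    have := hC s; rewrite !site_sigmaE; apply: preimage_shift_sgen.
    by move=> _ ->.
  have e2 := hs (s.1 + n) (s.2 + x) _ (site_sigma_shift hC').
  congr fine; rewrite -[RHS]/(P (C s)).
  have eqs : shift (- s.1) (- s.2) @^-1` C s =
     shift (- (s.1 + n)) (- (s.2 + x)) @^-1` (shift n x @^-1` C s).
    have en : n - (s.1 + n) = - s.1 by rewrite opprD addrCA subrr addr0.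
    have ex : x - (s.2 + x) = - s.2 by rewrite opprD addrCA subrr addr0.
    by apply/funext => om; rewrite /preimage/mkset shift_shift en ex.
  have e3 k y (B : set (Omega R d)) :
      shift k y @^-1` (shift (- k) (- y) @^-1` B) = B.
    apply/seteqP; split=> om /=; rewrite shift_shift !addNr shift0//.
  rewrite e3 in e1; rewrite e3 in e2.
  by rewrite e2 e1 eqs.
- by rewrite map_inj_uniq//; exact: can_inj fK.
- move=> s; rewrite /C'; have := hC (s.1 - n, s.2 - x).
  rewrite !site_sigmaE; apply: preimage_shift_sgen => _ -> /=.
  by rewrite !subrK -surjective_pairing.
Qed.

End Law.
End Sites.

(** * Functions of a set of sites and their expectations *)

Local Notation Om I := (g_sigma_algebraType (sgen I)).

Lemma ae_imp d (T : measurableType d) (R : realType)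
    (mu : {measure set T -> \bar R}) (A B : T -> Prop) :
  (forall x, A x -> B x) -> {ae mu, forall x, A x} -> {ae mu, forall x, B x}.
Proof. by move=> h; exact: filterS. Qed.

Lemma ae_imp2 d (T : measurableType d) (R : realType)
    (mu : {measure set T -> \bar R}) (A B C : T -> Prop) :
  (forall x, A x -> B x -> C x) ->
  {ae mu, forall x, A x} -> {ae mu, forall x, B x} -> {ae mu, forall x, C x}.
Proof. by move=> h; apply: filterS2. Qed.

Section SiteFunctions.
Variables (R : realType) (d : nat).
Local Notation site := (int * Zd d)%type.
Implicit Types (I J : set site) (f g : Env R d -> R).

Definition sfun I f := measurable_fun (setT : set (Om I)) (f : Om I -> R).

Lemma sfun_sub I J f : I `<=` J -> sfun I f -> sfun J f.
Proof.
move=> IJ mf _ B mB; have := mf measurableT B mB; exact: sgen_sub.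
Qed.

Lemma sfun_measurable I f :
  sfun I f -> measurable_fun (setT : set (Omega R d)) f.
Proof.
move=> mf _ B mB; have := mf measurableT B mB; exact: sgen_measurable.
Qed.

Lemma sfun_coord I n x z : I (n, x) -> sfun I (fun om => om n x z).
Proof.
move=> Inx _ B mB; rewrite setTI; apply: sub_sigma_algebra.
by exists (n, x), z, B.
Qed.

Lemma sfun_shift I J n x f : (forall s, I s -> J (s.1 + n, s.2 + x)) ->
  sfun I f -> sfun J (fun om => f (shift n x om)).
Proof.
move=> IJ mf _ B mB; have := mf measurableT B mB; rewrite !setTI => h.
exact: (preimage_shift_sgen IJ h).
Qed.

Lemma sfun_cst I (c : R) : sfun I (fun=> c).
Proof. exact: measurable_cst. Qed.

Lemma sfunD I f g : sfun I f -> sfun I g -> sfun I (fun om => f om + g om).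
Proof. exact: measurable_funD. Qed.

Lemma sfunB I f g : sfun I f -> sfun I g -> sfun I (fun om => f om - g om).
Proof. exact: measurable_funB. Qed.

Lemma sfunM I f g : sfun I f -> sfun I g -> sfun I (fun om => f om * g om).
Proof. exact: measurable_funM. Qed.

Lemma sfun_sum I (T : Type) (r : seq T) (F : T -> Env R d -> R) :
  (forall i, sfun I (F i)) -> sfun I (fun om => \sum_(i <- r) F i om).
Proof. by move=> h; apply: measurable_sum. Qed.

Lemma sfun_indic I A : <<s sgen I >> A -> sfun I \1_A.
Proof. by move=> hA; exact: (@measurable_indic _ (Om I) R setT A hA). Qed.

Lemma measurable_wrt_BplusP n f :
  measurable_wrt (Bplus n) f <-> sfun [set s : site | n <= s.1] f.
Proof.
rewrite /measurable_wrt /Bplus env_genE; split=> h.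
  by move=> _ B mB; rewrite setTI; exact: h.
by move=> B mB; have := h measurableT B mB; rewrite setTI.
Qed.

Lemma measurable_wrt_BminusP n f :
  measurable_wrt (Bminus n) f <-> sfun [set s : site | s.1 <= n] f.
Proof.
rewrite /measurable_wrt /Bminus env_genE; split=> h.
  by move=> _ B mB; rewrite setTI; exact: h.
by move=> B mB; have := h measurableT B mB; rewrite setTI.
Qed.

Lemma measurable_shift n x :
  measurable_fun setT (shift n x : Omega R d -> Omega R d).
Proof.
move=> _ B mB; rewrite setTI; rewrite !measurable_sgenT in mB *.
exact: preimage_shift_sgen mB.
Qed.

End SiteFunctions.

Section Expectation.
Variables (R : realType) (d : nat) (P : probability (Omega R d) R).
Local Notation site := (int * Zd d)%type.
Implicit Types (I J : set site) (f g : Env R d -> R).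

(** Kept in [\bar R] and used on nonnegative functions, so that additivity and monotonicity need no
    integrability. *)
Definition Ex f : \bar R := (\int[P]_om (f om)%:E)%E.

Let mE I f : sfun I f ->
  measurable_fun (setT : set (Omega R d)) (fun om => (f om)%:E).
Proof. by move=> /sfun_measurable mf; apply/measurable_EFinP. Qed.

Let E0 f : (forall om, 0 <= f om) ->
  forall om : Omega R d, setT om -> (0 <= (f om)%:E)%E.
Proof. by move=> f0 om _; rewrite lee_fin. Qed.

Lemma Ex_ge0 f : (forall om, 0 <= f om) -> (0 <= Ex f)%E.
Proof. by move=> f0; apply: integral_ge0 => om _; rewrite lee_fin. Qed.

Lemma Ex_cst (c : R) : Ex (fun=> c) = c%:E.
Proof.
by rewrite /Ex integral_cst//= [X in (_ * X)%E]probability_setT mule1.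
Qed.

Lemma eq_Ex f g : f =1 g -> Ex f = Ex g.
Proof. by move=> fg; apply: eq_integral => om _; rewrite fg. Qed.

Lemma Ex_D f g : sfun setT f -> sfun setT g ->
  (forall om, 0 <= f om) -> (forall om, 0 <= g om) ->
  Ex (fun om => f om + g om) = (Ex f + Ex g)%E.
Proof.
move=> mf mg f0 g0.
exact: (ge0_integralD P measurableT (E0 f0) (mE mf) (E0 g0) (mE mg)).
Qed.

Lemma Ex_Zl (c : R) f : 0 <= c -> sfun setT f -> (forall om, 0 <= f om) ->
  Ex (fun om => c * f om) = (c%:E * Ex f)%E.
Proof.
move=> c0 mf f0.
exact: (@ge0_integralZl _ _ _ P _ measurableT _ (mE mf) c%:E (E0 f0) c0).
Qed.

Lemma Ex_sum (T : Type) (r : seq T) (F : T -> Env R d -> R) :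
  (forall i, sfun setT (F i)) -> (forall i om, 0 <= F i om) ->
  Ex (fun om => \sum_(i <- r) F i om) = (\sum_(i <- r) Ex (F i))%E.
Proof.
move=> mF F0.
rewrite -(ge0_integral_sum P measurableT (fun i => mE (mF i)) (fun i => E0 (F0 i))).
by apply: eq_integral => om _; rewrite sumEFin.
Qed.

Lemma Ex_le f g : sfun setT f -> sfun setT g ->
  (forall om, 0 <= f om) -> (forall om, f om <= g om) -> (Ex f <= Ex g)%E.
Proof.
move=> mf mg f0 fg.
apply: (ge0_le_integral P measurableT (E0 f0) (mE mf) (mE mg)) => om _.
by rewrite lee_fin fg.
Qed.

Lemma ae_eq_Ex f g : sfun setT f -> sfun setT g ->
  {ae P, forall om, f om = g om} ->
  (forall om, 0 <= f om) -> (forall om, 0 <= g om) -> Ex f = Ex g.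
Proof.
move=> mf mg fg f0 g0.
apply: (ge0_ae_eq_integral measurableT (mE mf) (mE mg) (E0 f0) (E0 g0)).
by apply: (ae_imp _ fg) => om ->.
Qed.

Variable c1 : R.
Hypothesis hP : env_assumptions P c1.

Lemma Ex_shift n x f : sfun setT f -> (forall om, 0 <= f om) ->
  Ex (fun om => f (shift n x om)) = Ex f.
Proof.
move=> mf f0.
have ms := @measurable_shift R d n x.
transitivity (\int[pushforward P (shift n x)]_om (f om)%:E)%E.
  rewrite (ge0_integral_pushforward ms P measurableT (mE mf))//.
  by move=> y _; rewrite lee_fin.
by apply: eq_measure_integral => A mA _; exact: (P_shift hP).
Qed.

(** By [sgen_indep] the image of [P] under the diagonal map into [Om I * Om J] is the product of the
    two restrictions of [P]; Tonelli then splits the integral. *)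
Lemma Ex_indep I J f g : I `&` J = set0 -> sfun I f -> sfun J g ->
  (forall om, 0 <= f om) -> (forall om, 0 <= g om) ->
  Ex (fun om => f om * g om) = (Ex f * Ex g)%E.
Proof.
move=> IJ mf mg f0 g0.
have idm K : measurable_fun (setT : set (Omega R d)) (id : Omega R d -> Om K).
  by move=> _ B mB; rewrite setTI; exact: (sgen_measurable mB).
pose PI := pushforward P (id : Omega R d -> Om I).
pose PJ := pushforward P (id : Omega R d -> Om J).
pose iI : {mfun (Omega R d) >-> Om I} := HB.pack id (isMeasurableFun.Build _ _ _ _ _ (idm I)).
pose iJ : {mfun (Omega R d) >-> Om J} := HB.pack id (isMeasurableFun.Build _ _ _ _ _ (idm J)).
pose mI : probability (Om I) R := distribution P iI.
pose mJ : probability (Om J) R := distribution P iJ.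
pose dg (om : Omega R d) : Om I * Om J := (om, om).
have mdg : measurable_fun setT dg by apply/measurable_fun_pair; exact: idm.
have mff : measurable_fun setT (fun w : Om I * Om J => (f w.1 * g w.2)%:E).
  apply/measurable_EFinP; apply: measurable_funM.
    by apply: (measurableT_comp (f := (f : Om I -> R))).
  by apply: (measurableT_comp (f := (g : Om J -> R))).
transitivity (\int[mI \x mJ]_w (f w.1 * g w.2)%:E)%E.
  transitivity (\int[pushforward P dg]_w (f w.1 * g w.2)%:E)%E.
    rewrite (ge0_integral_pushforward mdg P measurableT mff)//.
    by move=> w _; rewrite lee_fin mulr_ge0.
  apply: eq_measure_integral => A mA _; symmetry.
  apply: (product_measure_unique (m' := pushforward P dg)) => //.
  move=> X Y mX mY; exact: (sgen_indep hP IJ mX mY).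
rewrite fubini_tonelli1//; last by move=> w; rewrite lee_fin mulr_ge0.
rewrite /fubini_F /=.
under eq_integral => om _.
  under eq_integral => om' _ do rewrite EFinM.
  rewrite ge0_integralZl//=; last 3 first.
    by apply/measurable_EFinP.
    by move=> w _; rewrite lee_fin.
    by rewrite lee_fin.
  over.
rewrite ge0_integralZr//=; last 3 first.
  by apply/measurable_EFinP.
  by move=> w _; rewrite lee_fin.
  by apply: integral_ge0 => w _; rewrite lee_fin.
congr (_ * _)%E.
  rewrite ge0_integral_pushforward//; first by apply/measurable_EFinP.
  by move=> w _; rewrite lee_fin.
rewrite ge0_integral_pushforward//; first by apply/measurable_EFinP.
by move=> w _; rewrite lee_fin.
Qed.

End Expectation.

(** * Second moments of the partition functions *)

Section Weights.
Variables (R : realType) (d : nat).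
Local Notation site := (int * Zd d)%type.
Variable t : Env R d -> U d -> R.

Definition lay (a b : int) : set site := [set s | a <= s.1 < b].

Definition fstep (z : U d) (om : Omega R d) : Omega R d := shift 1 (uvec z) om.
Definition bstep (z : U d) (om : Omega R d) : Omega R d := shift (-1) (- uvec z) om.

(** Partition functions: [fwd] runs over paths leaving the space-time origin, [bwd], its time
    reversal, over paths arriving there. *)
Fixpoint fwd (m : nat) (om : Omega R d) : R :=
  if m is m'.+1 then \sum_(z : U d) t om z * fwd m' (fstep z om) else 1.

Fixpoint bwd (m : nat) (om : Omega R d) : R :=
  if m is m'.+1 then \sum_(z : U d) t (bstep z om) z * bwd m' (bstep z om) else 1.

Hypothesis t_meas : forall z, sfun [set (0, 0)] (t^~ z).
Hypothesis t_ge0 : forall om z, 0 <= t om z.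

Lemma sfun_t_shift y z : sfun [set (0, y)] (fun om => t (shift 0 y om) z).
Proof.
by apply: (sfun_shift _ (t_meas z)) => _ -> /=; rewrite !add0r.
Qed.

Lemma sfun_t_lay y z : sfun (lay 0 1) (fun om => t (shift 0 y om) z).
Proof. by apply: (sfun_sub _ (@sfun_t_shift y z)) => _ -> /=. Qed.

Lemma sfun_t z : sfun (lay 0 1) (t^~ z).
Proof. by apply: (sfun_sub _ (t_meas z)) => _ -> /=. Qed.

Lemma sfun_fwd m : sfun (lay 0 m%:Z) (fwd m).
Proof.
elim: m => [|m IHm]; first exact: sfun_cst.
apply: sfun_sum => z; apply: sfunM.
  by apply: (sfun_sub _ (t_meas z)) => _ -> /=.
apply: (sfun_shift _ IHm) => s; rewrite /lay/=; lia.
Qed.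

Lemma sfun_bwd m : sfun (lay (- m%:Z) 0) (bwd m).
Proof.
elim: m => [|m IHm]; first exact: sfun_cst.
apply: sfun_sum => z; apply: sfunM.
  by apply: (sfun_shift _ (t_meas z)) => _ -> /=; rewrite /lay/=; lia.
apply: (sfun_shift _ IHm) => s; rewrite /lay/=; lia.
Qed.

Lemma fwd_ge0 m om : 0 <= fwd m om.
Proof. by elim: m om => [|m IHm] om //=; rewrite sumr_ge0// => z _; rewrite mulr_ge0. Qed.

Lemma bwd_ge0 m om : 0 <= bwd m om.
Proof. by elim: m om => [|m IHm] om //=; rewrite sumr_ge0// => z _; rewrite mulr_ge0. Qed.

Lemma sfunT I f : sfun I f -> sfun (setT : set site) (f : Env R d -> R).
Proof. exact: sfun_sub. Qed.

Section Moments.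
Variables (P : probability (Omega R d) R) (c1 : R).
Hypothesis hP : env_assumptions P c1.
Variables (p : U d -> R) (V : U d -> U d -> R).
Hypothesis Ex_t : forall z, Ex P (t^~ z) = (p z)%:E.
Hypothesis Ex_tt : forall z z', Ex P (fun om => t om z * t om z') = (V z z')%:E.
Hypothesis p_sum1 : \sum_z p z = 1.

Lemma Ex_tt_shift y z z' :
  Ex P (fun om => t om z * t (shift 0 y om) z') = (pair_wt p V y z z')%:E.
Proof.
rewrite /pair_wt; case: eqP => [->|/eqP y0].
  by rewrite -Ex_tt; apply: eq_Ex => om; rewrite shift0.
rewrite (Ex_indep hP _ (t_meas z) (@sfun_t_shift y z'))//; last first.
  by rewrite -subset0 => _ [-> [/esym/eqP]]; rewrite (negPf y0).
rewrite Ex_t EFinM; congr (_ * _)%E.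
rewrite -Ex_t; apply: (@Ex_shift _ _ _ _ hP 0 y (t^~ z')) => //.
exact: sfunT (t_meas z').
Qed.

Lemma lay_disj a b c e : b <= c -> lay a b `&` lay c e = set0.
Proof. by move=> bc; rewrite -subset0 => s []; rewrite /lay/=; lia. Qed.

Lemma Ex_fwd m : Ex P (fwd m) = 1%E.
Proof.
elim: m => [|m IHm]; first exact: Ex_cst.
have mz z : sfun (lay 1 m.+1%:Z) (fun om => fwd m (fstep z om)).
  by apply: (sfun_shift _ (@sfun_fwd m)) => s; rewrite /lay/=; lia.
rewrite Ex_sum; last 2 first.
- by move=> z; apply: sfunM; [exact: sfunT (t_meas z)|exact: sfunT (mz z)].
- by move=> z om; rewrite mulr_ge0// fwd_ge0.
under eq_bigr => z _.
  rewrite (Ex_indep hP (lay_disj _ _ (lexx 1)) (@sfun_t z) (mz z))//; last first.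
    by move=> om; rewrite fwd_ge0.
  rewrite (@Ex_shift _ _ _ _ hP _ _ (fwd m))//; last 2 first.
    exact: sfunT (@sfun_fwd m).
    exact: fwd_ge0.
  rewrite IHm Ex_t mule1.
  over.
by rewrite sumEFin p_sum1.
Qed.

Lemma Ex_bwd m : Ex P (bwd m) = 1%E.
Proof.
elim: m => [|m IHm]; first exact: Ex_cst.
have mb z : sfun setT (fun om => t om z * bwd m om).
  by apply: sfunM; [exact: sfunT (t_meas z)|exact: sfunT (@sfun_bwd m)].
have b0 z om : 0 <= t om z * bwd m om by rewrite mulr_ge0// bwd_ge0.
rewrite Ex_sum; last 2 first.
- by move=> z; exact: (sfun_shift _ (mb z)).
- by move=> z om; exact: b0.
under eq_bigr => z _.
  rewrite (Ex_shift hP (-1) (- uvec z) (mb z) (b0 z)).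
  rewrite (Ex_indep hP _ (@sfun_t z) (@sfun_bwd m))//; last 2 first.
    by rewrite setIC; exact: lay_disj.
    exact: bwd_ge0.
  rewrite IHm Ex_t mule1.
  over.
by rewrite sumEFin p_sum1.
Qed.

(** The answer ignores [b]: past time [a] the longer replica moves alone with mean weight one. This
    is the orthogonality of increments behind the L2 limit. *)
Lemma Ex_fwd_fwd a b y : (a <= b)%N ->
  Ex P (fun om => fwd a om * fwd b (shift 0 y om)) =
  (iter a (pair_fwd p V) (fun=> 1) y)%:E.
Proof.
have mF m x : sfun (lay 0 m%:Z) (fun om => fwd m (shift 0 x om)).
  by apply: (sfun_shift _ (@sfun_fwd m)) => s; rewrite /lay/=; lia.
elim: a b y => [|a IHa] b y ab.
  under eq_Ex do rewrite mul1r.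
  rewrite (Ex_shift hP 0 y (sfunT (@sfun_fwd b)))//; last exact: fwd_ge0.
  exact: Ex_fwd.
case: b ab => // b ab.
pose H w om := fwd a om * fwd b (shift 0 w om).
have eqH z z' om : fwd a (fstep z om) * fwd b (fstep z' (shift 0 y om)) =
    H (y + uvec z' - uvec z) (fstep z om).
  have e w : w + y = y + w - uvec z + uvec z :> Zd d by rewrite subrK addrC.
  by rewrite /H /fstep !shift_shift addr0 add0r e.
have mH w : sfun setT (H w).
  by apply: sfunM; [exact: sfunT (@sfun_fwd a)|exact: sfunT (mF b w)].
have mH1 w z : sfun [set s : site | 1 <= s.1] (fun om => H w (fstep z om)).
  have mH0 : sfun [set s : site | 0 <= s.1] (H w).
    apply: sfunM; first by apply: (sfun_sub _ (@sfun_fwd a)) => s /andP[].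
    by apply: (sfun_sub _ (mF b w)) => s /andP[].
  by apply: (sfun_shift _ mH0) => s; rewrite /=; lia.
have H0 w om : 0 <= H w om by rewrite mulr_ge0 ?fwd_ge0.
have mtt z z' : sfun (lay 0 1) (fun om => t om z * t (shift 0 y om) z').
  by apply: sfunM; [exact: sfun_t|exact: sfun_t_lay].
transitivity (\sum_z \sum_z' Ex P (fun om => t om z * t (shift 0 y om) z' *
    H (y + uvec z' - uvec z) (fstep z om))%R)%E.
  have mterm z z' : sfun setT (fun om => t om z * t (shift 0 y om) z' *
    H (y + uvec z' - uvec z) (fstep z om)).
    by apply: sfunM; [exact: sfunT (mtt z z')|exact: sfunT (mH1 _ _)].
  have t0 z z' om : 0 <= t om z * t (shift 0 y om) z' *
    H (y + uvec z' - uvec z) (fstep z om) by rewrite !mulr_ge0 ?fwd_ge0.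
  under [RHS]eq_bigr => z _ do rewrite -Ex_sum//.
  rewrite -Ex_sum; last 2 first.
  - by move=> z; apply: sfun_sum => z'.
  - by move=> z om; rewrite sumr_ge0.
  apply: eq_Ex => om; rewrite mulr_suml; apply: eq_bigr => z _.
  rewrite mulr_sumr; apply: eq_bigr => z' _.
  by rewrite -eqH mulrACA.
rewrite iterS {1}/pair_fwd -sumEFin; apply: eq_bigr => z _.
rewrite -sumEFin; apply: eq_bigr => z' _.
rewrite (Ex_indep hP _ (mtt z z') (mH1 _ z))//; last 2 first.
- by rewrite -subset0 => s []; rewrite /lay/=; lia.
- by move=> om; rewrite mulr_ge0.
rewrite Ex_tt_shift EFinM; congr (_ * _)%E.
by rewrite (Ex_shift hP 1 (uvec z) (mH _) (H0 _)) IHa.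
Qed.

(** Peeling the last step of each replica leaves them at displacement [y - uvec z' + uvec z]; the
    sites read are those, so this displacement decides whether the weights interact. *)
Lemma Ex_bwd_bwd a b y : (a <= b)%N ->
  Ex P (fun om => bwd a om * bwd b (shift 0 y om)) =
  (iter a (pair_back p V) (fun=> 1) y)%:E.
Proof.
have mF m x : sfun (lay (- m%:Z) 0) (fun om => bwd m (shift 0 x om)).
  by apply: (sfun_shift _ (@sfun_bwd m)) => s; rewrite /lay/=; lia.
elim: a b y => [|a IHa] b y ab.
  under eq_Ex do rewrite mul1r.
  rewrite (Ex_shift hP 0 y (sfunT (@sfun_bwd b)))//; last exact: bwd_ge0.
  exact: Ex_bwd.
case: b ab => // b ab.
pose H w om := bwd a om * bwd b (shift 0 w om).
pose W w z z' om := t om z * t (shift 0 w om) z' * H w om.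
have eqW z z' om : t (bstep z om) z * bwd a (bstep z om) *
    (t (bstep z' (shift 0 y om)) z' * bwd b (bstep z' (shift 0 y om))) =
    W (y - uvec z' + uvec z) z z' (bstep z om).
  rewrite mulrACA /W /H /bstep !shift_shift.
  by rewrite addrK addr0 add0r [- uvec z' + y]addrC.
have mH w : sfun [set s : site | s.1 < 0] (H w).
  apply: sfunM; first by apply: (sfun_sub _ (@sfun_bwd a)) => s /andP[].
  by apply: (sfun_sub _ (mF b w)) => s /andP[].
have H0 w om : 0 <= H w om by rewrite mulr_ge0 ?bwd_ge0.
have mtt w z z' : sfun (lay 0 1) (fun om => t om z * t (shift 0 w om) z').
  by apply: sfunM; [exact: sfun_t|exact: sfun_t_lay].
have mW w z z' : sfun setT (W w z z').
  by apply: sfunM; [exact: sfunT (mtt w z z')|exact: sfunT (mH w)].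
have W0 w z z' om : 0 <= W w z z' om by rewrite !mulr_ge0 ?bwd_ge0.
transitivity (\sum_z \sum_z' Ex P
    (fun om => W (y - uvec z' + uvec z) z z' (bstep z om))%R)%E.
  have mterm z z' : sfun setT (fun om => W (y - uvec z' + uvec z) z z' (bstep z om)).
    exact: (sfun_shift _ (mW _ z z')).
  under [RHS]eq_bigr => z _ do rewrite -Ex_sum//.
  rewrite -Ex_sum; last 2 first.
  - by move=> z; apply: sfun_sum => z'.
  - by move=> z om; rewrite sumr_ge0.
  apply: eq_Ex => om; rewrite mulr_suml; apply: eq_bigr => z _.
  rewrite mulr_sumr; apply: eq_bigr => z' _.
  by rewrite -eqW.
rewrite iterS {1}/pair_back -sumEFin; apply: eq_bigr => z _.
rewrite -sumEFin; apply: eq_bigr => z' _.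
rewrite (Ex_shift hP (-1) (- uvec z) (mW _ z z') (W0 _ z z')).
rewrite (Ex_indep hP _ (mtt _ z z') (mH _))//; last 2 first.
- by rewrite -subset0 => s []; rewrite /lay/=; lia.
- by move=> om; rewrite mulr_ge0.
by rewrite Ex_tt_shift EFinM IHa.
Qed.

End Moments.
End Weights.

(** * Almost sure limits of sequences with orthogonal increments *)

Lemma sum_half_pow (R : numFieldType) n :
  \sum_(0 <= k < n) (2 ^- k : R) = 2 - 2 * 2 ^- n.
Proof.
elim: n => [|n IHn]; first by rewrite big_geq// expr0 invr1 mulr1 subrr.
by rewrite big_nat_recr//= IHn exprS invfM; field; rewrite expf_neq0.
Qed.

Section SummableL1.
Context d (T : measurableType d) (R : realType) (mu : {measure set T -> \bar R}).
Variable g : nat -> T -> R.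
Hypothesis mg : forall k, measurable_fun setT (g k).
Hypothesis g0 : forall k x, 0 <= g k x.
Hypothesis gle : forall k, (\int[mu]_x (g k x)%:E <= (2 ^- k)%:E)%E.

Definition total_sum x : \bar R := (\sum_(0 <= k <oo) (g k x)%:E)%E.

Lemma integrable_total_sum : mu.-integrable setT total_sum.
Proof.
have mgE k : measurable_fun setT (EFin \o g k) by apply/measurable_EFinP.
have g0E k x : (0 <= (g k x)%:E)%E by rewrite lee_fin.
have ts0 x : (0 <= total_sum x)%E by apply: nneseries_ge0 => k _ _.
apply/integrableP; split.
  apply: (@ge0_emeasurable_sum _ _ _ setT (fun k x => (g k x)%:E) xpredT) => // k _; exact: mgE.
under eq_integral => x _ do rewrite gee0_abs//.
rewrite integral_nneseries//.
apply: (@le_lt_trans _ _ 2%:E); last by rewrite ltry.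
apply: lime_le.
  by apply: is_cvg_nneseries => k _ _; apply: integral_ge0 => x _.
apply: nearW => n; apply: (@le_trans _ _ (\sum_(0 <= k < n) (2 ^- k)%:E)%E).
  exact: lee_sum.
by rewrite sumEFin lee_fin sum_half_pow gerBl mulr_ge0// invr_ge0 exprn_ge0.
Qed.

Lemma total_sum_ge n x : ((\sum_(0 <= k < n) g k x)%:E <= total_sum x)%E.
Proof.
rewrite -sumEFin; apply: nneseries_lim_ge => k _ _.
by rewrite lee_fin.
Qed.

Lemma ae_summable : {ae mu, forall x, cvgn (series (g^~ x))}.
Proof.
have := integrable_ae measurableT integrable_total_sum.
apply: filterS => x /(_ I) fin.
apply: nondecreasing_is_cvgn.
  by apply: nondecreasing_series => k _ _.
exists (fine (total_sum x)) => _ [n _ <-].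
by rewrite -lee_fin fineK// total_sum_ge.
Qed.

End SummableL1.

Section L2Limit.
Variables (R : realType) (d : nat) (P : probability (Omega R d) R).
Local Notation site := (int * Zd d)%type.
Variables (J : set site) (f : nat -> Env R d -> R) (M : nat -> R) (B : R).
Hypothesis mf : forall n, sfun J (f n).
Hypothesis f0 : forall n om, 0 <= f n om.
Hypothesis Eff : forall a b, (a <= b)%N ->
  Ex P (fun om => f a om * f b om) = (M a)%:E.
Hypothesis MB : forall n, M n <= B.

Let mfT n : sfun setT (f n). Proof. exact: sfun_sub (mf n). Qed.

(** By [Eff] the cross term has the same mean as the square of the earlier function. *)
Lemma Ex_sqr_diff a b : (a <= b)%N ->
  Ex P (fun om => (f b om - f a om) ^+ 2) = (M b - M a)%:E.
Proof.
move=> ab.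
have m1 : sfun setT (fun om => (f b om - f a om) ^+ 2).
  by apply: measurable_funX; exact: sfunB.
have m2 : sfun setT (fun om => 2 * (f a om * f b om)).
  by apply: sfunM; [exact: sfun_cst|exact: sfunM].
have e : Ex P (fun om => (f b om - f a om) ^+ 2 + 2 * (f a om * f b om)) =
    Ex P (fun om => f b om * f b om + f a om * f a om).
  by apply: eq_Ex => om; ring.
move: e; rewrite Ex_D//; last 2 first.
- by move=> om; exact: sqr_ge0.
- by move=> om; rewrite !mulr_ge0.
rewrite Ex_D//; last 4 first.
- exact: sfunM.
- exact: sfunM.
- by move=> om; rewrite mulr_ge0.
- by move=> om; rewrite mulr_ge0.
rewrite Ex_Zl//; last 2 first.
- exact: sfunM.
- by move=> om; rewrite mulr_ge0.
rewrite !Eff//.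
have := Ex_ge0 P (fun om => sqr_ge0 (f b om - f a om)).
case: (Ex P _) => [r _| |]//=.
by rewrite -!EFinM -!EFinD => -[h]; congr EFin; lra.
Qed.

Lemma M_mono a b : (a <= b)%N -> M a <= M b.
Proof.
move=> ab; rewrite -subr_ge0 -lee_fin -Ex_sqr_diff//.
by apply: Ex_ge0 => om; exact: sqr_ge0.
Qed.

(** A gap of [4^-k] between second moments becomes [2^-k] in L1, which is summable. *)
Lemma exists_rate : exists phi : nat -> nat,
  {homo phi : a b / (a <= b)%N} /\ (forall k, (k <= phi k)%N) /\
  forall k b, (phi k <= b)%N -> M b - M (phi k) <= 2 ^- k * 2 ^- k.
Proof.
have hs : has_sup (range M).
  by split; [exists (M 0%N), 0%N|exists B => _ [n _ <-]].
have ex k : exists n, M n > sup (range M) - 2 ^- k * 2 ^- k.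
  have e0 : 0 < 2 ^- k * 2 ^- k :> R by rewrite mulr_gt0 // invr_gt0 exprn_gt0.
  by have [_ [n _ <-] h] := sup_adherent e0 hs; exists n.
have [n hn] := choice ex.
(* Partial sums of the witnesses make [phi] monotone, and the successors make it at least [k]. *)
pose phi k := (\sum_(j < k.+1) (n j).+1)%N.
exists phi; split; [|split].
- move=> a b ab; rewrite /phi -(subnKC ab) -addSn big_split_ord/=.
  exact: leq_addr.
- move=> k; rewrite /phi; elim: k => [//|k IHk].
  by rewrite big_ord_recr/=; apply: leq_ltn_trans IHk _; rewrite addnS ltnS leq_addr.
- move=> k b kb.
  have Mb : M b <= sup (range M) by apply: sup_upper_bound => //; exists b.
  have nk : M (n k) <= M (phi k).
    apply: M_mono; rewrite /phi big_ord_recr/=; apply: leq_trans (leq_addl _ _).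
    exact: leqnSn.
  have := hn k; lra.
Qed.

(** Integrates [y <= y ^ 2 / (2 e) + e / 2] with [e = 2^-k], in place of Cauchy-Schwarz. *)
Lemma Ex_abs_diff k a b : (a <= b)%N -> M b - M a <= 2 ^- k * 2 ^- k ->
  (Ex P (fun om => `|f b om - f a om|)%R <= (2 ^- k)%:E)%E.
Proof.
move=> ab h; set e : R := 2 ^- k.
have e0 : 0 < e by rewrite invr_gt0 exprn_gt0.
pose G om := (2 * e)^-1 * (f b om - f a om) ^+ 2.
have mB : sfun setT (fun om => f b om - f a om) by exact: sfunB.
have m1 : sfun setT (fun om => (f b om - f a om) ^+ 2) by exact: measurable_funX.
have mG : sfun setT G by apply: sfunM => //; exact: sfun_cst.
have ei : 0 <= (2 * e)^-1 by rewrite invr_ge0 mulr_ge0// ltW.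
have G0 om : 0 <= G om by rewrite mulr_ge0// sqr_ge0.
apply: (@le_trans _ _ (Ex P (fun om => G om + e / 2))).
  apply: Ex_le => //.
  - exact: measurableT_comp.
  - by apply: sfunD => //; exact: sfun_cst.
  - move=> om; rewrite /G.
    set x := f b om - f a om; rewrite -(real_normK (num_real x)).
    set y := `|x|; rewrite -subr_ge0.
    have -> : (2 * e)^-1 * y ^+ 2 + e / 2 - y = (2 * e)^-1 * (y - e) ^+ 2.
      by field; rewrite gt_eqF.
    by rewrite mulr_ge0// sqr_ge0.
rewrite Ex_D//; last 2 first.
- exact: sfun_cst.
- by move=> om; rewrite divr_ge0// ltW.
rewrite Ex_cst Ex_Zl//; last by move=> om; exact: sqr_ge0.
rewrite Ex_sqr_diff// -EFinM -EFinD lee_fin.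
have : (2 * e)^-1 * (M b - M a) <= (2 * e)^-1 * (e * e) by rewrite ler_wpM2l.
have -> : (2 * e)^-1 * (e * e) = e / 2 by field; rewrite gt_eqF.
lra.
Qed.

(** Convergence along [phi k] and along its successor lets a one-step recursion pass to the limit.
    Convergence of the means follows by domination, with the first term plus the sum of all absolute
    increments. *)
Lemma L2_limit : exists (phi : nat -> nat) (u : Env R d -> R),
  [/\ sfun J u, (forall om, 0 <= u om), (forall k, (k <= phi k)%N),
   {ae P, forall om, (f (phi k) om @[k --> \oo] --> u om) /\
                     (f (phi k).+1 om @[k --> \oo] --> u om)} &
   Ex P (f (phi k)) @[k --> \oo] --> Ex P u].
Proof.
have [phi [phi_mono [phi_ge rate]]] := exists_rate.
pose g (k : nat) (om : Omega R d) : R := `|f (phi k.+1) om - f (phi k) om|.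
pose h (k : nat) (om : Omega R d) : R := `|f (phi k).+1 om - f (phi k) om|.
have mg k : sfun setT (g k) by apply: measurableT_comp => //; exact: sfunB.
have mh k : sfun setT (h k) by apply: measurableT_comp => //; exact: sfunB.
have g0 k om : 0 <= g k om by exact: normr_ge0.
have h0 k om : 0 <= h k om by exact: normr_ge0.
have gle k : (\int[P]_om (g k om)%:E <= (2 ^- k)%:E)%E.
  by apply: Ex_abs_diff; rewrite ?phi_mono ?rate ?phi_mono.
have hle k : (\int[P]_om (h k om)%:E <= (2 ^- k)%:E)%E.
  by apply: Ex_abs_diff; rewrite ?leqnSn ?rate ?leqnSn.
have mgT k := sfun_measurable (mg k); have mhT k := sfun_measurable (mh k).
have gae := ae_summable mgT g0 gle.
have hae := ae_summable mhT h0 hle.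
(* The upper limit is defined everywhere and measurable for the sites in [J] alone; it is the limit
   wherever the increments are summable. *)
pose u (om : Env R d) := fine (limn_esup (fun k => (f (phi k) om)%:E)).
have cvg_u (om : Omega R d) : cvgn (series (g^~ om)) ->
    f (phi k) om @[k --> \oo] --> u om.
  move=> cg.
  have cs : cvgn (series (fun k => f (phi k.+1) om - f (phi k) om)).
    exact: normed_cvg.
  have cf : cvgn (fun k => f (phi k) om).
    rewrite (_ : (fun k => _) = fun k => f (phi 0%N) om +
      series (fun k => f (phi k.+1) om - f (phi k) om) k).
      by apply: is_cvgD => //; exact: is_cvg_cst.
    apply/funext => k; rewrite seriesEnat/= (telescope_sumr (fun k => f (phi k) om))//.
    by rewrite addrC subrK.
  have [l hl] := (cvg_ex _).1 cf.
  have hlE : (f (phi k) om)%:E @[k --> \oo] --> l%:E.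
    by apply/cvg_EFin => //; exact: nearW.
  rewrite /u is_cvg_limn_esupE; last by apply/cvg_ex; exists l%:E.
  by rewrite (cvg_lim _ hlE).
have mu : sfun J u.
  have ml : measurable_fun (setT : set (Om J))
      (fun om : Om J => limn_esup (fun k => (f (phi k) om)%:E)).
    apply: measurable_fun_limn_esup => k; apply/measurable_EFinP; exact: mf.
  apply: measurableT_comp ml; exact: fine_measurable.
have u0 om : 0 <= u om.
  apply: fine_ge0; rewrite limn_esup_lim; apply: lime_ge; first exact: is_cvg_esups.
  apply: nearW => n; apply: le_trans (ereal_sup_ubound _); last by exists n => /=.
  by rewrite lee_fin.
exists phi, u; split => //.
  move: gae hae; apply: filterS2 => om cg ch; split; first exact: cvg_u.
  have hc0 : h k om @[k --> \oo] --> 0 := cvg_series_cvg_0 ch.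
  have h1 : (f (phi k).+1 om - f (phi k) om) @[k --> \oo] --> (0 : R).
    by apply/norm_cvg0P.
  rewrite -[u om]add0r; rewrite (_ : (fun k => f (phi k).+1 om) =
    fun k => (f (phi k).+1 om - f (phi k) om) + f (phi k) om); last first.
    by apply/funext => k; rewrite subrK.
  by apply: cvgD => //; exact: cvg_u.
pose S (om : Omega R d) := ((f (phi 0%N) om)%:E + total_sum g om)%E.
have iS : P.-integrable setT S.
  apply: integrableD => //; last exact: integrable_total_sum.
  apply/integrableP; split; first by apply/measurable_EFinP; exact: sfun_measurable (mf _).
  under eq_integral => om _ do rewrite gee0_abs ?lee_fin//.
  (* The first term is integrable by its second moment: [x <= x ^ 2 + 1]. *)
  apply: (@le_lt_trans _ _ (Ex P (fun om => f (phi 0%N) om * f (phi 0%N) om + 1))).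
    apply: Ex_le => //; first by apply: sfunD; [exact: sfunM|exact: sfun_cst].
    by move=> om; have := sqr_ge0 (f (phi 0%N) om - 1); have := f0 (phi 0%N) om; nra.
  rewrite Ex_D//; last 3 first.
  - exact: sfunM.
  - exact: sfun_cst.
  - by move=> om; rewrite mulr_ge0.
  by rewrite Eff// Ex_cst -EFinD ltry.
have [] := @dominated_convergence _ _ _ P setT measurableT
  (fun k om => (f (phi k) om)%:E) (fun om => (u om)%:E) S.
- by move=> k; apply/measurable_EFinP; exact: (sfun_measurable (mf _)).
- apply/measurable_EFinP; exact: (sfun_measurable mu).
- move: gae; apply: filterS => om cg _; apply/cvg_EFin; first exact: nearW.
  exact: cvg_u.
- exact: iS.
- apply: aeW => om k _.
  rewrite abse_EFin ger0_norm//.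
  apply: le_trans (leeD (lexx _) (total_sum_ge g0 k om)).
  rewrite -EFinD lee_fin.
  have -> : f (phi k) om = f (phi 0%N) om + \sum_(0 <= j < k) (f (phi j.+1) om - f (phi j) om).
    by rewrite (telescope_sumr (fun k => f (phi k) om))// addrC subrK.
  by rewrite lerD2l; apply: ler_sum => j _; exact: ler_norm.
by move=> _ _.
Qed.

End L2Limit.

(** * Tilted weights and the parameter theta *)

Lemma prob1_ae d (T : measurableType d) (R : realType) (P : probability T R)
    (A : set T) : measurable A -> P A = 1%E -> {ae P, forall x, A x}.
Proof.
move=> mA PA; exists (~` A); split; first exact: measurableC.
  by rewrite probability_setC// PA subee.
by move=> x.
Qed.

Lemma ae_forall_countable d (T : measurableType d) (R : realType)
    (mu : {measure set T -> \bar R}) (I : countType) (A : I -> T -> Prop) :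
  (forall i, {ae mu, forall x, A i x}) -> {ae mu, forall x, forall i, A i x}.
Proof.
move=> h.
have : {ae mu, forall x, forall k : nat,
    match @unpickle I k with Some i => A i x | None => True end}.
  apply: ae_foralln => k; case: (@unpickle I k) => [i|]; first exact: h.
  exact: aeW.
by apply: ae_imp => x hx i; have := hx (pickle i); rewrite pickleK.
Qed.

Section Clean.
Variables (R : realType) (d : nat).
Local Notation site := (int * Zd d)%type.

Definition good (c : R) (v : U d -> R) : bool :=
  [forall z, c <= v z] && (\sum_z v z == 1).

Lemma sgen_good c n x : <<s sgen [set (n, x)] >> [set om : Env R d | good c (om n x)].
Proof.
have mc z : sfun [set (n, x)] (fun om : Env R d => om n x z) by exact: sfun_coord.
have -> : [set om : Env R d | good c (om n x)] =
    [set om | \sum_z om n x z = 1] `&`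
    \bigcap_(z in [set: U d]) [set om | c <= om n x z].
  apply/seteqP; split=> [om /andP[/forallP h /eqP h1]|om [h1 h]].
    by split => // z _; exact: h.
  by apply/andP; split; [apply/forallP => z; exact: h|exact/eqP].
pose T := g_sigma_algebraType (@sgen R d [set (n, x)]).
apply: (@measurableI _ T).
  have := sfun_sum (index_enum (U d)) mc.
  move=> /(_ measurableT [set (1 : R)] (measurable_set1 _)).
  by rewrite setTI.
apply: (@fin_bigcap_measurable _ T) => [|z _]; first exact: finite_finset.
have := mc z; move=> /(_ measurableT `[c, +oo[%classic (measurable_itv _)).
rewrite setTI; congr (<<s _ >> _); apply/seteqP; split=> om /=;
  by rewrite in_itv/= andbT.
Qed.

(* Almost every environment consists of good vectors; replacing the others makes
   the weights positive everywhere without changing them almost surely. *)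
Definition fallback c : U d -> R := xget (fun=> 0) [set v | good c v].

Definition cl (c : R) (v : U d -> R) : U d -> R :=
  if good c v then v else fallback c.

Lemma sfun_cl c z : sfun [set (0, 0)] (fun om : Env R d => cl c (om 0 0) z).
Proof.
pose g := (\1_[set om : Env R d | good c (om 0 0)] : Env R d -> R).
have -> : (fun om : Env R d => cl c (om 0 0) z) =
    fun om => g om * om 0 0 z + (1 - g om) * fallback c z.
  apply/funext => om; rewrite /g indicE /cl.
  case: ifPn => h; first by rewrite mem_set// mul1r subrr mul0r addr0.
  by rewrite memNset ?mul0r ?subr0 ?mul1r ?add0r//; exact/negP.
have mg : sfun [set (0, 0)] g by apply: sfun_indic; exact: sgen_good.
apply: sfunD; apply: sfunM => //; [exact: sfun_coord| |exact: sfun_cst].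
by apply: sfunB => //; exact: sfun_cst.
Qed.

Variables (P : probability (Omega R d) R) (c1 : R).
Hypothesis hP : env_assumptions P c1.

Lemma c1_gt0 : 0 < c1. Proof. by case: hP. Qed.

Lemma ae_good : {ae P, forall om, forall n x, good c1 (om n x)}.
Proof.
have [h1 _ _ _ h5] := hP.
have ae0 : {ae P, forall om : Omega R d, good c1 (om 0 0)}.
  have a1 : {ae P, forall om : Omega R d, good 0 (om 0 0)}.
    apply: prob1_ae; first exact: sgen_measurable (@sgen_good 0 0 0).
    rewrite -(h1 0 0); congr (P _); apply/seteqP; split=> om.
      by move=> /andP[/forallP h /eqP ?].
    by move=> [h hs]; apply/andP; split; [apply/forallP|apply/eqP].
  have a2 : {ae P, forall om : Omega R d, forall z, c1 <= om 0 0 z}.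
    apply: ae_forall_countable => z; apply: prob1_ae (h5 z).
    have := sfun_measurable (@sfun_coord R d setT 0 0 z I) measurableT
      (measurable_itv `[c1, +oo[).
    rewrite setTI; congr (measurable _); apply/seteqP; split=> om /=;
      by rewrite in_itv/= andbT.
  move: a1 a2; apply: filterS2 => om /andP[_ hs] hz.
  by apply/andP; split => //; exact/forallP.
have aes (s : int * Zd d) : {ae P, forall om : Omega R d, good c1 (om s.1 s.2)}.
  have mg k y := sgen_measurable (@sgen_good c1 k y).
  apply: prob1_ae; first exact: mg.
  rewrite -(_ : P [set om : Omega R d | good c1 (om 0 0)] = 1%E).
    rewrite -(P_shift hP s.1 s.2 (mg 0 0)); congr (P _); apply/seteqP; split=> om;
    by rewrite /preimage/shift/= !add0r.
  have [N [mN N0 sub]] := ae0.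
  apply/eqP; rewrite eq_le probability_le1 ?mg//=.
  rewrite -[X in (X <= _)%E](_ : P (~` N) = 1%E); last first.
    by rewrite probability_setC// N0 sube0.
  apply: le_measure; rewrite ?inE; [exact: measurableC|exact: mg|].
  by move=> om Nom; apply: contrapT => h; apply: Nom; exact: sub.
by apply: ae_imp (ae_forall_countable aes) => om h n x; exact: (h (n, x)).
Qed.

(** Good vectors exist because almost every environment supplies one and [P] is not the zero
    measure. *)
Lemma good_fallback : good c1 (fallback c1).
Proof.
suff [v hv] : exists v : U d -> R, good c1 v by rewrite /fallback; case: xgetP => // /(_ v).
apply: contrapT => h.
have [N [mN N0 sub]] := ae_good.
have : P setT = 0%E.
  apply/eqP; rewrite eq_le measure_ge0 andbT -N0; apply: le_measure; rewrite ?inE//.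
  by move=> om _; apply: sub => /= hg; apply: h; exists (om 0 0).
by rewrite probability_setT => /eqP; rewrite onee_eq0.
Qed.

Lemma good_cl v : good c1 (cl c1 v).
Proof. by rewrite /cl; case: ifP => // _; exact: good_fallback. Qed.

Lemma cl_ge v z : c1 <= cl c1 v z.
Proof. by have /andP[/forallP] := good_cl v. Qed.

Lemma cl_sum v : \sum_z cl c1 v z = 1.
Proof. by have /andP[_ /eqP] := good_cl v. Qed.

Lemma cl_gt0 v z : 0 < cl c1 v z. Proof. exact: lt_le_trans c1_gt0 (cl_ge v z). Qed.

Lemma cl_le1 v z : cl c1 v z <= 1.
Proof.
rewrite -(cl_sum v) (bigD1 z)//= lerDl sumr_ge0// => z' _.
exact: ltW (cl_gt0 v z').
Qed.

Let sfunclT z : sfun setT (fun om : Env R d => cl c1 (om 0 0) z).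
Proof. exact: sfun_sub (sfun_cl c1 z). Qed.

Lemma Ex_cl z : Ex P (fun om => cl c1 (om 0 0) z) = (qz P z)%:E.
Proof.
have e : Ex P (fun om => cl c1 (om 0 0) z) = (\int[P]_om (om 0 0 z)%:E)%E.
  apply: ae_eq_integral => //.
  - apply/measurable_EFinP; exact: sfun_measurable (sfunclT z).
  - apply/measurable_EFinP; exact: sfun_measurable (@sfun_coord R d setT 0 0 z I).
  - by apply: ae_imp ae_good => om h _; rewrite /cl h.
rewrite /qz -e fineK// ge0_fin_numE; last by apply: Ex_ge0 => om; rewrite ltW ?cl_gt0.
apply: (@le_lt_trans _ _ 1%E); last by rewrite ltry.
rewrite -(Ex_cst P 1); apply: Ex_le => //.
- exact: sfun_cst.
- by move=> om; rewrite ltW ?cl_gt0.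
- by move=> om; exact: cl_le1.
Qed.

Lemma qz_ge z : c1 <= qz P z.
Proof.
rewrite -lee_fin -Ex_cl -(Ex_cst P c1); apply: Ex_le => //.
- exact: sfun_cst.
- by move=> om; exact: ltW c1_gt0.
- by move=> om; exact: cl_ge.
Qed.

Lemma qz_gt0 z : 0 < qz P z. Proof. exact: lt_le_trans c1_gt0 (qz_ge z). Qed.

Lemma qz_sum : \sum_z qz P z = 1.
Proof.
apply: EFin_inj; rewrite -sumEFin.
under eq_bigr => z _ do rewrite -Ex_cl.
rewrite -Ex_sum//; last by move=> z om; rewrite ltW ?cl_gt0.
by under eq_Ex => om do rewrite cl_sum; exact: Ex_cst.
Qed.

Lemma qz_le1 z : qz P z <= 1.
Proof.
rewrite -qz_sum (bigD1 z)//= lerDl sumr_ge0// => z' _.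
exact: ltW (qz_gt0 z').
Qed.

Lemma ipE (th : 'rV[R]_d) (z : U d) :
  ip th (zR (uvec z)) = if z.2 then th 0 z.1 else - th 0 z.1.
Proof.
rewrite /ip (bigD1 z.1)//= big1 ?addr0 => [|i iz].
  by rewrite !mxE eqxx; case: z.2; rewrite ?mulrN ?mulr1// rmorphN1 mulrN1.
by rewrite !mxE (negPf iz) mulr0.
Qed.

Section Tilt.
Variable th : 'rV[R]_d.
Local Notation Lam := (Lambda_c P th).
Local Notation ex z := (expR (ip th (zR (uvec z)) - Lam)).

Lemma Zsum_gt0 : 0 < \sum_(z : U d) qz P z * expR (ip th (zR (uvec z))).
Proof.
have t0 z : 0 <= qz P z * expR (ip th (zR (uvec z))).
  by rewrite mulr_ge0 ?expR_ge0// ltW ?qz_gt0.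
have [z0 _|e] := pickP (fun _ : U d => true).
  rewrite (bigD1 z0)//= ltr_pwDl ?sumr_ge0// mulr_gt0 ?qz_gt0 ?expR_gt0//.
by have := qz_sum; rewrite big_pred0// => /esym/eqP; rewrite oner_eq0.
Qed.

Lemma expR_Lam : expR Lam = \sum_(z : U d) qz P z * expR (ip th (zR (uvec z))).
Proof. by rewrite /Lambda_c lnK// posrE Zsum_gt0. Qed.

(** [tw] is an everywhere positive version of [tilt]. Its one-site moments [tp] and [tV] are the
    data [p] and [V] of the pair kernels. *)
Definition tw (om : Env R d) (z : U d) : R := cl c1 (om 0 0) z * ex z.
Definition tp (z : U d) : R := qz P z * ex z.
Definition tV (z z' : U d) : R :=
  fine (Ex P (fun om => cl c1 (om 0 0) z * cl c1 (om 0 0) z')) * (ex z * ex z').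

Lemma tw_gt0 om z : 0 < tw om z.
Proof. by rewrite mulr_gt0 ?cl_gt0 ?expR_gt0. Qed.

Lemma tw_ge0 om z : 0 <= tw om z. Proof. exact: ltW (tw_gt0 om z). Qed.

Lemma sfun_tw z : sfun [set (0, 0)] (tw^~ z).
Proof. by apply: sfunM; [exact: sfun_cl|exact: sfun_cst]. Qed.

Lemma tp_sum1 : \sum_z tp z = 1.
Proof.
rewrite /tp; under eq_bigr => z _ do rewrite expRD expRN mulrA.
by rewrite -mulr_suml expR_Lam divff// gt_eqF// Zsum_gt0.
Qed.

Lemma Ex_tw z : Ex P (tw^~ z) = (tp z)%:E.
Proof.
rewrite /tw /tp (_ : (fun om => _) = fun om => ex z * cl c1 (om 0 0) z); last first.
  by apply/funext => om; rewrite mulrC.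
rewrite Ex_Zl ?expR_ge0//; last by move=> om; rewrite ltW ?cl_gt0.
by rewrite Ex_cl -EFinM mulrC.
Qed.

Lemma Ex_clcl z z' : exists v : R, [/\
  Ex P (fun om => cl c1 (om 0 0) z * cl c1 (om 0 0) z') = v%:E &
  c1 ^+ 2 <= v].
Proof.
have m2 : sfun setT (fun om : Env R d => cl c1 (om 0 0) z * cl c1 (om 0 0) z').
  exact: sfunM.
have h1 : ((c1 ^+ 2)%:E <= Ex P (fun om => cl c1 (om 0 0) z * cl c1 (om 0 0) z')%R)%E.
  rewrite -(Ex_cst P (c1 ^+ 2)); apply: Ex_le => //.
  - exact: sfun_cst.
  - by move=> om; exact: sqr_ge0.
  - by move=> om; rewrite expr2 ler_pM// ?cl_ge// ltW ?c1_gt0.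
have h2 : (Ex P (fun om => cl c1 (om 0 0) z * cl c1 (om 0 0) z')%R <= 1%:E)%E.
  rewrite -(Ex_cst P 1); apply: Ex_le => //.
  - exact: sfun_cst.
  - by move=> om; rewrite mulr_ge0// ltW ?cl_gt0.
  - by move=> om; rewrite mulr_ile1 ?cl_le1// ltW ?cl_gt0.
move: h1 h2; case: (Ex P _) => [v| |]//= h1 h2.
by exists v; split => //; rewrite -lee_fin.
Qed.

Lemma Ex_tw2 z z' : Ex P (fun om => tw om z * tw om z') = (tV z z')%:E.
Proof.
rewrite /tw /tV (_ : (fun om => _) = fun om => (ex z * ex z') *
  (cl c1 (om 0 0) z * cl c1 (om 0 0) z')); last first.
  by apply/funext => om; ring.
rewrite Ex_Zl ?mulr_ge0 ?expR_ge0//; last 2 first.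
- exact: sfunM.
- by move=> om; rewrite mulr_ge0// ltW ?cl_gt0.
by have [v [-> _]] := Ex_clcl z z'; rewrite -EFinM mulrC.
Qed.

Lemma ae_tw_tilt : {ae P, forall om, forall n x z,
  tw (shift n x om) z = tilt P th (shift n x om) z}.
Proof.
apply: ae_imp ae_good => om h n x z.
by rewrite /tw /tilt /cl /shift h.
Qed.

Variable r : R.
Hypothesis th_le : forall i, `|th 0 i| <= r.

Lemma ip_le z : `|ip th (zR (uvec z))| <= r.
Proof. by rewrite ipE; case: z.2; rewrite ?normrN. Qed.

(** [expR Lam] is a [q]-average of numbers between [expR (- r)] and [expR r]. *)
Lemma Lam_le : `|Lam| <= r.
Proof.
have hle z : qz P z * expR (- r) <= qz P z * expR (ip th (zR (uvec z))) <= qz P z * expR r.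
  have := ip_le z; rewrite ler_norml => /andP[h1 h2].
  by rewrite !ler_wpM2l ?ler_expR// ltW ?qz_gt0.
have e s : \sum_z qz P z * expR s = expR s by rewrite -mulr_suml qz_sum mul1r.
rewrite ler_norml -ler_expR -[X in _ && X]ler_expR expR_Lam -[expR (- r)]e -[expR r]e; apply/andP; split.
  by apply: ler_sum => z _; have /andP[] := hle z.
by apply: ler_sum => z _; have /andP[] := hle z.
Qed.

Lemma ex_ge z : expR (- (2 * r)) <= ex z.
Proof.
rewrite ler_expR; have := ip_le z; have := Lam_le.
rewrite !ler_norml => /andP[? ?] /andP[? ?]; lra.
Qed.

Lemma ex_le z : ex z <= expR (2 * r).
Proof.
rewrite ler_expR; have := ip_le z; have := Lam_le.
rewrite !ler_norml => /andP[? ?] /andP[? ?]; lra.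
Qed.

(** By ellipticity the untilted second moment is at least [c1 ^ 2], while [qz P z * qz P z'] is at
    most 1; the tilts are the same on both sides. *)
Lemma tV_ge z z' : c1 ^+ 2 * (tp z * tp z') <= tV z z'.
Proof.
rewrite /tV /tp; have [v [-> hv]] := Ex_clcl z z'; rewrite /=.
have -> : c1 ^+ 2 * (qz P z * ex z * (qz P z' * ex z')) =
  c1 ^+ 2 * (qz P z * qz P z') * (ex z * ex z') by ring.
rewrite ler_wpM2r ?mulr_ge0 ?expR_ge0//.
apply: le_trans hv; rewrite ler_piMr ?sqr_ge0//.
by rewrite mulr_ile1 ?qz_le1// ltW ?qz_gt0.
Qed.

Lemma tV_ge0 z z' : 0 <= tV z z'.
Proof.
apply: le_trans (tV_ge z z'); rewrite mulr_ge0 ?sqr_ge0//.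
by rewrite !mulr_ge0 ?expR_ge0// ltW ?qz_gt0.
Qed.

(** Untilted, the second moments sum to 1 because every environment vector does; each of the two
    tilts costs at most [expR (2 * r)]. *)
Lemma tV_sum : \sum_z \sum_z' tV z z' <= expR (4 * r).
Proof.
have -> : expR (4 * r) = \sum_z \sum_z'
    fine (Ex P (fun om => cl c1 (om 0 0) z * cl c1 (om 0 0) z')) * expR (4 * r).
  under eq_bigr => z _ do rewrite -mulr_suml.
  rewrite -mulr_suml -[LHS]mul1r; congr (_ * _); apply: EFin_inj.
  rewrite -sumEFin; under eq_bigr => z _ do rewrite -sumEFin.
  have F0 z om : 0 <= cl c1 (om 0 0) z by rewrite ltW ?cl_gt0.
  under eq_bigr => z _.
    under eq_bigr => z' _.
      have -> : (fine (Ex P (fun om => cl c1 (om 0 0) z * cl c1 (om 0 0) z')%R))%:E =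
        Ex P (fun om => cl c1 (om 0 0) z * cl c1 (om 0 0) z')%R.
        by have [v [-> _]] := Ex_clcl z z'.
      over.
    rewrite -Ex_sum; last 2 first.
      by move=> z'; exact: sfunM.
      by move=> z' om; rewrite mulr_ge0.
    over.
  rewrite -Ex_sum; last 2 first.
    by move=> z; apply: sfun_sum => z'; exact: sfunM.
    by move=> z om; rewrite sumr_ge0// => z' _; rewrite mulr_ge0.
  rewrite -(Ex_cst P 1); apply: eq_Ex => om.
  by under eq_bigr => z _ do rewrite -mulr_sumr cl_sum mulr1; rewrite cl_sum.
apply: ler_sum => z _; apply: ler_sum => z' _; rewrite /tV.
have [v [-> hv]] := Ex_clcl z z'; rewrite /= ler_wpM2l//.
  exact: le_trans (sqr_ge0 c1) hv.
have -> : 4 * r = 2 * r + 2 * r by ring.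
by rewrite [leRHS]expRD ler_pM ?expR_ge0// ex_le.
Qed.

Lemma tp_ge z : c1 * expR (- (2 * r)) <= tp z.
Proof. by rewrite ler_pM ?expR_ge0 ?qz_ge ?ex_ge// ltW ?c1_gt0. Qed.

End Tilt.

(** The order of the choices avoids a circularity: [kappa] is fixed first, it determines the Green
    bound [B], and [B] determines how small the excess [e], and with it [r], must be. *)
Lemma second_moment_bound : (3 <= d)%N -> exists r : R, 0 < r /\
  forall th : 'rV[R]_d, (forall i, `|th 0 i| <= r) -> exists B : R,
    forall m, iter m (pair_fwd (tp th) (tV th)) (fun=> 1) 0 <= B /\
              iter m (pair_back (tp th) (tV th)) (fun=> 1) 0 <= B.
Proof.
move=> d3; have c0 := c1_gt0.
(* A lower bound for the tilted probabilities that is valid for every [r <= 1]. *)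
set kappa := c1 * expR (- 2).
have k0 : 0 < kappa by rewrite mulr_gt0 ?expR_gt0.
set B := 6 / (4 * kappa ^+ 2) ^+ 3.
have B0 : 0 < B by rewrite divr_gt0// exprn_gt0// mulr_gt0// exprn_gt0.
(* Makes [e * (1 + B)] equal to half of [a = c1 ^+ 2]; the other half serves as [c]. *)
set e := c1 ^+ 2 / 2 / (1 + B).
have B1 : 0 < 1 + B by rewrite addr_gt0.
have e0 : 0 < e by rewrite divr_gt0// divr_gt0// exprn_gt0.
(* Chosen so that [1 - x] is the inverse of [1 + e], whence [expR x <= 1 + e]. With [r = x / 4] this
   is the bound on [expR (4 * r)] from [tV_sum]. *)
set x := e / (1 + e).
have x0 : 0 < x by rewrite divr_gt0// addr_gt0.
have x1 : x < 1 by rewrite ltr_pdivrMr ?mul1r ?ltrDr// addr_gt0.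
have c1le1 : c1 <= 1.
  have z0 : U d by exact: (Ordinal (leq_trans (isT : (1 <= 3)%N) d3), true).
  exact: le_trans (qz_ge z0) (qz_le1 z0).
have exx : expR x <= 1 + e.
  have := expR_ge1Dx (- x); rewrite expRN => h.
  have e' : 1 + - x = (1 + e)^-1.
    by rewrite /x; field; rewrite gt_eqF// addr_gt0.
  by rewrite -[leLHS]invrK -[leRHS]invrK lef_pV2 ?posrE ?invr_gt0 ?expR_gt0 ?addr_gt0// -e'.
exists (x / 4); split; first by rewrite divr_gt0.
move=> th hth.
have hk z : kappa <= tp th z.
  apply: le_trans (tp_ge hth z); rewrite ler_wpM2l ?ler_expR ?(ltW c0)//.
  by rewrite lerN2; lra.
have p0 z : 0 <= tp th z by exact: le_trans (ltW k0) (hk z).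
have V0 := tV_ge0 th; have Vge := tV_ge th.
have Vs : \sum_z \sum_z' tV th z z' <= 1 + e.
  apply: le_trans (tV_sum hth) _.
  by have -> : 4 * (x / 4) = x by field.
have a1 : c1 ^+ 2 <= 1 by rewrite expr_le1// ltW.
have c20 : 0 < c1 ^+ 2 / 2 by rewrite divr_gt0// exprn_gt0.
have small : e * (1 + B) + c1 ^+ 2 / 2 <= c1 ^+ 2.
  by rewrite /e divfK ?gt_eqF//; lra.
exists (1 + (1 + B) / (c1 ^+ 2 / 2)) => m; split; last first.
  exact: (iter_pair_back1_bound p0 (tp_sum1 th) V0 d3 k0 hk Vge a1 Vs c20 (ltW e0) small).
apply: le_trans (iter_pair_fwd1 p0 (tp_sum1 th) V0 d3 k0 hk Vge a1 Vs c20 (ltW e0) small m 0) _.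
rewrite lerD2l -/B ler_pdivlMr//; apply: (@le_trans _ _ B); last by rewrite lerDr.
by rewrite ler_piMr ?(ltW B0)//; lra.
Qed.

End Clean.

(** * Solving for theta by convex minimisation *)

Lemma is_derive_exp_sum (R : realType) (I : Type) (r : seq I) (a b c : I -> R) (x : R) :
  is_derive x 1 (fun h => \sum_(i <- r) a i * expR (h * c i + b i))
    (\sum_(i <- r) a i * (c i * expR (x * c i + b i))).
Proof.
elim: r => [|i r IHr].
  rewrite big_nil (_ : (fun _ => _) = cst 0); first exact: is_derive_cst.
  by apply/funext => h; rewrite big_nil.
rewrite big_cons (_ : (fun _ => _) = (fun h => a i * expR (h * c i + b i)) +
  (fun h => \sum_(j <- r) a j * expR (h * c j + b j))); last first.
  by apply/funext => h; rewrite big_cons.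
apply: is_deriveD.
have lin : is_derive x 1 (fun h => h * c i + b i) (c i).
  rewrite (_ : (fun h => _) = c i *: id + cst (b i)); last first.
    by apply/funext => h; rewrite /= mulrC.
  by apply: is_derive_eq; rewrite addr0 [LHS]mulr1.
have ex : is_derive x 1 (expR \o (fun h => h * c i + b i)) (c i * expR (x * c i + b i)).
  by rewrite mulrC; exact: (is_derive1_comp (f := expR)).
have -> : (fun h => a i * expR (h * c i + b i)) = a i *: (expR \o (fun h => h * c i + b i)) by [].
exact: is_deriveZ.
Qed.

Lemma derive_ray (R : realType) (n : nat) (f : 'rV[R]_n -> R) (th v : 'rV[R]_n) (l : R) :
  is_derive (0 : R) 1 (fun h : R => f (h *: v + th)) l -> derive f th v = l.
Proof.
move=> [_ <-]; rewrite /derive.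
have -> : (fun h : R => h^-1 *: ((f \o pseudometric_normed_Zmodule.shift th) (h *: v) - f th)) =
  (fun h : R => h^-1 *: (((fun h : R => f (h *: v + th)) \o
     pseudometric_normed_Zmodule.shift 0) (h *: 1) - f ((0 : R) *: v + th))).
  apply/funext => h /=; rewrite /pseudometric_normed_Zmodule.shift.
  by rewrite addr0 [h *: 1]mulr1 scale0r add0r.
by [].
Qed.

Lemma continuous_sumR (R : realType) (T : topologicalType) (I : Type) (r : seq I)
    (f : I -> T -> R) :
  (forall i, continuous (f i)) -> continuous (fun x => \sum_(i <- r) f i x).
Proof.
move=> cf; elim: r => [|i r IHr].
  rewrite (_ : (fun _ => _) = cst 0); first by move=> x; exact: cvg_cst.
  by apply/funext => x; rewrite big_nil.
rewrite (_ : (fun _ => _) = (fun x => f i x + \sum_(j <- r) f j x)).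
  by move=> x; apply: cvgD; [exact: cf|exact: IHr].
by apply/funext => x; rewrite big_cons.
Qed.

Lemma continuous_mulR (R : realType) (T : topologicalType) (f g : T -> R) :
  continuous f -> continuous g -> continuous (fun x => f x * g x).
Proof. by move=> cf cg x; apply: cvgM; [exact: cf|exact: cg]. Qed.

Lemma continuous_cstR (R : realType) (T : topologicalType) (c : R) :
  continuous (fun _ : T => c).
Proof. by move=> x; exact: cvg_cst. Qed.

Section Theta.
Variables (R : realType) (d : nat) (P : probability (Omega R d) R) (c1 : R).
Hypothesis hP : env_assumptions P c1.
Local Notation q := (qz P).
Implicit Types (th xi : 'rV[R]_d).

Lemma ipDl th th' x : ip (th + th') x = ip th x + ip th' x.
Proof. by rewrite /ip -big_split; apply: eq_bigr => j _; rewrite mxE mulrDl. Qed.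

Lemma ipZ h th x : ip (h *: th) x = h * ip th x.
Proof. by rewrite /ip mulr_sumr; apply: eq_bigr => j _; rewrite mxE mulrA. Qed.

Lemma ip_delta i (x : 'rV[R]_d) : ip (delta_mx 0 i) x = x 0 i.
Proof.
rewrite /ip (bigD1 i)//= big1 ?addr0 => [|j ji]; first by rewrite mxE !eqxx mul1r.
by rewrite mxE (negPf ji) andbF mul0r.
Qed.

Lemma ipB_r th x y : ip th (x - y) = ip th x - ip th y.
Proof. by rewrite /ip -sumrB; apply: eq_bigr => j _; rewrite !mxE mulrBr. Qed.

Definition Zs th : R := \sum_z q z * expR (ip th (zR (uvec z))).
Definition Ms th : 'rV[R]_d :=
  \row_i \sum_z q z * (zR (uvec z) 0 i * expR (ip th (zR (uvec z)))).

Lemma grad_LambdaE th : grad (Lambda_c P) th = (Zs th)^-1 *: Ms th.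
Proof.
apply/rowP => i; rewrite !mxE; apply: derive_ray.
pose c z : R := zR (uvec z) 0 i; pose b z : R := ip th (zR (uvec z)).
have ds := is_derive_exp_sum (index_enum (U d)) q b c 0.
pose S (h : R) := \sum_z q z * expR (h * c z + b z).
have SE : (fun h : R => Lambda_c P (h *: delta_mx 0 i + th)) = @ln R \o S.
  apply/funext => h; congr ln; apply: eq_bigr => z _.
  by rewrite ipDl ipZ ip_delta.
have S0 : S 0 = Zs th.
  by apply: eq_bigr => z _; rewrite mul0r add0r.
have S0gt : 0 < S 0 by rewrite S0; exact: (Zsum_gt0 hP).
rewrite SE -S0.
have h := is_derive1_comp (f := @ln R) (g := S) (is_derive1_ln S0gt) ds.
apply: (is_derive_eq h); congr (_ * _); apply: eq_bigr => z _.
by rewrite mul0r add0r.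
Qed.

(** Centring the steps at [xi] multiplies the partition sum by [expR (- ip th xi)]. The equation for
    [th] thus says that the gradient of a convex sum of exponentials vanishes. *)
Lemma grad_Lambda_eqP th xi : grad (Lambda_c P) th = xi <->
  forall i, \sum_z q z * ((zR (uvec z) - xi) 0 i *
              expR (ip th (zR (uvec z) - xi))) = 0.
Proof.
have Z0 : 0 < Zs th := Zsum_gt0 hP th.
have e i : \sum_z q z * ((zR (uvec z) - xi) 0 i * expR (ip th (zR (uvec z) - xi))) =
    expR (- ip th xi) * (Ms th 0 i - xi 0 i * Zs th).
  rewrite mxE /Zs mulr_sumr -sumrB mulr_sumr; apply: eq_bigr => z _.
  by rewrite ipB_r expRD [in LHS]mxE [X in _ + X]mxE; ring.
rewrite grad_LambdaE; split=> [h i|h].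
  by rewrite e -h !mxE mulrAC mulVf ?mul1r ?subrr ?mulr0// gt_eqF.
apply/rowP => i; have /eqP := h i; rewrite e mulf_eq0 gt_eqF ?expR_gt0//= subr_eq0.
by move=> /eqP hM; rewrite mxE hM mulrC mulfK// gt_eqF.
Qed.

(** Strict monotonicity: testing both equations on [th' - th] and subtracting leaves a sum of terms
    [q (a - b)(e^a - e^b)], all nonnegative, hence all zero. So [th' - th] is orthogonal to every
    centred step, and the two opposite steps on an axis kill its coordinate. *)
Lemma grad_Lambda_inj th th' xi :
  grad (Lambda_c P) th = xi -> grad (Lambda_c P) th' = xi -> th' = th.
Proof.
move=> /grad_Lambda_eqP h /grad_Lambda_eqP h'.
pose w z : 'rV[R]_d := zR (uvec z) - xi.
pose D := th' - th.
have hD t : (forall i, \sum_z q z * (w z 0 i * expR (ip t (w z))) = 0) ->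
    \sum_z q z * (ip D (w z) * expR (ip t (w z))) = 0.
  move=> ht; transitivity (\sum_j D 0 j * \sum_z q z * (w z 0 j * expR (ip t (w z)))).
    under [RHS]eq_bigr => j _ do rewrite mulr_sumr.
    rewrite [RHS]exchange_big; apply: eq_bigr => z _ /=.
    by rewrite {1}/ip mulr_suml mulr_sumr; apply: eq_bigr => j _; ring.
  by rewrite big1// => j _; rewrite ht mulr0.
have dif : \sum_z q z * (ip D (w z) * (expR (ip th' (w z)) - expR (ip th (w z)))) = 0.
  under eq_bigr => z _ do rewrite !mulrBr.
  by rewrite sumrB !hD ?subrr.
have DE z : ip D (w z) = ip th' (w z) - ip th (w z).
  by rewrite ipDl -[- th]scaleN1r ipZ mulN1r.
have term0 z : 0 <= q z * (ip D (w z) * (expR (ip th' (w z)) - expR (ip th (w z)))).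
  rewrite mulr_ge0 ?(ltW (qz_gt0 hP z))// DE.
  have [le|/ltW le] := leP (ip th (w z)) (ip th' (w z)).
    by rewrite mulr_ge0// subr_ge0 ?ler_expR.
  by rewrite mulr_le0// subr_le0 ?ler_expR.
have Dw z : ip D (w z) = 0.
  move/eqP: dif; rewrite psumr_eq0// => /allP /(_ z).
  rewrite mem_index_enum => /(_ isT) /=.
  rewrite !mulf_eq0 gt_eqF ?(qz_gt0 hP z)//= subr_eq0.
  by case/orP => /eqP // /expR_inj e; rewrite DE e subrr.
suff D0 : D = 0 by apply/eqP; rewrite -subr_eq0 -/D D0.
apply/rowP => i; rewrite [RHS]mxE.
have := Dw (i, true); have := Dw (i, false).
rewrite /w !ipB_r !ipE/=; lra.
Qed.

Lemma xi_oE i : xi_o P 0 i = \sum_z q z * (zR (uvec z) 0 i).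
Proof. by rewrite /xi_o summxE; apply: eq_bigr => z _; rewrite mxE. Qed.

Lemma le_enorm (v : 'rV[R]_d) i : `|v 0 i| <= enorm v.
Proof.
rewrite /enorm -sqrtr_sqr ler_sqrt; last by rewrite sumr_ge0// => j _; rewrite sqr_ge0.
by rewrite (bigD1 i)//= lerDl sumr_ge0// => j _; rewrite sqr_ge0.
Qed.

Lemma ip_bound (th v : 'rV[R]_d) (r e : R) : 0 <= r ->
  (forall i, `|th 0 i| <= r) -> (forall i, `|v 0 i| <= e) ->
  `|ip th v| <= d%:R * r * e.
Proof.
move=> r0 hr he; apply: le_trans (ler_norm_sum _ _ _) _.
rewrite (_ : d%:R * r * e = \sum_(j < d) (r * e)); last first.
  by rewrite sumr_const card_ord -mulrA mulr_natl.
by apply: ler_sum => j _; rewrite normrM ler_pM.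
Qed.

Lemma continuous_exp_sum (w : U d -> 'rV[R]_d) :
  continuous (fun th : 'rV[R]_d => \sum_z q z * expR (ip th (w z))).
Proof.
have cip z : continuous (fun th : 'rV[R]_d => ip th (w z)).
  apply: continuous_sumR => j; apply: continuous_mulR.
    exact: coord_continuous.
  exact: continuous_cstR.
apply: continuous_sumR => z; apply: continuous_mulR; first exact: continuous_cstR.
by move=> th; apply: (continuous_comp (cip z th)); exact: continuous_expR.
Qed.

(** The square of [1 + x / 2 <= expR (x / 2)], whose left side is nonnegative exactly when
    [-2 <= x]. *)
Lemma expR_ge_sqr (x : R) : -2 <= x -> 1 + x + x ^+ 2 / 4 <= expR x.
Proof.
move=> x2; have -> : x = x / 2 + x / 2 by lra.
rewrite expRD; have h := expR_ge1Dx (x / 2).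
have h0 : 0 <= 1 + x / 2 by lra.
have := ler_pM h0 h0 h h; apply: le_trans.
by rewrite -splitr le_eqVlt; apply/orP; left; apply/eqP; field.
Qed.

(** A minimiser of [Phi] over the cube of half-width [s] solves the equation once it is interior. On
    a face the quadratic part of the exponentials gains at least [c1 * s ^+ 2 / 2], while the drift
    [xi - xi_o P] costs at most half of that, so [Phi] exceeds its value 1 at the centre. *)
Lemma theta_exists (r : R) : 0 < r -> exists eta : R, 0 < eta /\
  forall xi, enorm (xi - xi_o P) < eta -> exists th,
    (forall i, `|th 0 i| <= r) /\ grad (Lambda_c P) th = xi.
Proof.
move=> r_gt0; have c0 := c1_gt0 hP.
(* The cap [1 / 2] keeps every exponent above [-2], as [expR_ge_sqr] requires: two contributions of
   size at most [s] and one of size at most 1. *)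
pose s := Num.min r (1 / 2).
have s0 : 0 < s by rewrite lt_min r_gt0/=; lra.
have sr : s <= r by rewrite ge_min lexx.
have s2 : s <= 1 / 2 by rewrite ge_min lexx orbT.
(* The summand 1 keeps [D] positive for every [d]. *)
pose D := d%:R + 1 : R.
have D0 : 0 < D by rewrite ltr_wpDl.
have dD : d%:R <= D by rewrite lerDl.
exists (Num.min (1 / D) (c1 * s / (4 * D))); split.
  by rewrite lt_min !divr_gt0// mulr_gt0.
move=> xi hxi; pose w z : 'rV[R]_d := zR (uvec z) - xi.
pose Phi (th : 'rV[R]_d) : R := \sum_z q z * expR (ip th (w z)).
pose A : set 'rV[R]_d := [set th | forall i, `[- s, s]%classic (th ord0 i)].
have cA : compact A by apply: (@rV_compact R d (fun=> `[- s, s]%classic)) => i; exact: (@segment_compact _ (- s) s).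
have A0 : A 0 by move=> i; rewrite /= in_itv/= mxE oppr_le0 !ltW.
have hA th : A th -> forall i, `|th 0 i| <= s.
  by move=> h i; have := h i; rewrite /= in_itv/= ler_norml.
have hxi_i i : `|(xi - xi_o P) 0 i| <= 1 / D /\ `|(xi - xi_o P) 0 i| <= c1 * s / (4 * D).
  apply/andP; rewrite -le_min; exact: le_trans (le_enorm _ i) (ltW hxi).
have dD1 : d%:R / D <= 1 by rewrite ler_pdivrMr// mul1r.
have small th : A th -> `|ip th (xi - xi_o P)| <= c1 * s ^+ 2 / 4 /\
    `|ip th (xi - xi_o P)| <= 1.
  move=> /hA hth; split.
    apply: le_trans (ip_bound (ltW s0) hth (fun i => (hxi_i i).2)) _.
    have -> : d%:R * s * (c1 * s / (4 * D)) = (d%:R / D) * (c1 * s ^+ 2 / 4).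
      by field; rewrite gt_eqF.
    by rewrite ler_piMl// divr_ge0// mulr_ge0 ?sqr_ge0// ltW.
  apply: le_trans (ip_bound (ltW s0) hth (fun i => (hxi_i i).1)) _.
  have -> : d%:R * s * (1 / D) = (d%:R / D) * s by field; rewrite gt_eqF.
  by apply: (@le_trans _ _ s); [rewrite ler_piMl// ltW|lra].
have [||c cA' cmin] := @EVT_min_rV R d Phi A _ cA.
- by exists 0.
- by apply: continuous_subspaceT; exact: continuous_exp_sum.
move: cA'; rewrite inE => cA'.
have Phi0 : Phi 0 = 1.
  rewrite -(qz_sum hP); apply: eq_bigr => z _.
  by rewrite (_ : ip 0 _ = 0) ?expR0 ?mulr1// /ip big1// => j _; rewrite mxE mul0r.
have Phic : Phi c <= 1 by rewrite -Phi0; apply: cmin; rewrite inE.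
have inner i : `|c 0 i| < s.
  rewrite lt_neqAle hA// andbT; apply/eqP => ci.
  pose x z := ip c (w z).
  have [sm1 sm2] := small _ cA'.
  have mean : \sum_z q z * x z = - ip c (xi - xi_o P).
    have hxo : ip c (xi_o P) = \sum_z q z * ip c (zR (uvec z)).
      rewrite /ip; under eq_bigr => j _ do rewrite xi_oE mulr_sumr.
      rewrite exchange_big; apply: eq_bigr => z _; rewrite mulr_sumr.
      by apply: eq_bigr => j _; rewrite mulrCA.
    rewrite ipB_r opprB hxo -[ip c xi]mul1r -(qz_sum hP) mulr_suml -sumrB.
    by apply: eq_bigr => z _; rewrite /x /w ipB_r mulrBr.
  have hipz z : `|ip c (zR (uvec z))| <= s by exact: (ip_le (hA _ cA')).
  have hipo : `|ip c (xi_o P)| <= s.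
    have -> : ip c (xi_o P) = \sum_z q z * ip c (zR (uvec z)).
      rewrite /ip; under eq_bigr => j _ do rewrite xi_oE mulr_sumr.
      rewrite exchange_big; apply: eq_bigr => z _; rewrite mulr_sumr.
      by apply: eq_bigr => j _; rewrite mulrCA.
    apply: le_trans (ler_norm_sum _ _ _) _.
    rewrite -[leRHS]mul1r -(qz_sum hP) mulr_suml; apply: ler_sum => z _.
    rewrite normrM (ger0_norm (ltW (qz_gt0 hP z))).
    by rewrite ler_wpM2l// ltW// (qz_gt0 hP).
  have x2 z : - 2 <= x z.
    have := hipz z; have := hipo; have := sm2; rewrite /x /w !ipB_r !ler_norml.
    by move=> /andP[? ?] /andP[? ?] /andP[? ?]; lra.
  have low : 1 + (- ip c (xi - xi_o P)) + (\sum_z q z * x z ^+ 2) / 4 <= Phi c.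
    have -> : 1 + (- ip c (xi - xi_o P)) + (\sum_z q z * x z ^+ 2) / 4 =
        \sum_z q z * (1 + x z + x z ^+ 2 / 4).
      under [RHS]eq_bigr => z _ do rewrite 2!mulrDr mulr1 mulrA.
      by rewrite 2!big_split/= (qz_sum hP) mean mulr_suml.
    apply: ler_sum => z _; rewrite ler_wpM2l ?expR_ge_sqr//.
    by rewrite ltW// (qz_gt0 hP).
  have ab : (i, true) != (i, false) :> U d by rewrite xpair_eqE andbF.
  have qx0 z : 0 <= q z * x z ^+ 2 by rewrite mulr_ge0 ?sqr_ge0// ltW// (qz_gt0 hP).
  have sq := ler_sum2 ab qx0.
  have sqq : c1 * (x (i, true) ^+ 2 + x (i, false) ^+ 2) <= \sum_z q z * x z ^+ 2.
    apply: le_trans sq; rewrite mulrDr.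
    by rewrite lerD// ler_wpM2r ?sqr_ge0 ?(qz_ge hP).
  have xd : x (i, true) - x (i, false) = 2 * c 0 i.
    by rewrite /x /w !ipB_r !ipE/=; lra.
  have cs : (c 0 i) ^+ 2 = s ^+ 2 by rewrite -ci real_normK ?num_real.
  have xq : 2 * s ^+ 2 <= x (i, true) ^+ 2 + x (i, false) ^+ 2.
    rewrite -cs; have -> : c 0 i = (x (i, true) - x (i, false)) / 2 by lra.
    by have := sqr_ge0 (x (i, true) + x (i, false)); nra.
  have c1s : c1 * (2 * s ^+ 2) <= c1 * (x (i, true) ^+ 2 + x (i, false) ^+ 2).
    by rewrite ler_wpM2l// ltW.
  have c1s0 : 0 < c1 * s ^+ 2 by rewrite mulr_gt0// exprn_gt0.
  move: sm1; rewrite ler_norml => /andP[sm1 sm1'].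
  rewrite mulrCA in c1s.
  lra.
exists c; split; first by move=> i; exact: le_trans (ltW (inner i)) sr.
apply/grad_Lambda_eqP => i.
pose phi (h : R) := \sum_z q z * expR (h * w z 0 i + ip c (w z)).
have phiE h : phi h = Phi (h *: delta_mx 0 i + c).
  by apply: eq_bigr => z _; rewrite ipDl ipZ ip_delta.
have dphi (h : R) : is_derive h (1 : R) phi
    (\sum_z q z * (w z 0 i * expR (h * w z 0 i + ip c (w z)))).
  exact: is_derive_exp_sum.
(* The room left before coordinate [i] of [c] reaches a face. *)
pose del := s - `|c 0 i|.
have del0 : 0 < del by rewrite subr_gt0.
have : is_derive (0 : R) (1 : R) phi 0.
  apply: (@derive1_at_min _ phi (- del) del 0).
  - by lra.
  - by move=> t _; have [] := dphi t.
  - by rewrite in_itv/= oppr_lt0 del0.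
  - move=> t; rewrite in_itv/= => /andP[t1 t2].
    rewrite !phiE scale0r add0r; apply: cmin; rewrite inE => j.
    rewrite /= in_itv/= -ler_norml mxE mxE mxE eqxx/=.
    have [->|ji] := eqVneq j i; last by rewrite mulr0 add0r hA.
    rewrite mulr1; apply: le_trans (ler_normD _ _) _.
    by rewrite -lerBrDr -/del ler_norml !ltW.
move=> [_ e0]; have [_ e1] := dphi 0.
have {e0 e1} : \sum_z q z * (w z 0 i * expR (0 * w z 0 i + ip c (w z))) = 0 by rewrite -e1 e0.
by under eq_bigr => z _ do rewrite mul0r add0r.
Qed.

End Theta.

(** * Path sums and harmonic limits *)

Section Horizon.
Variables (R : realType) (d : nat).
Local Notation site := (int * Zd d)%type.
Implicit Types (I J : set site).

(** Events with a bounded time horizon: an intersection-stable generating class, and the one that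
    [is_mubar] and the independence of far layers can reach. *)
Definition hor I : set (set (Omega R d)) :=
  [set X | exists n : nat, <<s sgen (I `&` [set s | `|s.1| < n%:Z]) >> X].

Lemma hor_sub I : hor I `<=` <<s sgen I >>.
Proof. by move=> X [n]; apply: sgen_sub => s []. Qed.

Lemma hor_setI I : setI_closed (hor I).
Proof.
move=> A B [m hA] [n hB]; exists (maxn m n).
have up k (X : set (Env R d)) : (k <= maxn m n)%N -> <<s sgen (I `&` [set s | `|s.1| < k%:Z]) >> X ->
    <<s sgen (I `&` [set s | `|s.1| < (maxn m n)%:Z]) >> X.
  by move=> kmn; apply: sgen_sub => s [Is /= sk]; split => //=; lia.
have hA' := up _ _ (leq_maxl m n) hA; have hB' := up _ _ (leq_maxr m n) hB.
exact: (@measurableI _ (Om (I `&` [set s | `|s.1| < (maxn m n)%:Z])) A B hA' hB').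
Qed.

Lemma horT I : hor I setT.
Proof. by exists 0%N; exact: (@measurableT _ (Om (I `&` [set s | `|s.1| < 0%:Z]))). Qed.

Lemma hor_sgen I : <<s hor I >> = <<s (@sgen R d I) >>.
Proof.
apply/seteqP; split; apply: smallest_sub; try exact: smallest_sigma_algebra.
  exact: hor_sub.
move=> A [s [z [B [Is mB ->]]]]; apply: sub_sigma_algebra.
exists (`|s.1|%N.+1); apply: sub_sigma_algebra; exists s, z, B; split => //.
by split => //=; lia.
Qed.

Lemma hor_unique I (m1 m2 : {measure set (Omega R d) -> \bar R}) :
  (m1 setT < +oo)%E -> (forall A, hor I A -> m1 A = m2 A) ->
  forall A, <<s sgen I >> A -> m1 A = m2 A.
Proof.
move=> m1T h A hA; apply: (@pi_system_unique _ R (Omega R d) (hor I)) => //.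
- by move=> X /hor_sub; exact: sgen_measurable.
- exact: hor_setI.
- exact: horT.
- by rewrite hor_sgen.
Qed.

End Horizon.

Section Paths.
Variables (R : realType) (d : nat).
Local Notation site := (int * Zd d)%type.

Fixpoint paths (n : nat) : seq (seq (U d)) :=
  if n is n'.+1 then [seq z :: l | z <- index_enum (U d), l <- paths n'] else [:: [::]].

Lemma size_paths n l : l \in paths n -> size l = n.
Proof.
elim: n l => [|n IHn] l /=; first by rewrite inE => /eqP->.
by move=> /allpairsP[[z l'] [_ hl ->]] /=; rewrite (IHn _ hl).
Qed.

Lemma sum_pathsS (V : nmodType) n (F : seq (U d) -> V) :
  \sum_(l <- paths n.+1) F l = \sum_z \sum_(l <- paths n) F (z :: l).
Proof. by rewrite /= big_allpairs_dep. Qed.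

Lemma sum_paths0 (V : nmodType) (F : seq (U d) -> V) :
  \sum_(l <- paths 0) F l = F [::].
Proof. by rewrite /= big_seq1. Qed.

Lemma sum_paths_cat (V : nmodType) m n (F : seq (U d) -> V) :
  \sum_(l <- paths (m + n)) F l =
  \sum_(l1 <- paths m) \sum_(l2 <- paths n) F (l1 ++ l2).
Proof.
elim: m F => [|m IHm] F; first by rewrite sum_paths0.
rewrite addSn !sum_pathsS; apply: eq_bigr => z _; exact: IHm.
Qed.

Definition disp (l : seq (U d)) : Zd d := \sum_(z <- l) uvec z.

(** [endp l] views the environment from the end of a path leaving the origin, [bk l] from the start
    of a path arriving there. *)
Definition endp (l : seq (U d)) (om : Omega R d) : Omega R d :=
  shift (size l)%:Z (disp l) om.

Definition bk (l : seq (U d)) (om : Omega R d) : Omega R d :=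
  shift (- (size l)%:Z) (- disp l) om.

Lemma disp_cons z l : disp (z :: l) = uvec z + disp l.
Proof. exact: big_cons. Qed.

Lemma disp_cat l1 l2 : disp (l1 ++ l2) = disp l1 + disp l2.
Proof. exact: big_cat. Qed.

Lemma endp_nil om : endp [::] om = om.
Proof. by rewrite /endp /disp big_nil shift0. Qed.

Lemma endp_cons z l om : endp (z :: l) om = endp l (fstep z om).
Proof.
rewrite /endp /fstep shift_shift disp_cons addrC -PoszD addn1.
by rewrite [_ + uvec z]addrC.
Qed.

Lemma endp_bk l om : endp l (bk l om) = om.
Proof. by rewrite /endp /bk shift_shift !subrr shift0. Qed.

Lemma bk_cat l1 l2 om : bk (l1 ++ l2) om = bk l1 (bk l2 om).
Proof.
by rewrite /bk shift_shift size_cat disp_cat PoszD !opprD.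
Qed.

Lemma bk_seq1 z om : bk [:: z] om = bstep z om.
Proof. by rewrite /bk /bstep /disp big_seq1. Qed.

Lemma bk_nil om : bk [::] om = om.
Proof. by rewrite /bk /disp big_nil !oppr0 shift0. Qed.

Variable t : Env R d -> U d -> R.

Fixpoint wt (l : seq (U d)) (om : Omega R d) : R :=
  if l is z :: l' then t om z * wt l' (fstep z om) else 1.

Lemma wt_cat l1 l2 om : wt (l1 ++ l2) om = wt l1 om * wt l2 (endp l1 om).
Proof.
elim: l1 om => [|z l1 IH] om; first by rewrite mul1r endp_nil.
by rewrite /= IH mulrA endp_cons.
Qed.

Lemma fwdS m om : fwd t m.+1 om = \sum_(z : U d) t om z * fwd t m (fstep z om).
Proof. by []. Qed.

Lemma bwdS m om :
  bwd t m.+1 om = \sum_(z : U d) t (bstep z om) z * bwd t m (bstep z om).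
Proof. by []. Qed.

Lemma fwdE n k om :
  fwd t (n + k) om = \sum_(l <- paths n) wt l om * fwd t k (endp l om).
Proof.
elim: n om => [|n IHn] om; first by rewrite sum_paths0 mul1r endp_nil.
rewrite addSn fwdS sum_pathsS; apply: eq_bigr => z _.
rewrite IHn mulr_sumr; apply: eq_bigr => l _.
by rewrite endp_cons mulrA.
Qed.

Lemma fwd_paths n om : fwd t n om = \sum_(l <- paths n) wt l om.
Proof. by rewrite -[n in LHS]addn0 fwdE; apply: eq_bigr => l _; rewrite mulr1. Qed.

(** The recursion of [bwd] peels the last step of a path, whereas [paths] and [wt] peel the first,
    so paths are recut as [l ++ [:: z]]. *)
Lemma bwdE n k om :
  bwd t (n + k) om = \sum_(l <- paths n) wt l (bk l om) * bwd t k (bk l om).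
Proof.
elim: n om => [|n IHn] om; first by rewrite sum_paths0 mul1r bk_nil.
rewrite addSn bwdS -[in RHS]addn1 sum_paths_cat.
under [RHS]eq_bigr => l _ do rewrite sum_pathsS.
rewrite [RHS]exchange_big; apply: eq_bigr => z _ /=.
rewrite IHn mulr_sumr; apply: eq_bigr => l _; rewrite big_seq1.
rewrite bk_cat bk_seq1 wt_cat endp_bk /= mulr1; ring.
Qed.

Lemma bwd_paths n om : bwd t n om = \sum_(l <- paths n) wt l (bk l om).
Proof. by rewrite -[n in LHS]addn0 bwdE; apply: eq_bigr => l _; rewrite mulr1. Qed.

Hypothesis t_meas : forall z, sfun [set (0, 0)] (t^~ z).
Hypothesis t_ge0 : forall om z, 0 <= t om z.

Lemma wt_ge0 l om : 0 <= wt l om.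
Proof. by elim: l om => [|z l IHl] om //=; rewrite mulr_ge0. Qed.

Lemma sfun_wt l : sfun (lay 0 (size l)%:Z) (wt l).
Proof.
elim: l => [|z l IHl]; first exact: sfun_cst.
apply: sfunM.
  by apply: (sfun_sub _ (t_meas z)) => _ -> /=.
by apply: (sfun_shift _ IHl) => s; rewrite /lay/=; lia.
Qed.

Variables (P : probability (Omega R d) R) (c1 : R).
Hypothesis hP : env_assumptions P c1.

Lemma sfun_endp l g : sfun [set s : site | 0 <= s.1] g ->
  sfun [set s : site | (size l)%:Z <= s.1] (fun om => g (endp l om)).
Proof. by move=> mg; apply: (sfun_shift _ mg) => s /=; lia. Qed.

(* The paths of length n read only the layers below n, the environment at
   their endpoints only the layers from n on. *)
Lemma Ex_path_indep n Y g :
  sfun [set s : site | s.1 < n%:Z] Y -> sfun [set s : site | 0 <= s.1] g ->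
  (forall om, 0 <= Y om) -> (forall om, 0 <= g om) ->
  Ex P (fun om => Y om * \sum_(l <- paths n) wt l om * g (endp l om)) =
  (Ex P (fun om => Y om * fwd t n om)%R * Ex P g)%E.
Proof.
move=> mY mg Y0 g0.
have mw l : l \in paths n -> sfun [set s : site | s.1 < n%:Z] (fun om => Y om * wt l om).
  move=> /size_paths hl; apply: sfunM => //.
  by apply: (sfun_sub _ (@sfun_wt l)) => s; rewrite hl => /andP[].
have mwT l : sfun setT (fun om => Y om * wt l om).
  by apply: sfunM; [exact: sfun_sub mY|exact: sfun_sub (@sfun_wt l)].
have mgl l : sfun setT (fun om => g (endp l om)).
  exact: sfun_sub (@sfun_endp l _ mg).
have w0 l om : 0 <= Y om * wt l om by rewrite mulr_ge0// wt_ge0.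
transitivity (\sum_(l <- paths n) Ex P (fun om => Y om * wt l om * g (endp l om))%R)%E.
  rewrite -Ex_sum; last 2 first.
  - by move=> l; exact: sfunM.
  - by move=> l om; rewrite mulr_ge0.
  by apply: eq_Ex => om; rewrite mulr_sumr; apply: eq_bigr => l _; rewrite mulrA.
transitivity (\sum_(l <- paths n) Ex P (fun om => Y om * wt l om)%R * Ex P g)%E.
  apply: eq_big_seq => l hl.
  rewrite (Ex_indep hP _ (mw _ hl) (@sfun_endp l _ mg))//.
    congr (_ * _)%E; apply: (@Ex_shift _ _ _ _ hP _ _ g) => //.
    exact: sfun_sub mg.
  by rewrite -subset0 => s []; rewrite /= (size_paths hl); lia.
rewrite -ge0_sume_distrl; last by move=> l _; exact: Ex_ge0.
congr (_ * _)%E; rewrite -Ex_sum//.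
by apply: eq_Ex => om; rewrite fwd_paths mulr_sumr.
Qed.

Lemma Ex_path_indep_back n Y g :
  sfun [set s : site | - n%:Z <= s.1] Y -> sfun [set s : site | s.1 < 0] g ->
  (forall om, 0 <= Y om) -> (forall om, 0 <= g om) ->
  Ex P (fun om => Y om * \sum_(l <- paths n) wt l (bk l om) * g (bk l om)) =
  (Ex P (fun om => Y om * bwd t n om)%R * Ex P g)%E.
Proof.
move=> mY mg Y0 g0.
have mwb l : sfun (lay (- (size l)%:Z) 0) (fun om => wt l (bk l om)).
  by apply: (sfun_shift _ (@sfun_wt l)) => s; rewrite /lay/=; lia.
have mw l : l \in paths n -> sfun [set s : site | - n%:Z <= s.1] (fun om => Y om * wt l (bk l om)).
  move=> /size_paths hl; apply: sfunM => //.
  by apply: (sfun_sub _ (mwb l)) => s; rewrite hl => /andP[].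
have mwT l : sfun setT (fun om => Y om * wt l (bk l om)).
  by apply: sfunM; [exact: sfun_sub mY|exact: sfun_sub (mwb l)].
have mgb l : sfun [set s : site | s.1 < - (size l)%:Z] (fun om => g (bk l om)).
  by apply: (sfun_shift _ mg) => s /=; lia.
have mgl l : sfun setT (fun om => g (bk l om)).
  exact: sfun_sub (mgb l).
have w0 l om : 0 <= Y om * wt l (bk l om) by rewrite mulr_ge0// wt_ge0.
transitivity (\sum_(l <- paths n) Ex P (fun om => Y om * wt l (bk l om) * g (bk l om))%R)%E.
  rewrite -Ex_sum; last 2 first.
  - by move=> l; exact: sfunM.
  - by move=> l om; rewrite mulr_ge0.
  by apply: eq_Ex => om; rewrite mulr_sumr; apply: eq_bigr => l _; rewrite mulrA.
transitivity (\sum_(l <- paths n) Ex P (fun om => Y om * wt l (bk l om))%R * Ex P g)%E.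
  apply: eq_big_seq => l hl.
  rewrite (Ex_indep hP _ (mw _ hl) (mgb l))//.
    congr (_ * _)%E; apply: (@Ex_shift _ _ _ _ hP _ _ g) => //.
    exact: sfun_sub mg.
  by rewrite -subset0 => s []; rewrite /= (size_paths hl); lia.
rewrite -ge0_sume_distrl; last by move=> l _; exact: Ex_ge0.
congr (_ * _)%E; rewrite -Ex_sum//.
by apply: eq_Ex => om; rewrite bwd_paths mulr_sumr.
Qed.

Lemma ae_shift n x (A : Omega R d -> Prop) :
  {ae P, forall om, A om} -> {ae P, forall om, A (shift n x om)}.
Proof.
move=> [N [mN N0 sub]]; exists (shift n x @^-1` N); split.
- have := @measurable_shift R d n x measurableT N mN; by rewrite setTI.
- by rewrite (P_shift hP).
- by move=> om /= h; apply: sub.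
Qed.

End Paths.

Lemma cvg_eventually_cst (R : realType) (a : nat -> \bar R) (l c : \bar R) (n : nat) :
  a k @[k --> \oo] --> l -> (forall k, (n <= k)%N -> a k = c) -> l = c.
Proof.
move=> al ac; apply: (cvg_unique (@ereal_hausdorff R) al).
apply: cvg_near_cst; exists n => // k /= nk; exact: ac.
Qed.

Section Limits.
Variables (R : realType) (d : nat) (P : probability (Omega R d) R) (c1 : R).
Hypothesis hP : env_assumptions P c1.
Variables (th : 'rV[R]_d) (B : R).
Hypothesis hB : forall m,
  iter m (pair_fwd (tp P th) (tV P c1 th)) (fun=> 1) 0 <= B /\
  iter m (pair_back (tp P th) (tV P c1 th)) (fun=> 1) 0 <= B.
Local Notation site := (int * Zd d)%type.
Local Notation t := (tw P c1 th).

Let t_meas := sfun_tw P c1 th.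
Let t_ge0 := tw_ge0 hP th.

Lemma fwd_limit : exists u : Env R d -> R, [/\
  sfun [set s : site | 0 <= s.1] u, (forall om, 0 <= u om), Ex P u = 1%E &
  {ae P, forall om, u om = \sum_z t om z * u (fstep z om)}].
Proof.
pose J := [set s : site | 0 <= s.1].
have mf n : sfun J (fwd t n).
  by apply: (sfun_sub _ (@sfun_fwd _ _ _ t_meas n)) => s /andP[].
have f0 := fwd_ge0 t_ge0.
pose M m := iter m (pair_fwd (tp P th) (tV P c1 th)) (fun=> 1) 0.
have Eff a b : (a <= b)%N -> Ex P (fun om => fwd t a om * fwd t b om) = (M a)%:E.
  move=> ab; rewrite -(Ex_fwd_fwd t_meas t_ge0 hP (Ex_tw hP th) (Ex_tw2 hP th) (tp_sum1 hP th) 0 ab).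
  by apply: eq_Ex => om; rewrite shift0.
have MB m : M m <= B := (hB m).1.
have [phi [u [mu u0 hphi ae_cv Ecv]]] := L2_limit mf f0 Eff MB.
exists u; split => //.
- apply: (cvg_eventually_cst Ecv (n := 0%N)) => k _.
  exact: (Ex_fwd t_meas t_ge0 hP (Ex_tw hP th) (tp_sum1 hP th)).
- have ae_sh : {ae P, forall om, forall z : U d,
     fwd t (phi k) (fstep z om) @[k --> \oo] --> u (fstep z om)}.
    apply: ae_forall_countable => z; apply: (@ae_shift _ _ _ _ hP 1 (uvec z)
      (fun om => fwd t (phi k) om @[k --> \oo] --> u om)).
    by apply: ae_imp ae_cv => om [].
  apply: (ae_imp2 _ ae_cv ae_sh) => om [_ h1] h2.
  apply: (cvg_unique _ h1) => //.
  rewrite (_ : (fun k => fwd t (phi k).+1 om) =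
    fun k => \sum_z t om z * fwd t (phi k) (fstep z om)); last first.
    by apply/funext.
  apply: cvg_big => [|z _]; last by apply: cvgM; [exact: cvg_cst|exact: h2].
  exact: add_continuous.
Qed.

Lemma bwd_limit : exists D : Env R d -> R, [/\
  sfun [set s : site | s.1 < 0] D, (forall om, 0 <= D om), Ex P D = 1%E &
  {ae P, forall om, D om = \sum_z t (bstep z om) z * D (bstep z om)}].
Proof.
pose J := [set s : site | s.1 < 0].
have mf n : sfun J (bwd t n).
  by apply: (sfun_sub _ (@sfun_bwd _ _ _ t_meas n)) => s /andP[].
have f0 := bwd_ge0 t_ge0.
pose M m := iter m (pair_back (tp P th) (tV P c1 th)) (fun=> 1) 0.
have Eff a b : (a <= b)%N -> Ex P (fun om => bwd t a om * bwd t b om) = (M a)%:E.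
  move=> ab; rewrite -(Ex_bwd_bwd t_meas t_ge0 hP (Ex_tw hP th) (Ex_tw2 hP th) (tp_sum1 hP th) 0 ab).
  by apply: eq_Ex => om; rewrite shift0.
have MB m : M m <= B := (hB m).2.
have [phi [u [mu u0 hphi ae_cv Ecv]]] := L2_limit mf f0 Eff MB.
exists u; split => //.
- apply: (cvg_eventually_cst Ecv (n := 0%N)) => k _.
  exact: (Ex_bwd t_meas t_ge0 hP (Ex_tw hP th) (tp_sum1 hP th)).
- have ae_sh : {ae P, forall om, forall z : U d,
     bwd t (phi k) (bstep z om) @[k --> \oo] --> u (bstep z om)}.
    apply: ae_forall_countable => z; apply: (@ae_shift _ _ _ _ hP (-1) (- uvec z)
      (fun om => bwd t (phi k) om @[k --> \oo] --> u om)).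
    by apply: ae_imp ae_cv => om [].
  apply: (ae_imp2 _ ae_cv ae_sh) => om [_ h1] h2.
  apply: (cvg_unique _ h1) => //.
  rewrite (_ : (fun k => bwd t (phi k).+1 om) =
    fun k => \sum_z t (bstep z om) z * bwd t (phi k) (bstep z om)); last first.
    by apply/funext.
  apply: cvg_big => [|z _]; last by apply: cvgM; [exact: cvg_cst|exact: h2].
  exact: add_continuous.
Qed.

End Limits.

(** * Zero-one law and positivity of the forward limit *)

Lemma ae_le_measure d (T : measurableType d) (R : realType)
    (mu : {measure set T -> \bar R}) (A B : set T) :
  measurable A -> measurable B -> {ae mu, forall x, A x -> B x} ->
  (mu A <= mu B)%E.
Proof.
move=> mA mB [N [mN N0 sub]].
rewrite -(measureU0 mB mN N0); apply: le_measure; rewrite ?inE//.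
  exact: measurableU.
move=> x Ax; have [Nx|nNx] := pselect (N x); [by right|left].
by apply: contrapT => nBx; apply: nNx; apply: sub => /= h; exact/nBx/h.
Qed.

(* A future event that is preserved by a fixed step is almost surely its own
   translate into the far future, hence independent of every finite horizon. *)
Section ZeroOne.
Variables (R : realType) (d : nat) (P : probability (Omega R d) R) (c1 : R).
Hypothesis hP : env_assumptions P c1.
Local Notation site := (int * Zd d)%type.
Variables (z0 : U d) (A : set (Omega R d)).
Hypothesis sA : <<s sgen [set s : site | 0 <= s.1] >> A.
Hypothesis stepA : {ae P, forall om, A om -> A (fstep z0 om)}.

Let fz (n : nat) : Omega R d -> Omega R d := shift n%:Z (uvec z0 *+ n).
Let mA : measurable A. Proof. exact: sgen_measurable sA. Qed.

Lemma inv_steps n : {ae P, forall om, A om -> A (fz n om)}.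
Proof.
elim: n => [|n IHn]; first by apply: aeW => om; rewrite /fz mulr0n shift0.
have h := @ae_shift _ _ _ _ hP n%:Z (uvec z0 *+ n)
  (fun om => A om -> A (fstep z0 om)) stepA.
apply: (ae_imp2 _ IHn h) => om h1 h2 /h1 /h2.
by rewrite /fstep /fz shift_shift mulrS -PoszD add1n.
Qed.

(** Moving [A] beyond the horizon of [C] gives at most the product of the probabilities, for [C] and
    for its complement alike. The two inequalities add up to an equality, so both are equalities. *)
Lemma inv_indep (C : set (Omega R d)) : hor [set s : site | 0 <= s.1] C ->
  P (A `&` C) = (P A * P C)%E.
Proof.
move=> [n hC].
pose I := [set s : site | 0 <= s.1] `&` [set s | `|s.1| < n%:Z].
have mC := sgen_measurable hC.
have hCc : <<s sgen I >> (~` C) by exact: (@measurableC _ (Om I) C hC).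
have mfA : <<s sgen [set s : site | n%:Z <= s.1] >> (fz n @^-1` A).
  by apply: (preimage_shift_sgen _ sA) => s /=; lia.
have le X : <<s sgen I >> X -> (P (A `&` X) <= P A * P X)%E.
  move=> hX; have mX := sgen_measurable hX.
  rewrite -[P A](P_shift hP n%:Z (uvec z0 *+ n) mA).
  rewrite -(sgen_indep hP _ mfA hX); last first.
    by rewrite -subset0 => s []; rewrite /I/= => h1 [h2 h3]; lia.
  apply: ae_le_measure.
  - exact: measurableI.
  - by apply: measurableI => //; exact: sgen_measurable mfA.
  - by apply: (ae_imp _ (inv_steps n)) => om h [/h].
have e1 : (P (A `&` C) + P (A `&` ~` C) = P A)%E.
  rewrite -measureU.
  - by rewrite -setIUr setUv setIT.
  - exact: measurableI.
  - by apply: measurableI => //; exact: measurableC.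
  - by rewrite setIACA setICr setI0.
have e2 : (P A * P C + P A * P (~` C) = P A)%E.
  by rewrite -ge0_muleDr// probability_setC// addeC subeK ?mule1// fin_num_measure.
have fin X : measurable X -> exists x : R, P X = x%:E.
  by move=> mX; exists (fine (P X)); rewrite fineK// fin_num_measure.
have [a ha] := fin _ mA; have [c hc] := fin _ mC.
have [c' hc'] := fin _ (measurableC mC).
have [x hx] := fin _ (measurableI _ _ mA mC).
have [x' hx'] := fin _ (measurableI _ _ mA (measurableC mC)).
have := le _ hC; have := le _ hCc; move: e1 e2; rewrite ha hc hc' hx hx'.
rewrite -!EFinM -!EFinD !lee_fin => -[e1] [e2] l1 l2; congr EFin; lra.
Qed.

Lemma inv_zero_one : P A = 0%E \/ P A = 1%E.
Proof.
have fA : ((fine (P A))%:E = P A)%E by rewrite fineK// fin_num_measure.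
have nn : 0 <= fine (P A) by exact: fine_ge0.
have sc X : (mscale (NngNum nn) P X = P A * P X)%E by rewrite /mscale/= fA.
have PAA : P (A `&` A) = (P A * P A)%E.
  rewrite -sc; apply: (@hor_unique _ _ [set s : site | 0 <= s.1] (mrestr P mA)
      (mscale (NngNum nn) P)) => //.
    by rewrite /= /mrestr setTI; apply: (le_lt_trans (probability_le1 _ mA)); rewrite ltry.
  move=> X hX; rewrite -[RHS]/(mscale (NngNum nn) P X) sc -inv_indep// setIC.
  by [].
move: PAA; rewrite setIid -fA -EFinM => -[].
move/eqP; rewrite -subr_eq0 -[X in X - _]mulr1 -mulrBr mulf_eq0.
by case/orP => [/eqP -> //|]; [left|rewrite subr_eq0 => /eqP <-; right].
Qed.

End ZeroOne.

Section Positivity.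
Variables (R : realType) (d : nat) (P : probability (Omega R d) R) (c1 : R).
Hypothesis hP : env_assumptions P c1.
Variables (th : 'rV[R]_d) (B : R).
Local Notation site := (int * Zd d)%type.
Local Notation t := (tw P c1 th).
Variable u : Env R d -> R.
Hypothesis mu : sfun [set s : site | 0 <= s.1] u.
Hypothesis u0 : forall om, 0 <= u om.
Hypothesis Eu : Ex P u = 1%E.
Hypothesis hu : {ae P, forall om, u om = \sum_z t om z * u (fstep z om)}.
Variable z0 : U d.

Let A : set (Omega R d) := u @^-1` [set 0].

Let sA : <<s sgen [set s : site | 0 <= s.1] >> A.
Proof. by have := mu measurableT (measurable_set1 (0 : R)); rewrite setTI. Qed.

Let mA : measurable A. Proof. exact: sgen_measurable sA. Qed.

(** A sum of nonnegative terms with positive weights vanishes only if every term does. *)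
Lemma zero_step : {ae P, forall om, A om -> A (fstep z0 om)}.
Proof.
apply: (ae_imp _ hu) => om h; rewrite /A /= => u_0.
move: h; rewrite u_0 => /esym/eqP; rewrite psumr_eq0; last first.
  by move=> z _; rewrite mulr_ge0 ?(tw_ge0 hP).
move=> /allP /(_ z0); rewrite mem_index_enum => /(_ isT) /=.
by rewrite mulf_eq0 gt_eqF ?(tw_gt0 hP)//= => /eqP.
Qed.

Lemma u_pos : {ae P, forall om, 0 < u om}.
Proof.
have PA : P A = 0%E.
  have [//|PA1] := inv_zero_one hP sA zero_step.
  have u_0 : {ae P, forall om, u om = 0} by exact: (@prob1_ae _ _ _ P A).
  have : Ex P u = Ex P (fun=> 0).
    apply: ae_eq_Ex => //; [exact: sfun_sub mu|exact: sfun_cst].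
  by rewrite Eu Ex_cst => /eqP; rewrite onee_eq0.
exists A; split => // om /= h.
by apply/eqP; rewrite eq_le u0 andbT leNgt; apply/negP.
Qed.

End Positivity.

Section Density.
Variables (R : realType) (d : nat) (P : probability (Omega R d) R) (c1 : R).
Hypothesis hP : env_assumptions P c1.
Variables (th : 'rV[R]_d) (B : R).
Hypothesis d1 : (0 < d)%N.
Hypothesis hB : forall m,
  iter m (pair_fwd (tp P th) (tV P c1 th)) (fun=> 1) 0 <= B /\
  iter m (pair_back (tp P th) (tV P c1 th)) (fun=> 1) 0 <= B.
Local Notation site := (int * Zd d)%type.
Local Notation t := (tw P c1 th).

Lemma fwd_density : exists u : Env R d -> R, [/\
  sfun [set s : site | 0 <= s.1] u, (forall om, 0 < u om), Ex P u = 1%E &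
  {ae P, forall om, u om = \sum_z t om z * u (fstep z om)}].
Proof.
have [u [mu u0 Eu hu]] := fwd_limit hP hB.
have upos := u_pos hP mu u0 Eu hu (Ordinal d1, true).
pose A : set (Env R d) := u @^-1` [set 0].
have sA : <<s sgen [set s : site | 0 <= s.1] >> A.
  by have := mu measurableT _ (measurable_set1 (0 : R)); rewrite setTI.
(* Redefines [u] as 1 on the null set where it vanishes, which makes it positive everywhere. *)
pose v om := u om + \1_A om.
have mv : sfun [set s : site | 0 <= s.1] v by apply: sfunD => //; exact: sfun_indic.
have uv : {ae P, forall om, u om = v om}.
  apply: (ae_imp _ upos) => om h; rewrite /v indicE memNset ?addr0//.
  by rewrite /A /= => h0; rewrite h0 ltxx in h.
have v0 om : 0 < v om.
  rewrite /v indicE; case: (boolP (om \in A)) => h.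
    by rewrite ltr_wpDl.
  rewrite addr0 lt_neqAle u0 andbT; apply/eqP => h0.
  by move: h => /negP; apply; rewrite inE /A /= -h0.
exists v; split => //.
- rewrite -Eu; apply: ae_eq_Ex => //; [exact: sfun_sub mv|exact: sfun_sub mu| |].
  + by apply: (ae_imp _ uv) => om ->.
  + by move=> om; rewrite ltW.
- have uvs : {ae P, forall om, forall z : U d, u (fstep z om) = v (fstep z om)}.
    apply: ae_forall_countable => z.
    exact: (@ae_shift _ _ _ _ hP 1 (uvec z) (fun om => u om = v om)).
  have h1 : {ae P, forall om, u om = v om /\ u om = \sum_z t om z * u (fstep z om)}.
    by apply: (ae_imp2 _ uv hu) => om.
  apply: (ae_imp2 _ h1 uvs) => om [<- ->] h2.
  by apply: eq_bigr => z _; rewrite h2.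
Qed.

End Density.

(** * Construction of the path measure *)

Lemma measurable_inv_pos d (T : measurableType d) (R : realType) (f : T -> R) :
  (forall x, 0 < f x) -> measurable_fun setT f -> measurable_fun setT (fun x => (f x)^-1).
Proof.
move=> f0 mf; rewrite (_ : (fun x => (f x)^-1) = fun x => expR (- ln (f x))).
  apply: (measurableT_comp (f := @expR R)); first exact: measurable_expR.
  by apply: measurableT_comp => //; apply: measurableT_comp mf; exact: measurable_ln.
by apply/funext => x; rewrite expRN lnK ?posrE.
Qed.

Section DensityProbability.
Context d (T : measurableType d) (R : realType) (P : probability T R).
Variable h : T -> R.
Hypothesis mh : measurable_fun setT h.
Hypothesis h0 : forall x, 0 <= h x.
Hypothesis h1 : (\int[P]_x (h x)%:E = 1)%E.

(** The formula for sets identifies [h] almost everywhere with a Radon-Nikodym derivative, whose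
    change of variables extends it to functions. *)
Lemma density_probability : exists Q : probability T R,
  forall f : T -> \bar R, measurable_fun setT f -> (forall x, (0 <= f x)%E) ->
    (\int[Q]_x f x = \int[P]_x (f x * (h x)%:E))%E.
Proof.
pose m (A : set T) : \bar R := (\int[P]_(x in A) (h x)%:E)%E.
have mhE : measurable_fun setT (EFin \o h) by apply/measurable_EFinP.
have m0 : m set0 = 0%E by rewrite /m integral_set0.
have mge0 A : (0 <= m A)%E by apply: integral_ge0 => x _; rewrite lee_fin.
have madd : semi_sigma_additive m.
  move=> F mF tF mUF; rewrite /m; apply: cvg_toP.
    apply: ereal_nondecreasing_is_cvgn => a b ab; apply: lee_sum_nneg_natr => // k _ _.
    exact: mge0.
  rewrite ge0_integral_bigcup//.
    exact: measurable_funTS.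
  by move=> x _; rewrite lee_fin.
have m1 : m setT = 1%E by [].
pose M := isMeasure.Build _ _ _ m m0 mge0 madd.
pose Mm : {measure set T -> \bar R} := HB.pack m M.
pose Pm := Measure_isProbability.Build _ _ _ Mm m1.
pose Q : probability T R := HB.pack m M Pm.
exists Q => f mf f0.
have QP : Q `<< P.
  apply/null_content_dominatesP => A mA A0.
  by apply: null_set_integral => //; exact: measurable_funTS.
rewrite -(Radon_Nikodym_SigmaFinite.change_of_variables QP f0 measurableT mf).
have ih : P.-integrable setT (EFin \o h).
  apply/integrableP; split => //.
  under eq_integral => x _ do rewrite gee0_abs ?lee_fin//.
  by rewrite h1 ltry.
have iRN := Radon_Nikodym_SigmaFinite.f_integrable QP.
have mRN := measurable_int _ iRN.
have ae : ae_eq P setT (Radon_Nikodym_SigmaFinite.f Q P) (EFin \o h).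
  apply: integral_ae_eq => // E _ mE.
  by rewrite -Radon_Nikodym_SigmaFinite.f_integral.
apply: ae_eq_integral => //.
- exact: emeasurable_funM.
- exact: emeasurable_funM.
- exact: ae_eqe_mul2l.
Qed.

End DensityProbability.

Section Affine.
Variable R : realType.
Local Notation leb := (@lebesgue_measure R).
Implicit Types (g : R -> \bar R).

Lemma integral_translate g (a s : R) : measurable_fun setT g -> (forall x, (0 <= g x)%E) ->
  (\int[leb]_(x in `[a, (a + s)%R[) g (x - a)%R = \int[leb]_(x in `[0%R, s[) g x)%E.
Proof.
move=> mg g0.
pose phi : measurableTypeR R -> measurableTypeR R := fun x => (x : R) - a.
have mphi : measurable_fun setT phi by exact: measurable_funB.
have -> : [set` `[a, a + s[] = phi @^-1` [set` `[0, s[].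
  by apply/seteqP; split=> x /=; rewrite !in_itv/= subr_ge0 ltrBlDl.
transitivity (\int[pushforward leb phi]_(x in `[0%R, s[) g x)%E.
  rewrite (ge0_integral_pushforward mphi leb)//.
  exact: measurable_funTS.
apply: eq_measure_integral => A mA _.
symmetry; apply: (@lebesgue_measure_unique R (pushforward leb phi)) => // _ [[x y]] _ <-.
rewrite -[RHS]/(leb (phi @^-1` `]x, y]%classic)) -[LHS]/(leb `]x, y]%classic).
have -> : phi @^-1` `]x, y]%classic = `]x + a, y + a]%classic.
  by apply/seteqP; split=> z /=; rewrite !in_itv/= ltrBrDr lerBlDr.
rewrite /= !lebesgue_measure_itv/= !lte_fin ltrD2r.
by case: ifP => // _; rewrite -!EFinB; congr EFin; ring.
Qed.

Lemma integral_scale g (a : R) : 0 < a -> measurable_fun setT g -> (forall x, (0 <= g x)%E) ->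
  (\int[leb]_(x in `[0%R, a[) g (x / a)%R = a%:E * \int[leb]_(x in `[0%R, 1%R[) g x)%E.
Proof.
move=> a0 mg g0.
pose phi : measurableTypeR R -> measurableTypeR R := fun x => (x : R) / a.
have mphi : measurable_fun setT phi by exact: measurable_funM.
have -> : [set` `[0, a[] = phi @^-1` [set` `[0, 1[].
  apply/seteqP; split=> x /=; rewrite !in_itv/=.
    by rewrite ltr_pdivrMr// mul1r => /andP[h1 h2]; rewrite h2 andbT divr_ge0// ltW.
  by rewrite ltr_pdivrMr// mul1r pmulr_lge0// invr_gt0.
have a0' : 0 <= a by exact: ltW.
transitivity (\int[pushforward leb phi]_(x in `[0%R, 1%R[) g x)%E.
  rewrite (ge0_integral_pushforward mphi leb)//.
  exact: measurable_funTS.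
rewrite -(@ge0_integral_mscale _ _ _ leb [set` `[0, 1[] _ (NngNum a0'))//; last first.
  exact: measurable_funTS.
apply: eq_measure_integral => A mA _.
have ai0 : 0 <= a^-1 by rewrite invr_ge0.
have key X : measurable X ->
    leb X = mscale (NngNum ai0) (pushforward leb phi) X.
  apply: (@lebesgue_measure_unique R
    (mscale (NngNum ai0) (pushforward leb phi))) => // _ [[x y]] _ <-.
  rewrite -[RHS]/((a^-1)%:E * leb (phi @^-1` `]x, y]%classic))%E -[LHS]/(leb `]x, y]%classic).
  have -> : phi @^-1` `]x, y]%classic = `]x * a, y * a]%classic.
    by apply/seteqP; split=> z /=; rewrite !in_itv/= ltr_pdivlMr// ler_pdivrMr.
  rewrite !lebesgue_measure_itv/= !lte_fin ltr_pM2r//.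
  case: ifP => _; last by rewrite -EFinM mulr0.
  by rewrite -!EFinB -EFinM; congr EFin; field; rewrite gt_eqF.
rewrite -[RHS]/(a%:E * leb A)%E key// /mscale/= muleA -EFinM divff ?mul1e//.
by rewrite gt_eqF.
Qed.

End Affine.

(* Samples an index of the list l with weights k from the uniform variable tau:
   tau is compared with the partial sums, and its rescaled position inside the
   selected interval is passed on as fresh uniform randomness. *)
Section Select.
Variables (R : realType) (I : Type) (T T' : Type) (i0 : I) (k : T -> I -> R).

Fixpoint sel (l : seq I) (phi : I -> T -> R -> T') (w : T * R) : T' :=
  if l is i :: l' then
    if w.2 < k w.1 i then phi i w.1 (w.2 / k w.1 i)
    else sel l' phi (w.1, w.2 - k w.1 i)
  else phi i0 w.1 0.

End Select.

Lemma sel_comp (R : realType) (I T T' T'' : Type) i0 (k : T -> I -> R) l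
    (phi : I -> T -> R -> T') (F : T' -> T'') w :
  F (sel i0 k l phi w) = sel i0 k l (fun i x s => F (phi i x s)) w.
Proof. by elim: l w => [//|i l IHl] w /=; case: ifP. Qed.

Section SelectMeasure.
Context (R : realType) (I : Type) d (T : measurableType d) d' (T' : measurableType d').
Variables (i0 : I) (k : T -> I -> R).
Hypothesis mk : forall i, measurable_fun setT (k^~ i).
Hypothesis k0 : forall x i, 0 < k x i.

Lemma measurable_sel l (phi : I -> T -> R -> T') :
  (forall i, measurable_fun setT (fun w : T * R => phi i w.1 w.2)) ->
  measurable_fun setT (sel i0 k l phi).
Proof.
move=> mphi.
have mk1 i : measurable_fun setT (fun w : T * R => k w.1 i).
  exact: (measurableT_comp (mk i) measurable_fst).
elim: l => [|i l IHl].
  rewrite (_ : sel _ _ _ _ = (fun w : T * R => phi i0 w.1 w.2) \o (fun w => (w.1, 0)))//.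
  apply: measurableT_comp => //.
  by apply/measurable_fun_pair; [exact: measurable_fst|exact: measurable_cst].
rewrite (_ : sel _ _ _ _ = fun w => if w.2 < k w.1 i then phi i w.1 (w.2 / k w.1 i)
    else sel i0 k l phi (w.1, w.2 - k w.1 i))//.
apply: measurable_fun_ifT.
- by apply: measurable_fun_ltr => //; exact: measurable_snd.
- apply: (measurableT_comp (f := fun w : T * R => phi i w.1 w.2)
    (g := fun w : T * R => (w.1, w.2 / k w.1 i))) => //.
  apply/measurable_fun_pair; first exact: measurable_fst.
  apply: measurable_funM; first exact: measurable_snd.
  exact: (measurable_inv_pos _ (mk1 i)).
- apply: (measurableT_comp (f := sel i0 k l phi)
    (g := fun w : T * R => (w.1, w.2 - k w.1 i))) => //.
  apply/measurable_fun_pair; first exact: measurable_fst.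
  by apply: measurable_funB => //; exact: measurable_snd.
Qed.

End SelectMeasure.

Section SelectIntegral.
Context (R : realType) (I : Type) (T : Type).
Variables (i0 : I) (k : T -> I -> R).
Local Notation leb := (@lebesgue_measure R).

(** Each index owns an interval of length [k x i]; translating it to 0 and rescaling it to unit
    length produces the factor. *)
Lemma integral_sel (x : T) (l : seq I) (phi : I -> R -> \bar R) :
  (forall i, 0 < k x i) -> (forall i, measurable_fun setT (phi i)) ->
  (forall i s, (0 <= phi i s)%E) ->
  (\int[leb]_(s in `[0%R, (\sum_(i <- l) k x i)%R[) sel i0 k l (fun i _ => phi i) (x, s) =
   \sum_(i <- l) (k x i)%:E * \int[leb]_(s in `[0%R, 1%R[) phi i s)%E.
Proof.
move=> k0 mphi phi0.
have msel l' : measurable_fun setT (fun s => sel i0 k l' (fun i _ => phi i) (x, s)).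
  elim: l' => [|i l' IHl']; first exact: measurable_cst.
  apply: measurable_fun_ifT => /=.
  - by apply: measurable_fun_ltr => //.
  - by apply: (measurableT_comp (mphi i)); exact: measurable_funM.
  - apply: (measurableT_comp (f := fun s => sel i0 k l' (fun i _ => phi i) (x, s))) => //.
    exact: measurable_funB.
have sel0 l' s : (0 <= sel i0 k l' (fun i _ => phi i) (x, s))%E.
  by elim: l' s => [|i l' IHl'] s //=; case: ifP.
elim: l => [|i l IHl].
  by rewrite !big_nil set_itvco0 integral_set0.
rewrite !big_cons.
have S0 : 0 <= \sum_(j <- l) k x j by rewrite sumr_ge0// => j _; exact: ltW.
have -> : [set` `[0, (k x i + \sum_(j <- l) k x j)[] =
    `[0, k x i[%classic `|` `[k x i, (k x i + \sum_(j <- l) k x j)[%classic.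
  have ki := ltW (k0 i).
  apply/seteqP; split=> s /=; rewrite !in_itv/=.
    move=> /andP[h1 h2]; case: (ltP s (k x i)) => h; [left|right].
      by rewrite h1.
    by rewrite h2.
  case=> /andP[h1 h2]; first by rewrite h1 (lt_le_trans h2)// lerDl.
  by rewrite h2 (le_trans ki).
rewrite ge0_integral_setU//; last 2 first.
- apply: measurable_funTS; exact: (msel (i :: l)).
- apply/disj_setPS => s [/=]; rewrite !in_itv/= => /andP[_ h1] /andP[h2 _].
  by move: h1; rewrite ltNge h2.
congr (_ + _)%E.
  rewrite -integral_scale//; apply: eq_integral => s; rewrite inE/= in_itv/= => /andP[_ h].
  by rewrite h.
rewrite -IHl -(integral_translate (k x i)) => //.
apply: eq_integral => s; rewrite inE/= in_itv/= => /andP[h _].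
by rewrite ltNge h.
Qed.

End SelectIntegral.

Section StepSequences.
Variable d : nat.

Definition seq_of (v : seq (Zd d)) : Zseq d := fun i => nth 0 v i.
Definition ext (l : seq (U d)) : Zseq d := seq_of (map (@uvec d) l).
Definition scons (y : Zd d) (s : Zseq d) : Zseq d := fun i => if i is j.+1 then s j else y.

Lemma ext_cons z l : ext (z :: l) = scons (uvec z) (ext l).
Proof. by apply/funext => -[|i]. Qed.

Lemma measurable_coord i y : measurable [set s : Zseq d | s i = y].
Proof. by apply: sub_sigma_algebra; exists i, y. Qed.

Lemma measurable_to_Zseq dT (T : measurableType dT) (F : T -> Zseq d) :
  (forall i y, measurable [set w | F w i = y]) -> measurable_fun setT F.
Proof.
move=> h; apply: (@measurability _ _ T (Zseq d) setT F (@zgen d) erefl) => // A [C [i [y ->]] <-].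
by rewrite setTI; exact: h.
Qed.

Lemma measurable_scons y : measurable_fun setT (scons y).
Proof.
apply: measurable_to_Zseq => -[|i] x; last exact: measurable_coord.
have [->|yx] := pselect (y = x).
  by rewrite (_ : [set _ | _] = setT)//; apply/seteqP; split.
by rewrite (_ : [set _ | _] = set0)//; apply/seteqP; split.
Qed.

Lemma bigcup_count_measurable dT (T : measurableType dT) (I : countType) (A : I -> set T) :
  (forall i, measurable (A i)) -> measurable (\bigcup_i A i).
Proof.
move=> mA; rewrite (_ : \bigcup_i A i =
    \bigcup_(n in [set: nat]) (if @unpickle I n is Some i then A i else set0)); last first.
  apply/seteqP; split=> [x [i _ Ax]|x [n _]].
    by exists (pickle i) => //; rewrite pickleK.
  by case: (unpickle n) => // i Ax; exists i.
by apply: bigcup_measurable => n _; case: (unpickle n).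
Qed.

(** The finitely many steps that matter take countably many values, so a preimage is a countable
    union of measurable rectangles. *)
Lemma measurable_section dT (T : measurableType dT) dT' (T' : measurableType dT')
    (K : nat) (f : T * Zseq d -> T') :
  (forall x s s', (forall i, (i < K)%N -> s i = s' i) -> f (x, s) = f (x, s')) ->
  (forall s, measurable_fun setT (fun x => f (x, s))) ->
  measurable_fun setT f.
Proof.
move=> fK mf _ B mB; rewrite setTI.
rewrite (_ : f @^-1` B = \bigcup_(v in [set: seq (Zd d)])
   (((fun x => f (x, seq_of v)) @^-1` B) `*`
    \bigcap_(i in `I_K) [set s : Zseq d | s i = nth 0 v i])); last first.
  apply/seteqP; split=> [[x s] /= Bx|[x s] [v _ [/= Bx hs]]].
    have e i : (i < K)%N -> s i = seq_of (mkseq s K) i.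
      by move=> iK; rewrite /seq_of nth_mkseq.
    exists (mkseq s K) => //; split => /=; first by rewrite -(fK x s).
    by move=> i /= /e.
  by rewrite /= (fK x s (seq_of v)).
apply: bigcup_count_measurable => v; apply: measurableX.
  by have := mf (seq_of v) measurableT B mB; rewrite setTI.
apply: bigcap_measurableType => i _; exact: measurable_coord.
Qed.

End StepSequences.

Section PathMeasure.
Variables (R : realType) (d : nat).
Hypothesis d1 : (0 < d)%N.
Let z0 : U d := (Ordinal d1, true).
Variable k : Omega R d -> U d -> R.
Hypothesis mk : forall z, measurable_fun setT (k^~ z).
Hypothesis k0 : forall om z, 0 < k om z.
Hypothesis k1 : forall om, \sum_z k om z = 1.
Local Notation W := (Omega R d * R)%type.
Local Notation sl := (sel z0 k (index_enum (U d))).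

(** One uniform variable drives the whole path: a deterministic map on pairs of environment and
    randomness consumes part of it at each step. The path measure is then an image of a product
    measure, with no extension of finite-dimensional laws. *)
Definition next_state (w : W) : W := sl (fun z om s => (fstep z om, s)) w.
Definition next_step (w : W) : Zd d := sl (fun z _ _ => uvec z) w.
Definition steps (w : W) : Zseq d := fun i => next_step (iter i next_state w).

Lemma stepsE w :
  steps w = sl (fun z om s => scons (uvec z) (steps (fstep z om, s))) w.
Proof.
have h : (next_step w, next_state w) = sl (fun z om s => (uvec z, (fstep z om, s))) w.
  rewrite /next_step /next_state.
  rewrite -(sel_comp (R := R) z0 k (index_enum (U d)) (fun z om s => (uvec z, (fstep z om, s)))
    (fun v : Zd d * W => v.1)).
  rewrite -(sel_comp (R := R) z0 k (index_enum (U d)) (fun z om s => (uvec z, (fstep z om, s)))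
    (fun v : Zd d * W => v.2)).
  by case: (sl _ _).
transitivity (scons (next_step w) (steps (next_state w))).
  by apply/funext => -[//|i]; rewrite /steps iterSr.
rewrite -[next_step w]/((next_step w, next_state w).1).
rewrite -[next_state w in LHS]/((next_step w, next_state w).2) h.
exact: (sel_comp (R := R) z0 k (index_enum (U d)) (fun z om s => (uvec z, (fstep z om, s)))
  (fun v : Zd d * W => scons v.1 (steps v.2)) w).
Qed.

Lemma measurable_next_state : measurable_fun setT next_state.
Proof.
apply: measurable_sel => // z; apply/measurable_fun_pair; last exact: measurable_snd.
apply: (measurableT_comp (f := fstep z)); last exact: measurable_fst.
exact: measurable_shift.
Qed.

Lemma measurable_steps : measurable_fun setT steps.
Proof.
apply: measurable_to_Zseq => i y.
have mi : measurable_fun setT (iter i next_state).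
  elim: i => [|i IHi]; first exact: measurable_id.
  exact: (measurableT_comp measurable_next_state).
have ms : measurable_fun setT (fun w => next_step w == y).
  rewrite (_ : (fun w => _) = sl (fun z _ _ => uvec z == y)); last first.
    by apply/funext => w; exact: (sel_comp _ _ _ _ (fun v => v == y)).
  by apply: measurable_sel => // z; exact: measurable_cst.
have := measurableT_comp ms mi; move=> /(_ measurableT [set true] I).
by rewrite setTI; congr (measurable _); apply/seteqP; split=> w /= /eqP.
Qed.

(** By [stepsE] and [integral_sel] the first step contributes its weight and leaves a uniform
    variable for the remaining ones. *)
Lemma integral_steps K (g : Zseq d -> \bar R) (om : Omega R d) :
  measurable_fun setT g -> (forall s, (0 <= g s)%E) ->
  (forall s s', (forall i, (i < K)%N -> s i = s' i) -> g s = g s') ->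
  (\int[@lebesgue_measure R]_(s in `[0%R, 1%R[) g (steps (om, s)) =
   \sum_(l <- paths d K) (wt k l om)%:E * g (ext l))%E.
Proof.
elim: K g om => [|K IHK] g om mg g0 gK.
  rewrite sum_paths0 mul1e.
  under eq_integral => s _ do rewrite (gK _ (ext [::]))//.
  by rewrite integral_cst//= lebesgue_measure_itv/= lte01 oppr0 adde0 mule1.
have fixom l (Phi : U d -> Omega R d -> R -> \bar R) s :
    sel z0 k l Phi (om, s) = sel z0 k l (fun z _ => Phi z om) (om, s).
  by elim: l s => [|z l IHl] s //=; case: ifP.
pose phi z s := g (scons (uvec z) (steps (fstep z om, s))).
have mphi z : measurable_fun setT (phi z).
  apply: (measurableT_comp mg); apply: (measurableT_comp (@measurable_scons d (uvec z))).
  exact: (measurableT_comp measurable_steps (pair1_measurable (fstep z om))).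
rewrite -(k1 om).
transitivity (\int[@lebesgue_measure R]_(s in `[0%R, (\sum_z k om z)%R[)
    sl (fun z _ => phi z) (om, s))%E.
  apply: eq_integral => s _; rewrite stepsE.
  by rewrite (sel_comp _ _ _ _ g) fixom.
rewrite integral_sel//; last by move=> z s; exact: g0.
rewrite sum_pathsS; apply: eq_bigr => z _.
rewrite (IHK (fun s => g (scons (uvec z) s)) (fstep z om)).
- rewrite ge0_sume_distrr; last first.
    by move=> l _; rewrite mule_ge0// lee_fin wt_ge0// => ? ?; exact: ltW.
  by apply: eq_bigr => l _; rewrite muleA -EFinM ext_cons.
- by apply: (measurableT_comp mg); exact: measurable_scons.
- by move=> s; exact: g0.
- by move=> s s' h; apply: gK => -[//|i] iK; exact: h.
Qed.

Variables (mu : probability (Omega R d) R).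

Lemma path_measure : exists mb : probability (Omega R d * Zseq d)%type R,
  forall (K : nat) (f : Omega R d * Zseq d -> R), (forall p, 0 <= f p) ->
    (forall om s s', (forall i, (i < K)%N -> s i = s' i) -> f (om, s) = f (om, s')) ->
    (forall s, measurable_fun setT (fun om => f (om, s))) ->
    (\int[mb]_p (f p)%:E =
     \int[mu]_om (\sum_(l <- paths d K) wt k l om * f (om, ext l))%:E)%E.
Proof.
have mid : measurable_fun setT (fun x : measurableTypeR R => (x : R)) by exact: measurable_id.
pose idR : {mfun measurableTypeR R >-> R} :=
  HB.pack (fun x : measurableTypeR R => (x : R)) (isMeasurableFun.Build _ _ _ _ _ mid).
pose U01 : probability R R := distribution (uniform_prob (@ltr01 R)) idR.
pose Psi (w : W) : Omega R d * Zseq d := (w.1, steps w).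
have mPsi : measurable_fun setT Psi.
  by apply/measurable_fun_pair; [exact: measurable_fst|exact: measurable_steps].
pose iPsi : {mfun W >-> (Omega R d * Zseq d)%type} :=
  HB.pack Psi (isMeasurableFun.Build _ _ _ _ _ mPsi).
pose Q : probability W R := (mu \x U01)%E.
exists (distribution Q iPsi) => K f f0 fK mf.
have mfE : measurable_fun setT (fun p => (f p)%:E).
  by apply/measurable_EFinP; exact: measurable_section fK mf.
rewrite ge0_integral_pushforward//; last by move=> p _; rewrite lee_fin.
rewrite preimage_setT.
rewrite [LHS](_ : _ = \int[mu \x U01]_w ((fun p => (f p)%:E) (Psi w)))%E//.
rewrite fubini_tonelli1//; last 2 first.
- exact: (measurableT_comp mfE).
- by move=> w; rewrite lee_fin.
apply: eq_integral => om _; rewrite /fubini_F.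
have ms : measurable_fun setT (fun s : R => (f (om, steps (om, s)))%:E).
  apply: (measurableT_comp mfE); apply/measurable_fun_pair; first exact: measurable_cst.
  exact: (measurableT_comp measurable_steps (pair1_measurable om)).
rewrite (ge0_integral_pushforward mid)//; last by move=> s _; rewrite lee_fin.
rewrite preimage_setT integral_uniform//=; last by move=> s; rewrite lee_fin.
rewrite subr0 invr1 mul1e -integral_itv_bndo_bndc; last exact: measurable_funTS.
rewrite (integral_steps (K := K) (g := fun s => (f (om, s))%:E))//.
- by rewrite -sumEFin; apply: eq_bigr => l _; rewrite EFinM.
- exact: (measurableT_comp mfE (pair1_measurable om)).
- by move=> s; rewrite lee_fin.
- by move=> s s' h; rewrite (fK om s s').
Qed.

End PathMeasure.

(** * The stationary law *)

Section Harmonic.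
Variables (R : realType) (d : nat) (t : Env R d -> U d -> R).
Variables (u D : Env R d -> R).

Definition harm (om : Env R d) := u om = \sum_z t om z * u (fstep z om).
Definition coharm (om : Env R d) := D om = \sum_z t (bstep z om) z * D (bstep z om).

Lemma harm_paths om : (forall n x, harm (shift n x om)) ->
  forall n, u om = \sum_(l <- paths d n) wt t l om * u (endp l om).
Proof.
move=> h n; elim: n om h => [|n IHn] om h; first by rewrite sum_paths0 mul1r endp_nil.
have := h 0 0; rewrite /harm shift0 => ->; rewrite sum_pathsS; apply: eq_bigr => z _.
rewrite (IHn (fstep z om)) ?mulr_sumr; last by move=> m x; rewrite /fstep shift_shift; exact: h.
by apply: eq_bigr => l _; rewrite endp_cons mulrA.
Qed.

Lemma coharm_paths om : (forall n x, coharm (shift n x om)) ->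
  forall n, D om = \sum_(l <- paths d n) wt t l (bk l om) * D (bk l om).
Proof.
move=> h n; elim: n om h => [|n IHn] om h; first by rewrite sum_paths0 mul1r bk_nil.
have := h 0 0; rewrite /coharm shift0 => ->; rewrite -[in RHS]addn1 sum_paths_cat.
under [RHS]eq_bigr => l _ do rewrite sum_pathsS.
rewrite [RHS]exchange_big; apply: eq_bigr => z _ /=.
rewrite (IHn (bstep z om)) ?mulr_sumr; last by move=> m x; rewrite /bstep shift_shift; exact: h.
apply: eq_bigr => l _; rewrite sum_paths0.
rewrite bk_cat bk_seq1 wt_cat endp_bk /= mulr1; ring.
Qed.

End Harmonic.

Section Densities.
Variables (R : realType) (d : nat) (P : probability (Omega R d) R) (c1 : R).
Hypothesis hP : env_assumptions P c1.
Variable t : Env R d -> U d -> R.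
Hypothesis t_meas : forall z, sfun [set (0, 0)] (t^~ z).
Hypothesis t_ge0 : forall om z, 0 <= t om z.
Local Notation site := (int * Zd d)%type.

Lemma ae_shifts (A : Omega R d -> Prop) :
  {ae P, forall om, A om} -> {ae P, forall om, forall n x, A (shift n x om)}.
Proof.
move=> hA.
have h (s : site) : {ae P, forall om, A (shift s.1 s.2 om)}.
  exact: (@ae_shift _ _ _ _ hP s.1 s.2 A).
have := @ae_forall_countable _ _ _ P site (fun s om => A (shift s.1 s.2 om)) h.
by apply: ae_imp => om hh n x; exact: (hh (n, x)).
Qed.

Section Forward.
Variable u : Env R d -> R.
Hypothesis mu : sfun [set s : site | 0 <= s.1] u.
Hypothesis u0 : forall om, 0 <= u om.
Hypothesis Eu : Ex P u = 1%E.
Hypothesis hu : {ae P, forall om, harm t u om}.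

Lemma sfun_path_sum n (f : seq (U d) -> Env R d -> R) : (forall l, sfun setT (f l)) ->
  sfun setT (fun om => \sum_(l <- paths d n) wt t l om * f l om).
Proof.
move=> mf; apply: sfun_sum => l; apply: sfunM => //.
by apply: (sfun_sub _ (@sfun_wt _ _ _ t_meas l)).
Qed.

Lemma sfun_endpT l (g : Env R d -> R) : sfun setT g -> sfun setT (fun om => g (endp l om)).
Proof. by move=> mg; apply: sfun_shift mg. Qed.

Lemma path_sum_ge0 n (f : seq (U d) -> R) om : (forall l, 0 <= f l) ->
  0 <= \sum_(l <- paths d n) wt t l om * f l.
Proof. by move=> f0; apply: sumr_ge0 => l _; rewrite mulr_ge0// wt_ge0. Qed.

(** Expanding [u] along paths of length [n] leaves a factor [u] on the layers from [n] on, which is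
    independent of the rest and has mean one. *)
Lemma Ex_fwd_density n Y : sfun [set s : site | s.1 < n%:Z] Y -> (forall om, 0 <= Y om) ->
  Ex P (fun om => Y om * u om) = Ex P (fun om => Y om * fwd t n om).
Proof.
move=> mY Y0.
have muT : sfun setT u by apply: (sfun_sub _ mu).
have mYT : sfun setT Y by apply: (sfun_sub _ mY).
transitivity (Ex P (fun om => Y om * \sum_(l <- paths d n) wt t l om * u (endp l om))).
  apply: ae_eq_Ex.
  - exact: sfunM.
  - by apply: sfunM => //; apply: sfun_path_sum => l; exact: sfun_endpT.
  - by apply: ae_imp (ae_shifts hu) => om h; rewrite -(harm_paths h).
  - by move=> om; rewrite mulr_ge0.
  - by move=> om; rewrite mulr_ge0//; apply: path_sum_ge0.
by rewrite (Ex_path_indep t_meas t_ge0 hP mY mu Y0 u0) Eu mule1.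
Qed.

End Forward.

Section Backward.
Variable D : Env R d -> R.
Hypothesis mD : sfun [set s : site | s.1 < 0] D.
Hypothesis D0 : forall om, 0 <= D om.
Hypothesis ED : Ex P D = 1%E.
Hypothesis hD : {ae P, forall om, coharm t D om}.

Lemma sfun_bkT l (g : Env R d -> R) : sfun setT g -> sfun setT (fun om => g (bk l om)).
Proof. by move=> mg; apply: sfun_shift mg. Qed.

Lemma Ex_bwd_density n Y : sfun [set s : site | - n%:Z <= s.1] Y -> (forall om, 0 <= Y om) ->
  Ex P (fun om => Y om * D om) = Ex P (fun om => Y om * bwd t n om).
Proof.
move=> mY Y0.
have mDT : sfun setT D by apply: (sfun_sub _ mD).
have mYT : sfun setT Y by apply: (sfun_sub _ mY).
have mw l : sfun setT (wt t l) by apply: (sfun_sub _ (@sfun_wt _ _ _ t_meas l)).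
transitivity (Ex P (fun om => Y om * \sum_(l <- paths d n) wt t l (bk l om) * D (bk l om))).
  apply: ae_eq_Ex.
  - exact: sfunM.
  - by apply: sfunM => //; apply: sfun_sum => l; apply: sfunM; exact: sfun_bkT.
  - by apply: ae_imp (ae_shifts hD) => om h; rewrite -(coharm_paths h).
  - by move=> om; rewrite mulr_ge0.
  - move=> om; rewrite mulr_ge0// sumr_ge0// => l _; rewrite mulr_ge0// wt_ge0//.
by rewrite (Ex_path_indep_back t_meas t_ge0 hP mY mD Y0 D0) ED mule1.
Qed.

End Backward.
End Densities.

(* The harmonic transform of the weights: outside the set where u is harmonic
   it is renormalised, so that it is a probability vector everywhere. *)
Section Kernel.
Variables (R : realType) (d : nat) (t : Env R d -> U d -> R) (u : Env R d -> R).
Hypothesis t_meas : forall z, sfun setT (t^~ z).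
Hypothesis t_gt0 : forall om z, 0 < t om z.
Hypothesis mu : sfun setT u.
Hypothesis u0 : forall om, 0 < u om.
Hypothesis d1 : (0 < d)%N.

Definition hker (om : Omega R d) (z : U d) : R :=
  t om z * u (fstep z om) / \sum_z' t om z' * u (fstep z' om).

Lemma hker_den om : 0 < \sum_z' t om z' * u (fstep z' om).
Proof.
rewrite (bigD1 (Ordinal d1, true))//= ltr_pwDl ?mulr_gt0//.
by apply: sumr_ge0 => z _; rewrite mulr_ge0// ltW.
Qed.

Lemma hker_gt0 om z : 0 < hker om z.
Proof. by rewrite divr_gt0 ?hker_den// mulr_gt0. Qed.

Lemma hker_sum om : \sum_z hker om z = 1.
Proof. by rewrite -mulr_suml divff// gt_eqF// hker_den. Qed.

Lemma measurable_hker z : measurable_fun setT (hker^~ z).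
Proof.
have m z' : sfun setT (fun om => t om z' * u (fstep z' om)).
  by apply: sfunM => //; apply: sfun_shift mu.
apply: measurable_funM; first exact: sfun_measurable (m z).
apply: measurable_inv_pos; first exact: hker_den.
exact: sfun_measurable (sfun_sum _ m).
Qed.

Lemma hkerE om z : harm t u om -> hker om z = t om z * u (fstep z om) / u om.
Proof. by rewrite /harm /hker => <-. Qed.

(** The ratios of values of [u] telescope along the path. *)
Lemma wt_hker om l : (forall n x, harm t u (shift n x om)) ->
  wt hker l om * u om = wt t l om * u (endp l om).
Proof.
elim: l om => [|z l IHl] om h; first by rewrite endp_nil.
rewrite /= hkerE; last by have := h 0 0; rewrite shift0.
rewrite endp_cons -[RHS]mulrA -IHl; last by move=> n x; rewrite /fstep shift_shift; exact: h.
have := u0 om; move=> /lt0r_neq0; set a := u _; set b := u _ => n0.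
by field.
Qed.

End Kernel.

(** * Path sums in the defining identity *)

Section StepLists.
Variables (R : realType) (d : nat).

Lemma mem_paths n (l : seq (U d)) : (l \in paths d n) = (size l == n).
Proof.
apply/idP/eqP => [/size_paths//|]; elim: n l => [|n IHn] [|z l]//= [ln].
by apply/allpairsP; exists (z, l); split => //=; [rewrite mem_index_enum|exact: IHn].
Qed.

Lemma uniq_paths n : uniq (paths d n).
Proof.
elim: n => //= n IHn; apply: allpairs_uniq => //; first exact: index_enum_uniq.
by move=> [z l] [z' l'] _ _ /= [-> ->].
Qed.

Definition steps_of L (zs : {ffun 'I_L -> U d}) : seq (U d) := [seq zs i | i <- enum 'I_L].

Lemma size_steps_of L (zs : {ffun 'I_L -> U d}) : size (steps_of zs) = L.
Proof. by rewrite size_map size_enum_ord. Qed.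

Lemma nth_steps_of L (zs : {ffun 'I_L -> U d}) z0 (i : 'I_L) : nth z0 (steps_of zs) i = zs i.
Proof. by rewrite (nth_map i) ?size_enum_ord// nth_ord_enum. Qed.

Lemma sum_paths_ffun (V : nmodType) L (F : seq (U d) -> V) :
  \sum_(l <- paths d L) F l = \sum_(zs : {ffun 'I_L -> U d}) F (steps_of zs).
Proof.
rewrite -(big_map (@steps_of L) xpredT F).
apply: perm_big; apply: uniq_perm; first exact: uniq_paths.
  rewrite map_inj_uniq ?index_enum_uniq// => zs zs' e; apply/ffunP => i.
  by rewrite -(nth_steps_of zs (zs i)) e nth_steps_of.
move=> l; rewrite mem_paths; apply/eqP/mapP => [lL|[zs _ ->]]; last exact: size_steps_of.
case: L lL => [|L] lL.
  by move/size0nil: lL => ->; exists [ffun i : 'I_0 => match notF (valP i) with end];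
    rewrite ?mem_index_enum//; apply/esym/size0nil; rewrite size_steps_of.
case: l lL => // z l lL; exists [ffun i : 'I_L.+1 => nth z (z :: l) i].
  by rewrite mem_index_enum.
apply: (@eq_from_nth _ z); first by rewrite size_steps_of.
by move=> i; rewrite lL => iL; rewrite (nth_steps_of _ z (Ordinal iL)) ffunE.
Qed.

Lemma disp_take z0 (l : seq (U d)) n k : size l = n ->
  \sum_(i < n | (i < k)%N) uvec (nth z0 l i) = disp (take k l).
Proof.
elim: l n k => [|z l IHl] [|n] k //= => [_|[ln]]; first by rewrite big_ord0 /disp big_nil.
rewrite big_mkcond big_ord_recl/=.
case: k => [|k]; first by rewrite big1 ?addr0 /disp ?big_nil.
by rewrite disp_cons -(IHl n)// [in RHS]big_mkcond.
Qed.

Lemma pos_disp L (zs : {ffun 'I_L -> U d}) k : pos zs k = disp (take k (steps_of zs)).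
Proof.
case: L zs => [|L] zs.
  by rewrite /pos big_ord0 (size0nil (size_steps_of zs)) /disp big_nil.
rewrite -(disp_take (zs ord0) k (size_steps_of zs)).
by apply: eq_bigr => i _; rewrite nth_steps_of.
Qed.

Lemma zRD (x y : Zd d) : zR (x + y) = zR x + zR y :> 'rV[R]_d.
Proof. by apply/rowP => i; rewrite !mxE rmorphD. Qed.

Lemma ipDr (th x y : 'rV[R]_d) : ip th (x + y) = ip th x + ip th y.
Proof. by rewrite /ip -big_split; apply: eq_bigr => i _; rewrite mxE mulrDr. Qed.

Lemma ip_disp (th : 'rV[R]_d) l : ip th (zR (disp l)) = \sum_(z <- l) ip th (zR (uvec z)).
Proof.
elim: l => [|z l IHl].
  by rewrite big_nil /disp big_nil /ip big1// => i _; rewrite !mxE mulr0.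
by rewrite disp_cons zRD ipDr IHl big_cons.
Qed.

Lemma wt_prod (t : Env R d -> U d -> R) z0 l om n : size l = n ->
  wt t l om = \prod_(i < n) t (endp (take i l) om) (nth z0 l i).
Proof.
elim: l n om => [|z l IHl] [|n] om //= => [_|[ln]]; first by rewrite big_ord0.
rewrite big_ord_recl /= endp_nil (IHl n)//; congr (_ * _).
by apply: eq_bigr => i _; rewrite /bump/= endp_cons.
Qed.

Variables (P : probability (Omega R d) R) (th : 'rV[R]_d).

Lemma weight_tilt L (om : Omega R d) (zs : {ffun 'I_L -> U d}) :
  weight om zs * expR (ip th (zR (pos zs L)) - L%:R * Lambda_c P th) =
  wt (tilt P th) (steps_of zs) om.
Proof.
case: L zs => [|L] zs.
  rewrite /weight /pos !big_ord0 (size0nil (size_steps_of zs)) mul1r mul0r subr0.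
  by have := ip_disp th [::]; rewrite /disp !big_nil => ->; rewrite expR0.
rewrite (wt_prod _ (zs ord0) om (size_steps_of zs)) pos_disp take_oversize ?size_steps_of//.
rewrite ip_disp /steps_of big_map big_enum /=.
rewrite (_ : L.+1%:R * _ = \sum_(i < L.+1) Lambda_c P th); last first.
  by rewrite sumr_const card_ord mulr_natl.
rewrite -sumrB expR_sum -big_split; apply: eq_bigr => i _ /=.
rewrite -/(steps_of zs) nth_steps_of pos_disp /tilt /endp /shift add0r size_take size_steps_of ltn_ord.
by rewrite add0r.
Qed.

End StepLists.

Section PathLaw.
Variables (R : realType) (d : nat) (P : probability (Omega R d) R) (c1 : R).
Hypothesis hP : env_assumptions P c1.
Variables (th : 'rV[R]_d) (t : Env R d -> U d -> R).
Hypothesis t_meas : forall z, sfun [set (0, 0)] (t^~ z).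
Hypothesis t_gt0 : forall om z, 0 < t om z.
Hypothesis t_tilt : {ae P, forall om, forall n x z, t (shift n x om) z = tilt P th (shift n x om) z}.
Local Notation site := (int * Zd d)%type.
Let t_ge0 om z : 0 <= t om z. Proof. exact: ltW. Qed.

Lemma eq_wt (t1 t2 : Env R d -> U d -> R) l om :
  (forall n x z, t1 (shift n x om) z = t2 (shift n x om) z) -> wt t1 l om = wt t2 l om.
Proof.
elim: l om => //= z l IHl om h; congr (_ * _); first by have := h 0 0 z; rewrite shift0.
by apply: IHl => n x z'; rewrite /fstep shift_shift.
Qed.

Lemma ext_eq N L (zs : {ffun 'I_L.+1 -> U d}) i : (N + i < L.+1)%N ->
  ext (drop N (steps_of zs)) i = uvec (zs (inord (N + i))).
Proof.
move=> h; rewrite /ext /seq_of -map_drop -map_comp.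
rewrite (nth_map ord0) ?size_drop ?size_enum_ord ?ltn_subRL//=.
by rewrite nth_drop; congr (uvec (zs _)); apply: val_inj; rewrite /= nth_enum_ord// inordK.
Qed.

Lemma sfun_prod (I : set site) (T : Type) (r : seq T) (F : T -> Env R d -> R) :
  (forall i, sfun I (F i)) -> sfun I (fun om => \prod_(i <- r) F i om).
Proof.
move=> mF; elim: r => [|i r IHr].
  rewrite (_ : (fun om => _) = fun=> 1); first exact: sfun_cst.
  by apply/funext => om; rewrite big_nil.
rewrite (_ : (fun om => _) = fun om => F i om * \prod_(j <- r) F j om); first exact: sfunM.
by apply/funext => om; rewrite big_cons.
Qed.

(** Passes from step functions to lists and from [tilt] to its positive version. The default value 0
    of the step sequence is never read, because [f] looks at [K] steps only. *)
Lemma mubar_rhs_paths N M K (f : Omega R d * Zseq d -> R) :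
  (forall om s s', (forall i, (i < K)%N -> s i = s' i) -> f (om, s) = f (om, s')) ->
  (forall s, sfun setT (fun om => f (om, s))) ->
  mubar_rhs P th N M K f = Ex P (fun om => \sum_(l <- paths d (N + M + K).+1)
    wt t l om * f (endp (take N l) om, ext (drop N l))).
Proof.
move=> fK mf; rewrite /mubar_rhs /Ex; set L := (N + M + K)%N.
apply: ae_eq_integral => //.
- apply/measurable_EFinP; apply: (@sfun_measurable _ _ setT); apply: sfun_sum => zs.
  apply: sfunM; last by apply: (sfun_shift _ (mf _)).
  apply: sfunM; last exact: sfun_cst.
  by apply: sfun_prod => i; exact: sfun_coord.
- apply/measurable_EFinP; apply: (@sfun_measurable _ _ setT); apply: sfun_sum => l.
  apply: sfunM; last by apply: (sfun_shift _ (mf _)).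
  by apply: (sfun_sub _ (@sfun_wt _ _ _ t_meas l)).
apply: ae_imp t_tilt => om h _; congr EFin.
rewrite [RHS]sum_paths_ffun; apply: eq_bigr => zs _.
rewrite weight_tilt -(eq_wt (t1 := t)) //; congr (_ * _).
rewrite /endp -pos_disp size_takel ?size_steps_of; last by rewrite /L; lia.
apply: fK => i iK; rewrite ext_eq; last by rewrite /L; lia.
by rewrite ifT//; rewrite /L; lia.
Qed.

End PathLaw.

Lemma integral_diff d (T : measurableType d) (R : realType) (mu : {measure set T -> \bar R})
    (f g : T -> R) : measurable_fun setT f -> measurable_fun setT g ->
  (forall x, 0 <= f x) -> (forall x, 0 <= g x) ->
  (\int[mu]_x (f x)%:E < +oo)%E -> (\int[mu]_x (g x)%:E < +oo)%E ->
  (\int[mu]_x (f x - g x)%:E = \int[mu]_x (f x)%:E - \int[mu]_x (g x)%:E)%E.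
Proof.
move=> mf mg f0 g0 fi gi.
have int (h : T -> R) : measurable_fun setT h -> (forall x, 0 <= h x) ->
    (\int[mu]_x (h x)%:E < +oo)%E -> mu.-integrable setT (EFin \o h).
  move=> mh h0 hi; apply/integrableP; split; first by apply/measurable_EFinP.
  by under eq_integral => x _ do rewrite /= ger0_norm//.
rewrite -integralB_EFin//; try exact: int.
Qed.

Lemma measurable_sfunT (R : realType) d (f : Env R d -> R) :
  measurable_fun (setT : set (Omega R d)) f -> sfun setT f.
Proof. by move=> mf _ B mB; have := mf measurableT B mB; rewrite !setTI measurable_sgenT. Qed.

Section StationaryLaw.
Variables (R : realType) (d : nat) (P : probability (Omega R d) R) (c1 : R).
Hypothesis hP : env_assumptions P c1.
Variable t : Env R d -> U d -> R.
Hypothesis t_meas : forall z, sfun [set (0, 0)] (t^~ z).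
Hypothesis t_gt0 : forall om z, 0 < t om z.
Local Notation site := (int * Zd d)%type.
Variables (u D : Env R d -> R).
Hypothesis mu : sfun [set s : site | 0 <= s.1] u.
Hypothesis u0 : forall om, 0 < u om.
Hypothesis Eu : Ex P u = 1%E.
Hypothesis hu : {ae P, forall om, harm t u om}.
Hypothesis mD : sfun [set s : site | s.1 < 0] D.
Hypothesis D0 : forall om, 0 <= D om.
Hypothesis ED : Ex P D = 1%E.
Hypothesis hD : {ae P, forall om, coharm t D om}.

Let t_ge0 om z : 0 <= t om z. Proof. exact: ltW. Qed.
Let u_ge0 om : 0 <= u om. Proof. exact: ltW. Qed.
Let w0 l om : 0 <= wt t l om. Proof. exact: wt_ge0. Qed.
Let mw l : sfun setT (wt t l).
Proof. by apply: (sfun_sub _ (@sfun_wt _ _ _ t_meas l)). Qed.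
Let muT : sfun setT u. Proof. by apply: (sfun_sub _ mu). Qed.
Let mDT : sfun setT D. Proof. by apply: (sfun_sub _ mD). Qed.

(** By [wt_hker] this is almost surely [u] times the weight of [l] under the transformed kernel. *)
Definition uwt l om := wt t l om * u (endp l om).

Lemma uwt_ge0 l om : 0 <= uwt l om. Proof. exact: mulr_ge0. Qed.
Lemma sfun_uwt l : sfun [set s : site | 0 <= s.1] (uwt l).
Proof.
apply: sfunM.
  by apply: (sfun_sub _ (@sfun_wt _ _ _ t_meas l)) => s /andP[].
by apply: (sfun_sub _ (@sfun_endp _ _ l _ mu)) => s /=; lia.
Qed.
Lemma sfun_uwtT l : sfun setT (uwt l).
Proof. by apply: (sfun_sub _ (sfun_uwt l)). Qed.

(** Seen from the end of [l], all other factors read layers up to [M] at most, so [fwd t M.+1] may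
    be replaced by [u]; what remains besides [bwd t N] then reads layers from [- N] on, so [bwd t N]
    may be replaced by [D]. *)
Lemma Ex_window N M l (g : Env R d -> R) :
  sfun [set s : site | - N%:Z <= s.1] g -> sfun [set s : site | s.1 <= M%:Z] g ->
  (forall om, 0 <= g om) ->
  Ex P (fun om => bwd t N om * (wt t l om * g om * fwd t M.+1 (endp l om))) =
  Ex P (fun om => D om * (uwt l om * g om)).
Proof.
move=> mg1 mg2 g0.
have mgT : sfun setT g by apply: (sfun_sub _ mg1).
have mb : sfun (lay (- N%:Z) 0) (bwd t N) by exact: sfun_bwd.
have mbT : sfun setT (bwd t N) by apply: (sfun_sub _ mb).
have b0 := bwd_ge0 t_ge0.
have f0 := fwd_ge0 t_ge0.
have mfT n : sfun setT (fwd t n) by apply: (sfun_sub _ (@sfun_fwd _ _ _ t_meas n)).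
pose Y om := bwd t N om * (wt t l om * g om).
have mYT : sfun setT Y by apply: sfunM => //; exact: sfunM.
have Y0 om : 0 <= Y om by rewrite !mulr_ge0.
have moved (v : Env R d -> R) : sfun setT v -> (forall om, 0 <= v om) ->
    Ex P (fun om => Y om * v (endp l om)) = Ex P (fun om => Y (bk l om) * v om).
  move=> mv v0; rewrite -(Ex_shift hP (- (size l)%:Z) (- disp l)).
  - by apply: eq_Ex => om; rewrite -/(bk l om) endp_bk.
  - by apply: sfunM => //; exact: sfun_endpT.
  - by move=> om; rewrite mulr_ge0.
transitivity (Ex P (fun om => Y om * u (endp l om))).
  transitivity (Ex P (fun om => Y om * fwd t M.+1 (endp l om))).
    by apply: eq_Ex => om; rewrite /Y -!mulrA.
  rewrite !moved//; apply/esym.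
  apply: (Ex_fwd_density hP t_meas t_ge0 mu u_ge0 Eu hu) => [|om //].
  apply: (@sfun_shift _ _ [set s : site | s.1 <= (M + size l)%:Z]) => [s /=|]; first lia.
  apply: sfunM; first by apply: (sfun_sub _ mb) => s; rewrite /lay/=; lia.
  apply: sfunM; last by apply: (sfun_sub _ mg2) => s /=; lia.
  by apply: (sfun_sub _ (@sfun_wt _ _ _ t_meas l)) => s; rewrite /lay/=; lia.
transitivity (Ex P (fun om => (uwt l om * g om) * bwd t N om)).
  by apply: eq_Ex => om; rewrite /Y /uwt; ring.
rewrite -(Ex_bwd_density hP t_meas t_ge0 mD D0 ED hD).
- by apply: eq_Ex => om; rewrite mulrC.
- apply: sfunM => //; by apply: (sfun_sub _ (sfun_uwt l)) => s /=; lia.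
- by move=> om; rewrite mulr_ge0 ?uwt_ge0.
Qed.

(** A path is cut into [N] steps before the observed time, the [K] steps that [f] sees, and [M.+1]
    further ones. Re-rooting at the observed time turns the first piece into [bwd t N]; the last
    piece sums to [fwd t M.+1]. *)
Lemma Ex_paths_window N M K (f : Omega R d * Zseq d -> R) :
  (forall p, 0 <= f p) ->
  (forall om s s', (forall i, (i < K)%N -> s i = s' i) -> f (om, s) = f (om, s')) ->
  (forall s, sfun [set s : site | - N%:Z <= s.1] (fun om => f (om, s))) ->
  (forall s, sfun [set s : site | s.1 <= M%:Z] (fun om => f (om, s))) ->
  Ex P (fun om => \sum_(l <- paths d (N + M + K).+1)
    wt t l om * f (endp (take N l) om, ext (drop N l))) =
  Ex P (fun om => D om * \sum_(l <- paths d K) uwt l om * f (om, ext l)).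
Proof.
move=> f0 fK mf1 mf2.
have mfT s : sfun setT (fun om => f (om, s)) by apply: (sfun_sub _ (mf1 s)).
pose H om := \sum_(l <- paths d K) wt t l om * f (om, ext l) * fwd t M.+1 (endp l om).
have ff0 := fwd_ge0 t_ge0; have b0 := bwd_ge0 t_ge0.
have mfw n : sfun setT (fwd t n) by apply: (sfun_sub _ (@sfun_fwd _ _ _ t_meas n)).
have mbT : sfun setT (bwd t N) by apply: (sfun_sub _ (@sfun_bwd _ _ _ t_meas N)).
have mterm l : sfun setT (fun om => wt t l om * f (om, ext l) * fwd t M.+1 (endp l om)).
  by apply: sfunM; [exact: sfunM|exact: sfun_endpT].
have mH : sfun setT H by exact: sfun_sum.
have H0 om : 0 <= H om by apply: sumr_ge0 => l _; rewrite !mulr_ge0.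
transitivity (Ex P (fun om => \sum_(l <- paths d N) wt t l om * H (endp l om))).
  apply: eq_Ex => om; rewrite (_ : (N + M + K).+1 = (N + (K + M.+1))%N); last by lia.
  rewrite sum_paths_cat big_seq [RHS]big_seq; apply: eq_bigr => l1 /size_paths h1.
  rewrite sum_paths_cat /H mulr_sumr big_seq [RHS]big_seq.
  apply: eq_bigr => l2 /size_paths h2.
  rewrite fwd_paths !mulr_sumr; apply: eq_bigr => l3 _.
  rewrite take_size_cat// drop_size_cat// !wt_cat.
  rewrite (fK _ (ext (l2 ++ l3)) (ext l2)); last first.
    by move=> i iK; rewrite /ext /seq_of map_cat nth_cat size_map h2 iK.
  by rewrite !mulrA mulrAC.
transitivity (Ex P (fun om => bwd t N om * H om)).
  rewrite Ex_sum; last 2 first.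
  - by move=> l; apply: sfunM => //; exact: sfun_endpT.
  - by move=> l om; rewrite mulr_ge0.
  transitivity (\sum_(l <- paths d N) Ex P (fun om => wt t l (bk l om) * H om)%R)%E.
    apply: eq_bigr => l _; rewrite -(Ex_shift hP (- (size l)%:Z) (- disp l)).
    - by apply: eq_Ex => om; rewrite -/(bk l om) endp_bk.
    - by apply: sfunM => //; exact: sfun_endpT.
    - by move=> om; rewrite mulr_ge0.
  rewrite -Ex_sum; last 2 first.
  - by move=> l; apply: sfunM => //; exact: sfun_bkT.
  - by move=> l om; rewrite mulr_ge0.
  by apply: eq_Ex => om; rewrite bwd_paths mulr_suml.
transitivity (\sum_(l <- paths d K) Ex P (fun om => D om * (uwt l om * f (om, ext l)))%R)%E.
  under eq_bigr => l _ do rewrite -(@Ex_window N M l _ (mf1 _) (mf2 _))//.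
  rewrite -Ex_sum; last 2 first.
  - by move=> l; apply: sfunM.
  - by move=> l om; rewrite !mulr_ge0.
  by apply: eq_Ex => om; rewrite mulr_sumr.
rewrite -Ex_sum; last 2 first.
- by move=> l; apply: sfunM => //; apply: sfunM => //; exact: sfun_uwtT.
- by move=> l om; rewrite !mulr_ge0 ?uwt_ge0.
by apply: eq_Ex => om; rewrite mulr_sumr.
Qed.

(** The initial density is [D] times [u], with [u] carried along in [uwt]. Unlike [is_mubar], this
    admits every nonnegative measurable [f], with no time window. *)
Definition path_law (mb : probability (Omega R d * Zseq d)%type R) :=
  forall (K : nat) (f : Omega R d * Zseq d -> R), (forall p, 0 <= f p) ->
    (forall om s s', (forall i, (i < K)%N -> s i = s' i) -> f (om, s) = f (om, s')) ->
    (forall s, sfun setT (fun om => f (om, s))) ->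
    (\int[mb]_p (f p)%:E =
     Ex P (fun om => D om * \sum_(l <- paths d K) uwt l om * f (om, ext l))%R)%E.

Lemma Ex_fwd1 n : Ex P (fwd t n) = 1%E.
Proof.
rewrite -Eu; transitivity (Ex P (fun om => 1 * fwd t n om)).
  by apply: eq_Ex => om; rewrite mul1r.
rewrite -(Ex_fwd_density hP t_meas t_ge0 mu u_ge0 Eu hu)//; last exact: sfun_cst.
by apply: eq_Ex => om; rewrite mul1r.
Qed.

Lemma path_law_mubar mb th :
  {ae P, forall om, forall n x z, t (shift n x om) z = tilt P th (shift n x om) z} ->
  path_law mb -> is_mubar P th mb.
Proof.
move=> t_tilt pl N M K f [C fC] fK mf.
have mf1 s : sfun [set s : site | - N%:Z <= s.1] (fun om => f (om, s)).
  by apply/measurable_wrt_BplusP; exact: (mf s).1.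
have mf2 s : sfun [set s : site | s.1 <= M%:Z] (fun om => f (om, s)).
  by apply/measurable_wrt_BminusP; exact: (mf s).2.
have mfT s : sfun setT (fun om => f (om, s)) by apply: (sfun_sub _ (mf1 s)).
rewrite (mubar_rhs_paths (t := t) _ t_tilt N M fK mfT)//.
(* The defining identity tests bounded signed functions; adding the bound makes them nonnegative. *)
pose g p := f p + C.
have g0 p : 0 <= g p by have := fC p; rewrite ler_norml => /andP[h _]; rewrite /g -lerBlDr sub0r.
have C0 : 0 <= C by apply: le_trans (fC (point, point)).
have gC p : g p <= C + C by have := fC p; rewrite ler_norml => /andP[_ h]; rewrite lerD2r.
have mI s I : sfun I (fun om => f (om, s)) -> sfun I (fun om => g (om, s)).
  by move=> h; apply: sfunD => //; exact: sfun_cst.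
have gK om s s' : (forall i, (i < K)%N -> s i = s' i) -> g (om, s) = g (om, s').
  by move=> h; rewrite /g (fK om s s').
have mgT : measurable_fun setT g.
  by apply: measurable_section gK _ => s; apply: sfun_measurable (mI s setT _).
have fin (m : R) : (m%:E < +oo)%E by exact: ltry.
transitivity (\int[mb]_p (g p)%:E - C%:E)%E.
  have eC : (\int[mb]_p C%:E = C%:E)%E.
    by rewrite integral_cst//= [X in (_ * X)%E]probability_setT mule1.
  rewrite -eC -integral_diff ?eC//.
  - by apply: eq_integral => p _; rewrite /g addrK.
  - apply: le_lt_trans (ltry (C + C)).
    have <- : (\int[mb]_p (C + C)%:E = (C + C)%:E)%E.
      by rewrite integral_cst//= [X in (_ * X)%E]probability_setT mule1.
    apply: ge0_le_integral => //.
    + by move=> p _; rewrite lee_fin.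
    + exact/measurable_EFinP.
    + by move=> p _; rewrite lee_fin.
rewrite (pl K g g0 gK) => [|s]; last exact: mI.
rewrite -(Ex_paths_window g0 gK (fun s => mI s _ (mf1 s)) (fun s => mI s _ (mf2 s))).
set L := (N + M + K).+1.
pose F om := \sum_(l <- paths d L) wt t l om * g (endp (take N l) om, ext (drop N l)).
have mF : sfun setT F.
  by apply: sfun_sum => l; apply: sfunM => //; apply: (sfun_endpT _ (mI _ _ (mfT _))).
have F0 om : 0 <= F om by apply: sumr_ge0 => l _; rewrite mulr_ge0.
have mfw n : sfun setT (fwd t n) by apply: (sfun_sub _ (@sfun_fwd _ _ _ t_meas n)).
have ff0 := fwd_ge0 t_ge0.
have mCf c : sfun setT (fun om => c * fwd t L om) by apply: sfunM => //; exact: sfun_cst.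
have EC c : 0 <= c -> Ex P (fun om => c * fwd t L om) = c%:E.
  by move=> c0; rewrite Ex_Zl// Ex_fwd1 mule1.
(* The added constant is worth [C] on this side as well, since it comes multiplied by [fwd t L],
   which has mean one. *)
rewrite -{1}(EC C)// -integral_diff.
- apply: eq_integral => om _; congr EFin; rewrite fwd_paths mulr_sumr -sumrB.
  by apply: eq_bigr => l _; rewrite /g; ring.
- exact: sfun_measurable mF.
- exact: sfun_measurable (mCf C).
- exact: F0.
- by move=> om; rewrite mulr_ge0.
- apply: le_lt_trans (ltry (C + C)); rewrite -(EC (C + C)) ?addr_ge0//.
  apply: Ex_le => // om; rewrite fwd_paths mulr_sumr; apply: ler_sum => l _.
  by rewrite mulrC ler_wpM2r.
- by rewrite [X in (X < _)%E]EC.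
Qed.

Lemma Ex_uD : Ex P (fun om => u om * D om) = 1%E.
Proof.
rewrite (@Ex_bwd_density _ _ _ _ hP _ t_meas t_ge0 _ mD D0 ED hD 0)//.
by rewrite -Eu; apply: eq_Ex => om; rewrite /= mulr1.
Qed.

Lemma inv_measure : exists nu : probability (Omega R d) R,
  forall f : Env R d -> R, sfun setT f -> (forall om, 0 <= f om) ->
    (\int[nu]_om (f om)%:E = Ex P (fun om => D om * u om * f om)%R)%E.
Proof.
have muD : sfun setT (fun om => u om * D om) by exact: sfunM.
have [nu hnu] := density_probability (sfun_measurable muD)
  (fun om => mulr_ge0 (u_ge0 om) (D0 om)) Ex_uD.
exists nu => f mf f0; rewrite hnu//.
- by apply: eq_integral => om _; rewrite -EFinM; congr EFin; ring.
- by apply/measurable_EFinP; exact: sfun_measurable mf.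
Qed.

(** The chain with kernel [hker] is started from the density [D * u]; the factor [u] absorbs the
    normalisation of the kernel by [wt_hker]. *)
Lemma path_law_exists : (0 < d)%N -> exists mb, path_law mb.
Proof.
move=> d1; have [nu hnu] := inv_measure.
have tT z : sfun setT (t^~ z) by apply: (sfun_sub _ (t_meas z)).
have [mb hmb] := path_measure d1 (measurable_hker tT t_gt0 muT u0 d1)
  (hker_gt0 t_gt0 u0 d1) (hker_sum t_gt0 u0 d1) nu.
have kw0 l om : 0 <= wt (hker t u) l om.
  by apply: wt_ge0 => {}om z; exact: ltW (hker_gt0 t_gt0 u0 d1 om z).
have mkw l : sfun setT (wt (hker t u) l).
  elim: l => [|z l IHl]; first exact: sfun_cst.
  apply: sfunM; last by apply: (sfun_shift _ IHl).
  exact: measurable_sfunT (measurable_hker tT t_gt0 muT u0 d1 z).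
exists mb => K f f0 fK mf.
have mS (v : seq (U d) -> Env R d -> R) : (forall l, sfun setT (v l)) ->
    sfun setT (fun om => \sum_(l <- paths d K) v l om * f (om, ext l)).
  by move=> mv; apply: sfun_sum => l; apply: sfunM.
rewrite (hmb K f f0 fK) => [|s]; last exact: sfun_measurable (mf s).
rewrite hnu; last 2 first.
- exact: mS.
- by move=> om; apply: sumr_ge0 => l _; rewrite mulr_ge0.
apply: ae_eq_Ex.
- by apply: sfunM; [exact: sfunM|exact: mS].
- by apply: sfunM => //; apply: mS => l; exact: sfun_uwtT.
- apply: ae_imp (ae_shifts hP hu) => om h; rewrite -mulrA; congr (_ * _).
  rewrite mulr_sumr; apply: eq_bigr => l _.
  by rewrite /uwt -(wt_hker u0 l h); ring.
- by move=> om; rewrite !mulr_ge0// sumr_ge0// => l _; rewrite mulr_ge0.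
- by move=> om; rewrite mulr_ge0// sumr_ge0// => l _; rewrite mulr_ge0// uwt_ge0.
Qed.

End StationaryLaw.

(** * Uniqueness *)

Section MubarUnique.
Variables (R : realType) (d : nat).
Local Notation site := (int * Zd d)%type.

Definition zdet (C : set (Zseq d)) := exists K : nat,
  forall s s' : Zseq d, (forall i, (i < K)%N -> s i = s' i) -> C s -> C s'.

Lemma zdet_measurable C : zdet C -> measurable C.
Proof.
move=> [K hC].
have h : measurable_fun setT (fun p : unit * Zseq d => `[< C p.2 >]).
  apply: (@measurable_section _ _ _ _ _ K) => [x s s' e|s].
  2: by exact: (measurable_cst (`[< C s >])).

  by congr asbool; apply/propext; split; apply: hC => // i /e.
have := (measurableT_comp h (pair1_measurable tt)) measurableT [set true] I.
by rewrite setTI; congr measurable; apply/seteqP; split=> s /asboolP.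
Qed.

Lemma zdetI : setI_closed zdet.
Proof.
move=> A B [K hA] [K' hB]; exists (maxn K K') => s s' e [As Bs].
by split; [apply: hA As|apply: hB Bs] => i iK; apply: e; rewrite leq_max iK ?orbT.
Qed.

Definition window_rect : set (set (Omega R d * Zseq d)) :=
  [set X | exists (A : set (Omega R d)) (C : set (Zseq d)), [/\ hor setT A, zdet C & X = A `*` C]].

Lemma window_rect_sgen (X : set (Omega R d * Zseq d)) :
  measurable X -> <<s window_rect >> X.
Proof.
move=> mX; pose T0 := g_sigma_algebraType window_rect.
have m1 : measurable_fun setT (fun p : T0 => (p : Omega R d * Zseq d).1).
  apply: (@measurability _ _ T0 (Omega R d) setT _ (@hor R d setT)).
    apply/seteqP; split => A; last by rewrite hor_sgen -measurable_sgenT.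
    by rewrite measurable_sgenT -hor_sgen.
  move=> _ [A hA <-]; rewrite setTI; apply: sub_sigma_algebra.
  by exists A, setT; split => //; [exists 0%N|apply/seteqP; split=> [[om s]|[om s] []]].
have m2 : measurable_fun setT (fun p : T0 => (p : Omega R d * Zseq d).2).
  apply: (@measurability _ _ T0 (Zseq d) setT _ (@zgen d) erefl).
  move=> _ [_ [i [y ->]] <-]; rewrite setTI; apply: sub_sigma_algebra.
  exists setT, [set s | s i = y]; split => //; first exact: horT.
    by exists i.+1 => s s' e /= <-; rewrite e.
  by apply/seteqP; split=> [[om s]|[om s] []].
have m12 : measurable_fun setT (fun p : T0 => (p.1, p.2) : Omega R d * Zseq d).
  exact/measurable_fun_pair.
by have := m12 measurableT X mX; rewrite setTI; congr (<<s _ >> _); apply/seteqP; split=> [[]|[]].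
Qed.

(** Rectangles of a bounded-horizon event and an event on finitely many steps are
    intersection-stable and generating, and the identity prescribes their probabilities. *)
Lemma mubar_unique (P : probability (Omega R d) R) th
    (m1 m2 : probability (Omega R d * Zseq d)%type R) :
  is_mubar P th m1 -> is_mubar P th m2 -> forall X, measurable X -> m1 X = m2 X.
Proof.
move=> h1 h2 X mX.
apply: (@pi_system_unique _ _ _ window_rect) => //.
- move=> _ [A [C [hA hC ->]]]; apply: measurableX.
    exact: sgen_measurable (hor_sub hA).
  exact: zdet_measurable.
- move=> _ _ [A [C [hA hC ->]]] [A' [C' [hA' hC' ->]]].
  exists (A `&` A'), (C `&` C'); split; [exact: hor_setI|exact: zdetI|].
  by apply/seteqP; split=> [[om s] [[? ?] [? ?]]|[om s] [[? ?] [? ?]]].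
- exists setT, setT; split; [exact: horT|by exists 0%N|].
  by apply/seteqP; split=> [[om s]|[om s] []].
- by rewrite [X in (X < _)%E]probability_setT ltry.
- move=> _ [A [C [[n hA] [K hC] ->]]].
  have mAC : measurable (A `*` C).
    by apply: measurableX; [exact: sgen_measurable hA|apply: zdet_measurable; exists K].
  have eI (m : probability (Omega R d * Zseq d)%type R) :
      (m (A `*` C) = \int[m]_p (\1_(A `*` C) p)%:E)%E by rewrite integral_indic// setIT.
  have K_dep om s s' : (forall i, (i < K)%N -> s i = s' i) ->
      \1_(A `*` C) (om, s) = \1_(A `*` C) (om, s') :> R.
    move=> e; rewrite !indicE; congr (_%:R); congr (nat_of_bool _).
    by apply/idP/idP; rewrite !inE => -[/= ? hs]; split => //=; apply: hC hs => i /e.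
  have mf (s : Zseq d) I : [set s | `|s.1| < n%:Z] `<=` I ->
      sfun I (fun om : Env R d => \1_(A `*` C) (om, s) : R).
    move=> nI.
    have hAI : <<s sgen I >> A by apply: sgen_sub hA => x [_ /nI].
    have [Cs|Cs] := pselect (C s).
      rewrite (_ : (fun om => _) = \1_A); first exact: sfun_indic.
      apply/funext => om; rewrite !indicE; congr (_%:R); congr (nat_of_bool _).
      by apply/idP/idP; rewrite !inE => [] h; [case: h|split].
    rewrite (_ : (fun om => _) = fun=> 0); first exact: sfun_cst.
    by apply/funext => om; rewrite indicE memNset// => -[].
  apply: (eq_trans (eI m1)); apply: esym; apply: (eq_trans (eI m2)).
  (* An event within horizon [n] fits the window [N = M = n]. *)
  rewrite (h1 n n K) ?(h2 n n K)//.
  + by exists 1 => p; rewrite indicE; case: (_ \in _); rewrite ?normr1 ?normr0.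
  + move=> s; split; [apply/measurable_wrt_BplusP|apply/measurable_wrt_BminusP]; apply: mf => x /=; lia.
  + by exists 1 => p; rewrite indicE; case: (_ \in _); rewrite ?normr1 ?normr0.
  + move=> s; split; [apply/measurable_wrt_BplusP|apply/measurable_wrt_BminusP]; apply: mf => x /=; lia.
- exact: window_rect_sgen.
Qed.

End MubarUnique.

(** * The environment chain under the path law *)

Section Chain.
Variables (R : realType) (d : nat).
Local Notation site := (int * Zd d)%type.
Implicit Types (k : Omega R d -> U d -> R) (A : nat -> set (Omega R d)) (om : Omega R d).

Lemma eq_chain k1 k2 A j m om : (forall n x z, k1 (shift n x om) z = k2 (shift n x om) z) ->
  chain k1 A j m om = chain k2 A j m om.
Proof.
elim: m j om => //= m IHm j om h; congr (_ * _); apply: eq_bigr => z _.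
have := h 0 0 z; rewrite shift0 => ->; congr (_ * _).
by apply: IHm => n x z'; rewrite shift_shift.
Qed.

Lemma chain_shift k A j m om : chain k A j.+1 m om = chain k (fun i => A i.+1) j m om.
Proof.
elim: m j om => //= m IHm j om; congr (_ * _); apply: eq_bigr => z _; congr (_ * _).
exact: IHm.
Qed.

Lemma chain_ge0 k A j m om : (forall om z, 0 <= k om z) -> 0 <= chain k A j m om.
Proof.
move=> k0; elim: m j om => [|m IHm] j om /=; first by rewrite indicE ler0n.
by rewrite mulr_ge0 ?sumr_ge0 ?indicE ?ler0n// => z _; rewrite mulr_ge0.
Qed.

Lemma sfun_chain k A j m : (forall i, measurable (A i)) -> (forall z, sfun setT (k^~ z)) ->
  sfun setT (chain k A j m).
Proof.
move=> mA mk; have mI i : sfun setT (\1_(A i) : Env R d -> R).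
  by apply: sfun_indic; rewrite -measurable_sgenT.
elim: m j => [|m IHm] j; first exact: mI.
apply: sfunM; first exact: mI.
by apply: sfun_sum => z; apply: sfunM => //; apply: (sfun_shift _ (IHm _)).
Qed.

Fixpoint pind A (j : nat) (l : seq (U d)) om : R :=
  if l is z :: l' then \1_(A j) om * pind A j.+1 l' (fstep z om) else \1_(A j) om.

Lemma env_path0 (p : Omega R d * Zseq d) : env_path p 0 = p.1.
Proof. by rewrite /env_path big_ord0 shift0. Qed.

Lemma env_path_scons om y (s : Zseq d) i :
  env_path (om, scons y s) i.+1 = env_path (shift 1 y om, s) i.
Proof.
rewrite /env_path /= big_ord_recl shift_shift -PoszD addn1; congr (shift _ _ om).
by rewrite addrC.
Qed.

Lemma pindE A j l om (X := [set w : nat -> Omega R d |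
    forall i, (i <= size l)%N -> A (j + i)%N (w i)]) :
  \1_(@env_path R d @^-1` X) (om, ext l) = pind A j l om.
Proof.
elim: l j om @X => [|z l IHl] j om /=.
  rewrite !indicE; congr (_%:R); congr nat_of_bool.
  apply/idP/idP; rewrite !inE /=; last by move=> h [] // _; rewrite env_path0 addn0.
  by move=> /(_ 0%N isT); rewrite env_path0 addn0.
rewrite -IHl ext_cons !indicE -natrM mulnb; congr (_%:R); congr nat_of_bool.
apply/idP/andP => [|[]]; rewrite !inE /=.
  move=> h; split; first by have := h 0%N isT; rewrite env_path0 addn0.
  by move=> i il /=; rewrite -env_path_scons addSnnS; exact: h.
move=> h0 h [|i] il; first by rewrite env_path0 addn0.
by rewrite env_path_scons -addSnnS; exact: h.
Qed.

Lemma measurable_env_path : measurable_fun setT (@env_path R d : _ -> OmegaN R d).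
Proof.
apply: (@measurability _ _ _ (OmegaN R d) setT _ (@seqgen R d) erefl).
move=> _ [_ [i [A [mA ->]]] <-].
have h : measurable_fun setT (fun p : Omega R d * Zseq d => env_path p i : Omega R d).
  apply: (@measurable_section _ _ _ _ _ i) => [om s s' e|s]; last exact: (@measurable_shift R d i%:Z (\sum_(j < i) s j)).
  by rewrite /env_path /=; congr (shift i%:Z _ om); apply: eq_bigr => j _; apply: e.
exact: (h measurableT A mA).
Qed.

Definition seqcyl : set (set (OmegaN R d)) :=
  [set X | exists n A, (forall i, measurable (A i)) /\
    X = [set w | forall i, (i <= n)%N -> A i (w i)]].

Lemma seqcyl_measurable : seqcyl `<=` (measurable : set (set (OmegaN R d))).
Proof.
move=> _ [n [A [mA ->]]].
rewrite (_ : [set w | _] = \bigcap_(i in `I_n.+1) [set w : OmegaN R d | A i (w i)]).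
  by apply: bigcap_measurableType => i _; apply: sub_sigma_algebra; exists i, (A i).
by apply/seteqP; split.
Qed.

Lemma seqcylI : setI_closed seqcyl.
Proof.
move=> _ _ [n [A [mA ->]]] [n' [A' [mA' ->]]].
exists (maxn n n'), (fun i => (if (i <= n)%N then A i else setT) `&`
                             (if (i <= n')%N then A' i else setT)); split.
  by move=> i; apply: measurableI; case: ifP.
apply/seteqP; split=> [w [h h'] i _|w h].
  by split; case: ifPn => // /[dup]; [move=> /h|move=> /h'].
split=> i il; have [] := h i; rewrite ?leq_max ?il ?orbT//.
Qed.

Lemma seqcylT : seqcyl setT.
Proof. by exists 0%N, (fun=> setT); split => //; apply/seteqP; split. Qed.

Lemma seqcyl_gen : <<s seqcyl >> = (measurable : set (set (OmegaN R d))).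
Proof.
apply/seteqP; split.
  by apply: smallest_sub; [exact: smallest_sigma_algebra|exact: seqcyl_measurable].
apply: smallest_sub; first exact: smallest_sigma_algebra.
move=> _ [i [A [mA ->]]]; apply: sub_sigma_algebra.
exists i, (fun j => if j == i then A else setT); split.
  by move=> j; case: ifP.
apply/seteqP; split=> w /= h; last by have := h i (leqnn i); rewrite eqxx.
by move=> j _; case: ifPn => // /eqP ->.
Qed.

Lemma seqcyl_unique (m1 m2 : {measure set (OmegaN R d) -> \bar R}) :
  (m1 setT < +oo)%E -> (forall X, seqcyl X -> m1 X = m2 X) ->
  forall X, measurable X -> m1 X = m2 X.
Proof.
move=> m1T h X mX; apply: (@pi_system_unique _ _ _ seqcyl) => //.
- exact: seqcyl_measurable.
- exact: seqcylI.
- exact: seqcylT.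
- by rewrite seqcyl_gen.
Qed.

End Chain.

Section StationaryMarkov.
Variables (R : realType) (d : nat) (P : probability (Omega R d) R) (c1 : R).
Hypothesis hP : env_assumptions P c1.
Variables (th : 'rV[R]_d) (t : Env R d -> U d -> R).
Hypothesis t_meas : forall z, sfun [set (0, 0)] (t^~ z).
Hypothesis t_gt0 : forall om z, 0 < t om z.
Hypothesis t_tilt : {ae P, forall om, forall n x z, t (shift n x om) z = tilt P th (shift n x om) z}.
Local Notation site := (int * Zd d)%type.
Variables (u D : Env R d -> R).
Hypothesis d1 : (0 < d)%N.
Hypothesis mu : sfun [set s : site | 0 <= s.1] u.
Hypothesis u0 : forall om, 0 < u om.
Hypothesis hu : {ae P, forall om, harm t u om}.
Hypothesis mD : sfun [set s : site | s.1 < 0] D.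
Hypothesis D0 : forall om, 0 <= D om.
Hypothesis hD : {ae P, forall om, coharm t D om}.

Let t_ge0 om z : 0 <= t om z. Proof. exact: ltW. Qed.
Let u_ge0 om : 0 <= u om. Proof. exact: ltW. Qed.
Let w0 l om : 0 <= wt t l om. Proof. exact: wt_ge0. Qed.
Let tT z : sfun setT (t^~ z). Proof. by apply: (sfun_sub _ (t_meas z)). Qed.
Let muT : sfun setT u. Proof. by apply: (sfun_sub _ mu). Qed.
Let mDT : sfun setT D. Proof. by apply: (sfun_sub _ mD). Qed.
Local Notation hk := (hker t u).
Let hk0 om z : 0 <= hk om z. Proof. exact: ltW (hker_gt0 t_gt0 u0 d1 om z). Qed.
Let mhk z : sfun setT (hk^~ z).
Proof. exact: measurable_sfunT (measurable_hker tT t_gt0 muT u0 d1 z). Qed.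

(** Here [pibar_theta] coincides with [hker]; asking it of all translates makes the set stable along
    the chain. *)
Definition regular (om : Omega R d) := forall n x, harm t u (shift n x om) /\
  forall z, t (shift n x om) z = tilt P th (shift n x om) z.

Lemma regular_shift n x om : regular om -> regular (shift n x om).
Proof. by move=> h m y; rewrite shift_shift; exact: h. Qed.

Lemma ae_regular : {ae P, forall om, regular om}.
Proof.
by apply: ae_imp2 t_tilt (ae_shifts hP hu) => om h1 h2 n x; split => // z; exact: h1.
Qed.

Lemma pibar_hker om z : regular om -> pibar_theta P th u om z = hk om z.
Proof.
move=> h; have := h 0 0; rewrite shift0 => -[h1 h2].
rewrite (hkerE _ h1) /pibar_theta h2 /tilt; rewrite /fstep; ring.
Qed.

Lemma chain_pibar A j m om : regular om ->
  chain (pibar_theta P th u) A j m om = chain hk A j m om.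
Proof. by move=> h; apply: eq_chain => n x z; apply: pibar_hker; exact: regular_shift. Qed.

Lemma sfun_pibar z : sfun setT ((pibar_theta P th u)^~ z).
Proof.
apply: sfunM; last exact: sfun_cst; apply: sfunM; first exact: sfun_coord.
apply: sfunM; first by apply: (sfun_shift _ muT).
exact: measurable_sfunT (@measurable_inv_pos _ (Omega R d) R u u0 (sfun_measurable muT)).
Qed.

Lemma u_chainS A j m om : harm t u om ->
  u om * chain hk A j m.+1 om =
  \1_(A j) om * \sum_z t om z * (u (fstep z om) * chain hk A j.+1 m (fstep z om)).
Proof.
move=> h /=; rewrite mulrCA mulr_sumr; congr (_ * _); apply: eq_bigr => z _.
rewrite (hkerE _ h) -/(fstep z om); have := u0 om => /lt0r_neq0 n0.
by field.
Qed.

Lemma sum_uwt_pind A j n om : regular om ->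
  \sum_(l <- paths d n) uwt t u l om * pind A j l om = u om * chain hk A j n om.
Proof.
elim: n j om => [|n IHn] j om h; first by rewrite sum_paths0 /uwt /= endp_nil mul1r.
rewrite u_chainS; last by have [] := h 0 0; rewrite shift0.
rewrite sum_pathsS mulr_sumr; apply: eq_bigr => z _.
rewrite -IHn ?mulr_sumr; last exact: regular_shift.
by apply: eq_bigr => l _; rewrite /uwt/= endp_cons; ring.
Qed.

Variable mb : probability (Omega R d * Zseq d)%type R.
Hypothesis pl : path_law P t u D mb.

Lemma path_law_env g : sfun setT g -> (forall om, 0 <= g om) ->
  (\int[mb]_p (g p.1)%:E = Ex P (fun om => D om * (u om * g om))%R)%E.
Proof.
move=> mg g0; rewrite (pl (K := 0%N) (f := fun p => g p.1))//.
by apply: eq_Ex => om; rewrite sum_paths0 /uwt/= mul1r endp_nil.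
Qed.

Lemma path_law_null (N : set (Omega R d)) : measurable N -> P N = 0%E ->
  mb (fst @^-1` N) = 0%E.
Proof.
move=> mN N0; have mI : sfun setT (\1_N : Env R d -> R).
  by apply: sfun_indic; rewrite -measurable_sgenT.
have mN' : measurable (fst @^-1` N : set (Omega R d * Zseq d)).
  by rewrite -[X in measurable X]setTI; exact: measurable_fst.
transitivity (\int[mb]_p (\1_N p.1)%:E)%E.
  by have := @integral_indic _ _ _ mb setT measurableT _ mN'; rewrite setIT => <-.
rewrite path_law_env//.
transitivity (Ex P (fun=> 0)); last exact: Ex_cst.
apply: ae_eq_Ex => //.
- by apply: sfunM => //; exact: sfunM.
- exact: sfun_cst.
- exists N; split => // om /= h; apply: contrapT => Nom; apply: h.
  by rewrite indicE memNset// !mulr0.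
- by move=> om; rewrite !mulr_ge0.
Qed.

Lemma ae_path_law (A : Omega R d -> Prop) :
  {ae P, forall om, A om} -> {ae mb, forall p, A p.1}.
Proof.
move=> [N [mN N0 sub]]; exists (fst @^-1` N); split.
- by rewrite -[X in measurable X]setTI; exact: measurable_fst.
- exact: path_law_null.
- by move=> p /= h; apply: sub.
Qed.

Lemma path_law_seqcyl A n : (forall i, measurable (A i)) ->
  mb (@env_path R d @^-1` [set w | forall i, (i <= n)%N -> A i (w i)]) =
  Ex P (fun om => D om * (u om * chain hk A 0 n om)).
Proof.
move=> mA; set X := (X in _ @^-1` X).
have mX : measurable (@env_path R d @^-1` X).
  rewrite -[Y in measurable Y]setTI; apply: measurable_env_path => //.
  by apply: seqcyl_measurable; exists n, A.
have XK om (s s' : Zseq d) : (forall i, (i < n)%N -> s i = s' i) ->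
    \1_(@env_path R d @^-1` X) (om, s) = \1_(@env_path R d @^-1` X) (om, s') :> R.
  move=> e; rewrite !indicE; congr (_%:R); congr nat_of_bool.
  have ee i : (i <= n)%N -> env_path (om, s) i = env_path (om, s') i.
    move=> ilen; rewrite /env_path/=; congr (shift i%:Z _ om); apply: eq_bigr => j _.
    by apply: e; apply: leq_trans ilen.
  apply/idP/idP; rewrite !inE /= => h i ilen; first by rewrite -ee//; exact: h.
  by rewrite ee//; exact: h.
have mI : measurable_fun setT (\1_(@env_path R d @^-1` X) : _ -> R).
  exact: measurable_indic.
transitivity (\int[mb]_p (\1_(@env_path R d @^-1` X) p)%:E)%E.
  by rewrite integral_indic// setIT.
rewrite (pl (K := n))//; last first.
  by move=> s; apply: measurable_sfunT; exact: (measurableT_comp mI (pair2_measurable s)).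
have mp l j : sfun setT (pind A j l).
  have mAi i : sfun setT (\1_(A i) : Env R d -> R).
    by apply: sfun_indic; rewrite -measurable_sgenT.
  elim: l j => [|z l IHl] j; first exact: mAi.
  by apply: sfunM; [exact: mAi|apply: (sfun_shift _ (IHl _))].
have pind0 l j om : 0 <= pind A j l om.
  by elim: l j om => [|z l IHl] j om /=; rewrite ?mulr_ge0// ?indicE ?ler0n.
apply: ae_eq_Ex.
- apply: sfunM => //; apply: sfun_sum => l; apply: sfunM; first exact: sfun_uwtT.
  by apply: measurable_sfunT; exact: (measurableT_comp mI (pair2_measurable (ext l))).
- by do 2!apply: sfunM => //; exact: sfun_chain.
- apply: ae_imp ae_regular => om h; rewrite -sum_uwt_pind//; congr (_ * _).
  rewrite big_seq [RHS]big_seq; apply: eq_bigr => l /size_paths hl.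
  by rewrite -pindE hl.
- by move=> om; rewrite mulr_ge0// sumr_ge0// => l _; rewrite mulr_ge0 ?uwt_ge0// indicE ler0n.
- by move=> om; rewrite !mulr_ge0// chain_ge0.
Qed.

(** Translating each term back by one step moves the weight from [g] to [D], and backward
    harmonicity sums the result up to [D]. *)
Lemma Ex_invariant g : sfun setT g -> (forall om, 0 <= g om) ->
  Ex P (fun om => D om * \sum_z t om z * g (fstep z om)) = Ex P (fun om => D om * g om).
Proof.
move=> mg g0.
have mtb z : sfun setT (fun om => t (bstep z om) z) by apply: (sfun_shift _ (tT z)).
have mDb z : sfun setT (fun om => D (bstep z om)) by apply: (sfun_shift _ mDT).
have mgf z : sfun setT (fun om => g (fstep z om)) by apply: (sfun_shift _ mg).
transitivity (Ex P (fun om => \sum_z (D om * t om z * g (fstep z om)))).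
  by apply: eq_Ex => om; rewrite mulr_sumr; apply: eq_bigr => z _; rewrite mulrA.
transitivity (Ex P (fun om => \sum_z (D (bstep z om) * t (bstep z om) z * g om))).
  rewrite !Ex_sum.
  - apply: eq_bigr => z _; rewrite -(@Ex_shift _ _ _ _ hP (-1) (- uvec z)
        (fun om => D om * t om z * g (fstep z om))).
    + by apply: eq_Ex => om; rewrite /bstep /fstep shift_shift !subrr shift0.
    + by apply: sfunM => //; exact: sfunM.
    + by move=> om; rewrite !mulr_ge0.
  - by move=> z; apply: sfunM => //; exact: sfunM.
  - by move=> z om; rewrite !mulr_ge0.
  - by move=> z; apply: sfunM => //; exact: sfunM.
  - by move=> z om; rewrite !mulr_ge0.
apply: ae_eq_Ex.
- by apply: sfun_sum => z; apply: sfunM => //; exact: sfunM.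
- exact: sfunM.
- apply: ae_imp hD => om ->; rewrite mulr_suml; apply: eq_bigr => z _.
  by rewrite [D _ * _]mulrC.
- by move=> om; apply: sumr_ge0 => z _; rewrite !mulr_ge0.
- by move=> om; rewrite mulr_ge0.
Qed.

Lemma path_law_stat_markov :
  stat_markov_ac P (pibar_theta P th u) mb (@env_path R d).
Proof.
have mch A n : (forall i, measurable (A i)) -> sfun setT (chain hk A 0 n).
  by move=> mA; exact: sfun_chain.
split=> [n A mA|S mS|n A hA A0].
- rewrite path_law_seqcyl// -path_law_env; last 2 first.
  + exact: mch.
  + by move=> om; exact: chain_ge0.
  apply: ae_eq_integral => //.
  + apply/measurable_EFinP; apply: (measurableT_comp (f := chain hk A 0 n)) => //.
    exact: sfun_measurable (mch _ _ mA).
  + apply/measurable_EFinP.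
    rewrite (_ : (fun p => _) = chain (pibar_theta P th u) A 0 n \o fst); last first.
      by apply/funext => p; rewrite /= env_path0.
    apply: measurableT_comp => //; apply: (@sfun_measurable _ _ setT).
    by apply: sfun_chain => // z; exact: sfun_pibar.
  + apply: ae_imp (ae_path_law ae_regular) => p h _.
    by rewrite env_path0 chain_pibar.
- pose tail (w : OmegaN R d) : OmegaN R d := fun i => w i.+1.
  have mtail : measurable_fun setT tail.
    apply: (@measurability _ _ _ (OmegaN R d) setT _ (@seqgen R d) erefl).
    move=> _ [_ [i [A [mA ->]]] <-]; rewrite setTI.
    by apply: sub_sigma_algebra; exists i.+1, A.
  have mW := @measurable_env_path R d.
  have mWt := measurableT_comp mtail mW.
  pose m1 := pushforward mb (tail \o (@env_path R d : _ -> OmegaN R d)).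
  pose m2 := pushforward mb (@env_path R d : _ -> OmegaN R d).
  have := @seqcyl_unique R d m1 m2; apply => //.
    by rewrite /m1 /= /pushforward preimage_setT [X in (X < _)%E]probability_setT ltry.
  move=> _ [n [A [mA ->]]]; rewrite /m1 /m2 /= /pushforward path_law_seqcyl//.
  (* Prepending [setT] turns the tail event into an ordinary cylinder whose first coordinate is
     free, so that [Ex_invariant] applies. *)
  pose A' i := if i is j.+1 then A j else setT.
  transitivity (mb (@env_path R d @^-1` [set w | forall i, (i <= n.+1)%N -> A' i (w i)])).
    congr (mb _); apply/seteqP; split=> p /= h.
      by move=> [//|i]; exact: h.
    by move=> i il; exact: (h i.+1).
  have mA' i : measurable (A' i) by case: i => [|i]; [exact: measurableT|exact: mA].
  rewrite path_law_seqcyl//.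
  have mg : sfun setT (fun om => u om * chain hk A 0 n om) by apply: sfunM => //; exact: mch.
  rewrite -(Ex_invariant mg); last by move=> om; rewrite mulr_ge0// chain_ge0.
  apply: ae_eq_Ex.
  + by do 2!apply: sfunM => //; exact: sfun_chain.
  + apply: sfunM => //; apply: sfun_sum => z; apply: sfunM => //.
    by apply: (sfun_shift _ mg).
  + apply: ae_imp hu => om h; rewrite u_chainS// indicE in_setT mul1r.
    by congr (_ * _); apply: eq_bigr => z _; rewrite chain_shift.
  + by move=> om; rewrite mulr_ge0// mulr_ge0// chain_ge0.
  + move=> om; rewrite mulr_ge0// sumr_ge0// => z _.
    by rewrite !mulr_ge0// chain_ge0.
- rewrite (_ : _ @^-1` _ = fst @^-1` A); last first.
    by apply/seteqP; split=> p /=; rewrite env_path0.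
  apply: path_law_null => //.
  by move: hA; rewrite /Bplus env_genE; exact: sgen_measurable.
Qed.

End StationaryMarkov.

(** * Uniqueness of the marginal *)

Section SubDensity.
Variables (R : realType) (d : nat) (P nu : probability (Omega R d) R).
Local Notation site := (int * Zd d)%type.

(** The Radon-Nikodym derivative of the restrictions, taken on the space that carries only [sgen I],
    so that [phi] depends on the sites in [I] alone. *)
Lemma sub_density (I : set site) :
  (forall A, <<s sgen I >> A -> P A = 0%E -> nu A = 0%E) ->
  exists phi : Env R d -> R, [/\ sfun I phi, (forall om, 0 <= phi om) &
    forall f, sfun I f -> (forall om, 0 <= f om) ->
      (\int[nu]_om (f om)%:E = Ex P (fun om => phi om * f om)%R)%E].
Proof.
move=> ac.
have idm : measurable_fun (setT : set (Omega R d)) (id : Omega R d -> Om I).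
  by move=> _ B mB; rewrite setTI; exact: (sgen_measurable mB).
pose X : {mfun Omega R d >-> Om I} := HB.pack (id : Omega R d -> Om I)
  (isMeasurableFun.Build _ _ _ _ _ idm).
pose PI : probability (Om I) R := distribution P X.
pose nuI : probability (Om I) R := distribution nu X.
have dom : nuI `<< PI by apply/null_content_dominatesP => A mA; exact: ac.
pose g := Radon_Nikodym_SigmaFinite.f nuI PI.
have g0 := Radon_Nikodym_SigmaFinite.f_ge0 dom.
have gfin := Radon_Nikodym_SigmaFinite.f_fin_num dom.
have mg : measurable_fun setT g.
  by have := Radon_Nikodym_SigmaFinite.f_integrable dom => /integrableP[].
have mphi : measurable_fun setT (fine \o g) by exact: (measurableT_comp _ mg).
exists (fine \o g); split => //.
  by move=> om; apply: fine_ge0; exact: g0.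
move=> f mf f0.
have mfE : measurable_fun (setT : set (Om I)) (EFin \o f) by apply/measurable_EFinP.
have fE0 : forall om : Om I, (0 <= (f om)%:E)%E by move=> om; rewrite lee_fin.
transitivity (\int[nuI]_om (f om)%:E)%E.
  by rewrite (ge0_integral_pushforward idm _ measurableT mfE)// => om _; rewrite lee_fin.
rewrite -(Radon_Nikodym_SigmaFinite.change_of_variables dom fE0 measurableT mfE).
rewrite (ge0_integral_pushforward idm P measurableT); last 2 first.
- exact: emeasurable_funM.
- by move=> om _; rewrite mule_ge0.
apply: eq_integral => om _ /=.
by rewrite EFinM fineK// muleC.
Qed.

Lemma Ex_eq_ae a b : sfun setT a -> sfun setT b ->
  (forall om, 0 <= a om) -> (forall om, 0 <= b om) -> (Ex P a < +oo)%E ->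
  Ex P a = Ex P b -> {ae P, forall om, b om <= a om} -> {ae P, forall om, a om = b om}.
Proof.
move=> ma mb a0 b0 afin eab le.
have mab : measurable_fun setT (fun om : Omega R d => (a om - b om)%:E).
  by apply/measurable_EFinP; apply: (@sfun_measurable _ _ setT); exact: sfunB.
have e : (\int[P]_om `|(a om - b om)%:E| = 0)%E.
  transitivity (\int[P]_om (a om - b om)%:E)%E.
    apply: ae_eq_integral => //.
    - exact: measurableT_comp.
    - apply: ae_imp le => om h _; rewrite /= ger0_norm// subr_ge0//.
  rewrite integral_diff//.
  - by rewrite -/(Ex P a) -/(Ex P b) -eab subee// ge0_fin_numE// Ex_ge0.
  - exact: sfun_measurable ma.
  - exact: sfun_measurable mb.
  - by rewrite -/(Ex P b) -eab.
have := (ae_eq_integral_abs P measurableT mab).1 e.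
apply: ae_imp => om /(_ I) [] /eqP; rewrite subr_eq0 => /eqP.
by [].
Qed.

End SubDensity.

Section MarginalUnique.
Variables (R : realType) (d : nat) (P : probability (Omega R d) R) (c1 : R).
Hypothesis hP : env_assumptions P c1.
Variables (th : 'rV[R]_d) (t : Env R d -> U d -> R).
Hypothesis t_meas : forall z, sfun [set (0, 0)] (t^~ z).
Hypothesis t_gt0 : forall om z, 0 < t om z.
Hypothesis t_tilt : {ae P, forall om, forall n x z, t (shift n x om) z = tilt P th (shift n x om) z}.
Local Notation site := (int * Zd d)%type.
Local Notation future := [set s : site | 0 <= s.1].
Variable u : Env R d -> R.
Hypothesis d1 : (0 < d)%N.
Hypothesis mu : sfun future u.
Hypothesis u0 : forall om, 0 < u om.
Hypothesis Eu : Ex P u = 1%E.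
Hypothesis hu : {ae P, forall om, harm t u om}.

Let t_ge0 om z : 0 <= t om z. Proof. exact: ltW. Qed.
Let u_ge0 om : 0 <= u om. Proof. exact: ltW. Qed.
Let tF z : sfun future (t^~ z). Proof. by apply: (sfun_sub _ (t_meas z)) => _ ->. Qed.
Let tT z : sfun setT (t^~ z). Proof. by apply: (sfun_sub _ (t_meas z)). Qed.
Let muT : sfun setT u. Proof. by apply: (sfun_sub _ mu). Qed.
Local Notation hk := (hker t u).
Let hk_gt0 := hker_gt0 t_gt0 u0 d1.
Let hk_ge0 om z : 0 <= hk om z. Proof. exact: ltW. Qed.

Let uF z : sfun future (fun om => u (fstep z om)).
Proof. by apply: (sfun_shift _ mu) => s /=; lia. Qed.

Lemma sfun_hker z : sfun future (hk^~ z).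
Proof.
apply: sfunM; first exact: sfunM.
apply: (@measurable_inv_pos _ (Om future) R _ (hker_den t_gt0 u0 d1)).
by apply: (@sfun_sum _ _ future) => z'; exact: sfunM.
Qed.

Let mhk z : sfun setT (hk^~ z). Proof. by apply: (sfun_sub _ (sfun_hker z)). Qed.

(** The [n]-step transition probability into [A] for the transformed kernel. *)
Definition nstep A n om := \sum_(l <- paths d n) wt hk l om * \1_A (endp l om).

Lemma chain_nstep k A B j n om : (forall i, (i < j + n)%N -> B i = setT) -> B (j + n)%N = A ->
  chain k B j n om = \sum_(l <- paths d n) wt k l om * \1_A (endp l om) :> R.
Proof.
elim: n j om => [|n IHn] j om hB hA.
  by rewrite sum_paths0 mul1r endp_nil /= -hA addn0.
rewrite /= hB ?indicE ?in_setT ?mul1r; last by lia.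
rewrite sum_pathsS; apply: eq_bigr => z _.
rewrite (IHn j.+1) ?mulr_sumr; last 2 first.
- by move=> i ij; apply: hB; rewrite -addSnnS.
- by rewrite addSnnS.
by apply: eq_bigr => l _; rewrite endp_cons mulrA.
Qed.

Lemma wt_hk_ge0 l om : 0 <= wt hk l om.
Proof. exact: wt_ge0. Qed.

Lemma nstep_ge0 A n om : 0 <= nstep A n om.
Proof. by apply: sumr_ge0 => l _; rewrite mulr_ge0 ?wt_hk_ge0// indicE ler0n. Qed.

Lemma sfun_wt_hk l : sfun future (wt hk l).
Proof.
elim: l => [|z l IHl]; first exact: sfun_cst.
apply: sfunM; first exact: sfun_hker.
by apply: (sfun_shift _ IHl) => s /=; lia.
Qed.

(** Each step raises the layers by one, so after [n] steps an event on layers from [- n] on is seen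
    from the layers [0] on. *)
Lemma sfun_nstep A n : <<s sgen [set s : site | - n%:Z <= s.1] >> A -> sfun future (nstep A n).
Proof.
move=> hA.
have mI : sfun [set s : site | - n%:Z <= s.1] (\1_A : Env R d -> R) by exact: sfun_indic.
have h l : size l = n -> sfun future (fun om => wt hk l om * \1_A (endp l om)).
  move=> ln; apply: sfunM; first exact: sfun_wt_hk.
  by apply: (sfun_shift _ mI) => s /=; rewrite ln; lia.
(* [sfun_sum] asks for measurability of the term of every list, whereas only lists of length [n]
   give a future function; the test discards the others. *)
rewrite (_ : nstep A n = fun om => \sum_(l <- paths d n)
    (if size l == n then wt hk l om * \1_A (endp l om) else 0)); last first.
  apply/funext => om; rewrite /nstep big_seq [RHS]big_seq; apply: eq_bigr => l /size_paths ->.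
  by rewrite eqxx.
by apply: sfun_sum => l; case: eqP => [/h//|_]; exact: sfun_cst.
Qed.

Lemma nstep_le1 A om : nstep A 1 om <= 1.
Proof.
rewrite -(hker_sum t_gt0 u0 d1 om) /nstep sum_pathsS; apply: ler_sum => z _.
by rewrite sum_paths0 /= mulr1 ler_piMr// indicE; case: (_ \in _); rewrite ?ler01 ?lexx.
Qed.

(** The factor [u] cancels the normalisation of the kernel, leaving path weights times [u * \1_A] at
    the endpoint; independence splits off [fwd t 1], of mean one. *)
Lemma Ex_u_nstep A : <<s sgen future >> A ->
  Ex P (fun om => u om * nstep A 1 om) = Ex P (fun om => u om * \1_A om).
Proof.
move=> hA; have mI : sfun future (\1_A : Env R d -> R) by exact: sfun_indic.
have mg : sfun future (fun om => u om * \1_A om) by exact: sfunM.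
have g0 om : 0 <= u om * \1_A om by rewrite mulr_ge0// indicE ler0n.
transitivity (Ex P (fun om => 1 * \sum_(l <- paths d 1) wt t l om * (u (endp l om) * \1_A (endp l om)))).
  apply: ae_eq_Ex.
  - apply: sfunM => //; have := @sfun_nstep A 1 => h.
    apply: (sfun_sub _ (h _)) => //.
    by apply: sgen_sub hA => s /=; lia.
  - apply: sfunM; first exact: sfun_cst.
    apply: sfun_path_sum => // l; apply: (@sfun_endpT _ _ l (fun om => u om * \1_A om)).
    by apply: (sfun_sub _ mg).
  - apply: ae_imp (ae_shifts hP hu) => om h; rewrite mul1r mulr_sumr.
    apply: eq_bigr => l _; rewrite mulrA [u om * _]mulrC (wt_hker u0 l h); ring.
  - by move=> om; rewrite mulr_ge0 ?nstep_ge0.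
  - by move=> om; rewrite mul1r path_sum_ge0.
rewrite (Ex_path_indep t_meas t_ge0 hP _ mg) => //; last exact: sfun_cst.
rewrite (eq_Ex _ (g := fwd t 1)) ?(Ex_fwd1 hP t_meas t_gt0 mu u0 Eu hu) ?mul1e// => om.
by rewrite mul1r.
Qed.

Lemma sgen_regular : <<s sgen future >> [set om : Env R d | harm t u om /\
  forall z, t om z = tilt P th om z].
Proof.
have eqs f g : sfun future f -> sfun future g ->
    <<s sgen future >> [set om : Env R d | f om = g om].
  move=> mf mg; have := sfunB mf mg => /(_ measurableT [set 0] (measurable_set1 _)).
  rewrite setTI; congr (<<s _ >> _); apply/seteqP; split=> om /= /eqP.
    by rewrite subr_eq0 => /eqP.
  by rewrite -subr_eq0 => /eqP.
have h1 := eqs _ _ mu (sfun_sum (index_enum _) (fun z => sfunM (tF z) (uF z))).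
have h2 z : <<s sgen future >> [set om : Env R d | t om z = tilt P th om z].
  apply: eqs; first exact: tF.
  by apply: sfunM; [exact: sfun_coord|exact: sfun_cst].
rewrite (_ : [set om | _] = [set om | harm t u om] `&`
  \bigcap_(z in [set: U d]) [set om | t om z = tilt P th om z]); last first.
  by apply/seteqP; split=> om [a b]; split => // z; [move=> _|]; exact: b.
apply: (@measurableI _ (Om future)) => //.
apply: (@fin_bigcap_measurable _ (Om future)) => [|z _]; [exact: finite_finset|exact: h2].
Qed.

Context (dX : measure_display) (X : measurableType dX) (Q : probability X R).
Variable W : X -> nat -> Omega R d.
Hypothesis mW : measurable_fun setT (W : X -> OmegaN R d).
Hypothesis hQ : stat_markov_ac P (pibar_theta P th u) Q W.

Lemma measurable_marginal n : measurable_fun setT (fun x => W x n).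
Proof.
move=> _ A mA; apply: (mW measurableT (Y := [set w : OmegaN R d | A (w n)])).
by apply: sub_sigma_algebra; exists n, A.
Qed.

Let W0 : {mfun X >-> Omega R d} :=
  HB.pack (fun x => W x 0%N) (isMeasurableFun.Build _ _ _ _ _ (measurable_marginal 0)).
Definition marginal : probability (Omega R d) R := distribution Q W0.

Lemma integral_marginal f : sfun setT f -> (forall om, 0 <= f om) ->
  (\int[marginal]_om (f om)%:E = \int[Q]_x (f (W x 0%N))%:E)%E.
Proof.
move=> mf f0; rewrite (ge0_integral_pushforward (measurable_marginal 0))//.
- by apply/measurable_EFinP; exact: sfun_measurable mf.
- by move=> om _; rewrite lee_fin.
Qed.

Lemma marginal_null n A : <<s sgen [set s : site | n <= s.1] >> A -> P A = 0%E ->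
  marginal A = 0%E.
Proof.
by move=> hA A0; have [_ _ h] := hQ; apply: (h n) => //; rewrite /Bplus env_genE.
Qed.

(** Regularity at a site [s] is an event on the layers from [s.1] on, so absolute continuity on that
    sigma-algebra makes it almost sure, and sites are countable. Sites at negative times are the
    reason why [Bplus n] enters for every [n]. *)
Lemma ae_marginal_regular : {ae Q, forall x, regular P th t u (W x 0%N)}.
Proof.
pose S := [set om : Env R d | harm t u om /\ forall z, t om z = tilt P th om z].
suff h (s : site) : {ae Q, forall x, S (shift s.1 s.2 (W x 0%N))}.
  apply: ae_imp (ae_forall_countable h) => x hx n y.
  exact: (hx (n, y)).
have hS : <<s sgen [set s' : site | s.1 <= s'.1] >> (shift s.1 s.2 @^-1` S).
  by apply: (preimage_shift_sgen _ sgen_regular) => s' /=; lia.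
have hN := @measurableC _ (Om [set s' : site | s.1 <= s'.1]) _ hS.
exists ((fun x => W x 0%N) @^-1` (~` (shift s.1 s.2 @^-1` S))); split.
- rewrite -[Y in measurable Y]setTI; apply: (measurable_marginal 0) => //.
  exact: sgen_measurable hN.
- apply: (@marginal_null s.1) => //.
  have aeS : {ae P, forall om : Omega R d, S (shift s.1 s.2 om)}.
    by apply: ae_imp (ae_regular hP t_tilt hu) => om h; exact: (h s.1 s.2).
  have [N [mN N0 sub]] := aeS.
  apply/eqP; rewrite eq_le measure_ge0 andbT -N0; apply: le_measure; rewrite ?inE//.
  exact: sgen_measurable hN.
- by [].
Qed.

Lemma seqcyl_marginal A n : (forall i, measurable (A i)) ->
  (Q (W @^-1` [set w | forall i, (i <= n)%N -> A i (w i)]) =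
   \int[marginal]_om (chain hk A 0 n om)%:E)%E.
Proof.
move=> mA; have [-> // _ _] := hQ.
rewrite integral_marginal; last 2 first.
- exact: sfun_chain.
- by move=> om; exact: chain_ge0.
have mc k : (forall z, sfun setT (k^~ z)) ->
    measurable_fun setT (fun x => (chain k A 0 n (W x 0%N))%:E).
  move=> mk; apply/measurable_EFinP.
  apply: (measurableT_comp (f := chain k A 0 n)); last exact: measurable_marginal.
  by apply: (@sfun_measurable _ _ setT); exact: sfun_chain.
apply: ae_eq_integral => //.
- by apply: mc => z; exact: sfun_pibar.
- exact: mc.
- by apply: ae_imp ae_marginal_regular => x h _; rewrite (chain_pibar _ _ _ h).
Qed.

(** Stationarity replaces time 0 by time [n], and the Markov property reads the law at time [n] off
    the marginal. *)
Lemma marginal_invariant A n : measurable A ->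
  (marginal A = \int[marginal]_om (nstep A n om)%:E)%E.
Proof.
move=> mA.
transitivity (Q (W @^-1` [set w | A (w n)])).
  elim: n => [//|n ->]; have [_ h _] := hQ.
  by rewrite -(h [set w | A (w n)])//; apply: sub_sigma_algebra; exists n, A.
pose B i := if i == n then A else setT.
rewrite (_ : [set w | A (w n)] = [set w | forall i, (i <= n)%N -> B i (w i)]); last first.
  apply/seteqP; split=> w /= h; last by have := h n (leqnn n); rewrite /B eqxx.
  by move=> i _; rewrite /B; case: eqP => // ->.
rewrite seqcyl_marginal => [|i]; last by rewrite /B; case: ifP.
apply: eq_integral => om _; congr EFin; apply: chain_nstep; rewrite /B ?eqxx// => i.
by rewrite add0n => /ltn_eqF ->.
Qed.

(* The density phi of the marginal and u are both invariant under one step, so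
   (phi - u)(1_E - k 1_E) has zero mean for E = {u < phi} while being
   nonnegative; hence every step from E stays in E. *)
Lemma marginal_future f : sfun future f -> (forall om, 0 <= f om) ->
  (\int[marginal]_om (f om)%:E = Ex P (fun om => u om * f om)%R)%E.
Proof.
have [phi [mphi phi0 hphi]] := sub_density (@marginal_null 0).
suff e : {ae P, forall om, phi om = u om}.
  move=> mf f0; rewrite hphi//.
  have mfT : sfun setT f by apply: (sfun_sub _ mf).
  have mphiT : sfun setT phi by apply: (sfun_sub _ mphi).
  apply: ae_eq_Ex; [exact: sfunM|exact: sfunM| | |] => //.
  - by apply: ae_imp e => om ->.
  - by move=> om; rewrite mulr_ge0.
  - by move=> om; rewrite mulr_ge0.
have mphiT : sfun setT phi by apply: (sfun_sub _ mphi).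
have Ephi : Ex P phi = 1%E.
  transitivity (Ex P (fun om => phi om * 1)); first by apply: eq_Ex => om; rewrite mulr1.
  rewrite -(hphi (fun=> 1)) ?integral_cst//=; last exact: sfun_cst.
  by rewrite mul1e [LHS]probability_setT.
pose E := [set om : Env R d | u om < phi om].
have hE : <<s sgen future >> E.
  have := sfunB mphi mu => /(_ measurableT `]0, +oo[%classic (measurable_itv _)).
  rewrite setTI; congr (<<s _ >> _); apply/seteqP; split=> om /=;
    by rewrite /E/= in_itv/= andbT subr_gt0.
have mE : measurable (E : set (Omega R d)) by exact: sgen_measurable hE.
have mI : sfun future (\1_E : Env R d -> R) by exact: sfun_indic.
have mIT : sfun setT (\1_E : Env R d -> R) by apply: (sfun_sub _ mI).
have I0 om : 0 <= \1_E om :> R by rewrite indicE ler0n.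
have mf : sfun future (nstep E 1) by apply: sfun_nstep; apply: sgen_sub hE => s /=; lia.
have mfT : sfun setT (nstep E 1) by apply: (sfun_sub _ mf).
have e1 : Ex P (fun om => phi om * \1_E om) = Ex P (fun om => phi om * nstep E 1 om).
  rewrite -hphi// -hphi//; last by move=> om; exact: nstep_ge0.
  by rewrite -marginal_invariant// integral_indic// setIT.
have bnd v w : sfun setT v -> sfun setT w -> (forall om, 0 <= v om) -> (forall om, 0 <= w om) ->
    (forall om, w om <= 1) -> Ex P v = 1%E -> (Ex P (fun om => v om * w om)%R < +oo)%E.
  move=> mv mw v0 w0 w1 Ev; apply: (@le_lt_trans _ _ 1%E); last exact: ltry.
  rewrite -Ev; apply: Ex_le => //; first exact: sfunM.
    by move=> om; rewrite mulr_ge0.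
  by move=> om; rewrite ler_piMr.
have k0 om := nstep_ge0 E 1 om.
have aeq : {ae P, forall om, phi om * \1_E om + u om * nstep E 1 om =
                             phi om * nstep E 1 om + u om * \1_E om}.
  apply: Ex_eq_ae.
  - by apply: sfunD; exact: sfunM.
  - by apply: sfunD; exact: sfunM.
  - by move=> om; rewrite addr_ge0// mulr_ge0.
  - by move=> om; rewrite addr_ge0// mulr_ge0.
  - rewrite Ex_D; [|exact: sfunM|exact: sfunM|by move=> om; rewrite mulr_ge0|by move=> om; rewrite mulr_ge0].
    apply: lte_add_pinfty; apply: bnd => // om; exact: nstep_le1.
  - rewrite !Ex_D; try (by exact: sfunM); try (by move=> om; rewrite mulr_ge0).
    by rewrite e1 Ex_u_nstep.
  - apply: aeW => om; rewrite -subr_ge0.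
    have -> : phi om * \1_E om + u om * nstep E 1 om - (phi om * nstep E 1 om + u om * \1_E om) =
      (phi om - u om) * (\1_E om - nstep E 1 om) by ring.
    have [Eom|nEom] := pselect (E om); rewrite indicE.
      by rewrite mem_set// mulr_ge0 ?subr_ge0 ?nstep_le1//; exact: ltW.
    by rewrite memNset//= mulr_le0 ?subr_le0//; rewrite leNgt; apply/negP.
pose z0 : U d := (Ordinal d1, true).
have stepE : {ae P, forall om, E om -> E (fstep z0 om)}.
  apply: ae_imp aeq => om h Eom.
  have k1 : nstep E 1 om = 1.
    move: h; rewrite indicE mem_set//= !mulr1 => h.
    have : (phi om - u om) * (1 - nstep E 1 om) = 0 by lra.
    move/eqP; rewrite mulf_eq0 subr_eq0 gt_eqF//= subr_eq0 => /eqP ->.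
    by [].
  have s0 : \sum_z hk om z * (1 - \1_E (fstep z om)) = 0 :> R.
    transitivity (\sum_z hk om z - nstep E 1 om); last by rewrite k1 (hker_sum t_gt0 u0 d1) subrr.
    rewrite /nstep sum_pathsS -sumrB; apply: eq_bigr => z _.
    by rewrite sum_paths0 /= endp_cons endp_nil; ring.
  apply: contrapT => nE; move: s0 => /eqP; rewrite psumr_eq0; last first.
    by move=> z _; rewrite mulr_ge0// subr_ge0.
  move=> /allP /(_ z0); rewrite mem_index_enum => /(_ isT) /=.
  by rewrite indicE memNset// subr0 mulr1 gt_eqF.
have fin1 : (1 < +oo :> \bar R)%E by exact: ltry.
(* In either case one of the two densities dominates the other almost surely, and both have mean
   one. *)
have [PE|PE] := inv_zero_one hP hE stepE.
  have le : {ae P, forall om, phi om <= u om}.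
    exists E; split => // om /= /negP; rewrite -ltNge; exact.
  have := Ex_eq_ae muT mphiT u_ge0 phi0 _ _ le; rewrite Eu Ephi => /(_ fin1 erefl).
  by apply: ae_imp => om ->.
have le : {ae P, forall om, u om <= phi om}.
  by apply: ae_imp (prob1_ae mE PE) => om /ltW.
by have := Ex_eq_ae mphiT muT phi0 u_ge0 _ _ le; rewrite Eu Ephi => /(_ fin1 erefl).
Qed.

Lemma marginal_window A n : <<s sgen [set s : site | - n%:Z <= s.1] >> A ->
  marginal A = Ex P (fun om => u om * nstep A n om).
Proof.
move=> hA; rewrite (marginal_invariant n (sgen_measurable hA)) marginal_future//.
  exact: sfun_nstep.
by move=> om; exact: nstep_ge0.
Qed.

End MarginalUnique.

Section Uniqueness.
Variables (R : realType) (d : nat) (P : probability (Omega R d) R) (c1 : R).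
Hypothesis hP : env_assumptions P c1.
Variables (th : 'rV[R]_d) (t : Env R d -> U d -> R).
Hypothesis t_meas : forall z, sfun [set (0, 0)] (t^~ z).
Hypothesis t_gt0 : forall om z, 0 < t om z.
Hypothesis t_tilt : {ae P, forall om, forall n x z, t (shift n x om) z = tilt P th (shift n x om) z}.
Variable u : Env R d -> R.
Hypothesis d1 : (0 < d)%N.
Hypothesis mu : sfun [set s : int * Zd d | 0 <= s.1] u.
Hypothesis u0 : forall om, 0 < u om.
Hypothesis Eu : Ex P u = 1%E.
Hypothesis hu : {ae P, forall om, harm t u om}.

(** Cylinder probabilities depend on the marginal only, and marginals are compared on events of
    horizon [m], which read layers from [- m] on. Allowing two underlying spaces lets the path
    measure, read through [env_path], be compared with a law given directly on sequences. *)
Lemma stat_markov_unique (dX dY : measure_display) (X : measurableType dX)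
    (Y : measurableType dY) (Q : probability X R) (Q' : probability Y R)
    (W : X -> nat -> Omega R d) (W' : Y -> nat -> Omega R d) :
  measurable_fun setT (W : X -> OmegaN R d) -> measurable_fun setT (W' : Y -> OmegaN R d) ->
  stat_markov_ac P (pibar_theta P th u) Q W -> stat_markov_ac P (pibar_theta P th u) Q' W' ->
  forall S : set (OmegaN R d), measurable S -> Q (W @^-1` S) = Q' (W' @^-1` S).
Proof.
move=> mW mW' hQ hQ' S mS.
pose m1 := pushforward Q (W : X -> OmegaN R d).
pose m2 := pushforward Q' (W' : Y -> OmegaN R d).
have := @seqcyl_unique R d m1 m2; apply => //.
  by rewrite /m1 /= /pushforward preimage_setT [Z in (Z < _)%E]probability_setT ltry.
move=> _ [n [A [mA ->]]]; rewrite /m1 /m2 /= /pushforward.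
rewrite (seqcyl_marginal hP t_meas t_gt0 t_tilt d1 mu u0 hu mW hQ n mA).
rewrite (seqcyl_marginal hP t_meas t_gt0 t_tilt d1 mu u0 hu mW' hQ' n mA).
apply: eq_measure_integral => B mB _.
apply: (@hor_unique _ _ setT) => //.
- by rewrite [Z in (Z < _)%E]probability_setT ltry.
- move=> C [m hC].
  have hC' : <<s sgen [set s : int * Zd d | - m%:Z <= s.1] >> C.
    by apply: sgen_sub hC => s [_ /=]; lia.
  apply: (eq_trans (marginal_window hP t_meas t_gt0 t_tilt d1 mu u0 Eu hu mW hQ hC')).
  exact: esym (marginal_window hP t_meas t_gt0 t_tilt d1 mu u0 Eu hu mW' hQ' hC').
- by rewrite -measurable_sgenT.
Qed.

End Uniqueness.

Unset Implicit Arguments.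

Theorem theorem1p20 (R : realType) (d : nat) (P : probability (Omega R d) R) (c1 : R) :
  (3 <= d)%N -> env_assumptions P c1 ->
  exists eta : R, 0 < eta /\
  forall xi : 'rV[R]_d, enorm (xi - xi_o P) < eta ->
  exists th : 'rV[R]_d,
    [/\ grad (Lambda_c P) th = xi,
        (forall th' : 'rV[R]_d, grad (Lambda_c P) th' = xi -> th' = th) &
    exists u : Omega R d -> R,
      [/\ measurable_wrt (Bplus 0) u,
          (forall om, 0 < u om),
          (\int[P]_om (u om)%:E = 1)%E,
          {ae P, forall om : Omega R d, harmonic_at P th u om} &
       (exists mb : probability (Omega R d * Zseq d)%type R, is_mubar P th mb) /\
       (forall mb : probability (Omega R d * Zseq d)%type R, is_mubar P th mb ->
          stat_markov_ac P (pibar_theta P th u) mb (@env_path R d) /\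
          forall Q : probability (OmegaN R d) R,
            stat_markov_ac P (pibar_theta P th u) Q id ->
            forall S : set (OmegaN R d), measurable S ->
              Q S = mb (@env_path R d @^-1` S))]].
Proof.
move=> d3 hP; have d1 : (0 < d)%N by exact: leq_trans d3.
have [r [r0 hr]] := second_moment_bound hP d3.
have [eta [eta0 heta]] := theta_exists hP r0.
exists eta; split => // xi /heta [th [/hr [B hB] hth]].
exists th; split => //.
  by move=> th' hth'; exact: (grad_Lambda_inj hP hth).
have [u [mu u0 Eu hu]] := fwd_density hP d1 hB.
have [D [mD D0 ED hD]] := bwd_limit hP hB.
have t_meas := sfun_tw P c1 th; have t_gt0 := tw_gt0 hP th.
have t_tilt := ae_tw_tilt hP th.
exists u; split => //.
- exact/measurable_wrt_BplusP.
- apply: ae_imp2 hu t_tilt => om h1 h2; rewrite /harmonic_at h1; apply: eq_bigr => z _.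
  by have := h2 0 0 z; rewrite shift0 => ->.
have [mb0 pl] := path_law_exists hP t_meas t_gt0 mu u0 Eu hu mD D0 ED hD d1.
have is0 := path_law_mubar hP t_meas t_gt0 mu u0 Eu hu mD D0 ED hD t_tilt pl.
split; first by exists mb0.
move=> mb ismb.
have mbE X : measurable X -> mb X = mb0 X by exact: mubar_unique ismb is0 X.
(* Every measure satisfying the defining identity coincides with the constructed one and so inherits
   its path law. *)
have plb : path_law P (tw P c1 th) u D mb.
  move=> K f f0 fK mf; rewrite -(pl K f f0 fK mf).
  by apply: eq_measure_integral => X mX _; exact: mbE.
have st := path_law_stat_markov hP t_meas t_gt0 t_tilt d1 mu u0 hu mD D0 hD plb.
have mW := @measurable_env_path R d.
split => // Q hQ S mS.
have mid : measurable_fun setT (id : OmegaN R d -> OmegaN R d) by exact: measurable_id.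
exact: (stat_markov_unique hP t_meas t_gt0 t_tilt d1 mu u0 Eu hu mid mW hQ st mS).
Qed.
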